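(* Assume that the terminal data satisfy $$\|f_0^\varepsilon-f_0\|_{H^1(\Omega)}+\|f_1^\varepsilon-f_1\|\le\varepsilon .$$ Let $\varepsilon\in(0,1)$ be a sufficiently small number such that $\gamma:=\gamma(\varepsilon)\ge e^{2/C_1}$. Suppose that $$3C_1T<2\qquad\text{and}\qquad \lim_{\varepsilon\to0}\gamma^2(\varepsilon)\,\varepsilon\le K ,$$ where $K$ is a constant. Assume that the original system $$u_{tt}+u_t-\Delta u-\Delta u_t=0\ \text{ in }\Omega\times(0,T),\qquad u=0\ \text{ on }\partial\Omega\times(0,T),\qquad u(\cdot,T)=f_0,\ u_t(\cdot,T)=f_1\ \text{ in }\Omega$$ admits a unique solution $u$ such that $u\in C([0,T];\mathbb{W})$ and $u_t\in L^2(0,T;\mathbb{W})$, where $\mathbb{W}$ is the function space associated with the perturbing operator $\mathbf{Q}_\varepsilon$. Let $M>0$ be such that $$\|u\|^2_{C([0,T];\mathbb{W})}+\|u_t\|^2_{L^2(0,T;\mathbb{W})}\le M .$$ Let $u^\varepsilon$ be the unique weak solution of the regularized system $$u^\varepsilon_{tt}+u^\varepsilon_t+\Delta u^\varepsilon+\Delta u^\varepsilon_t=\mathbf{P}_\varepsilon u^\varepsilon+\mathbf{P}_\varepsilon u^\varepsilon_t\ \text{ in }\Omega\times(0,T),$$ $$u^\varepsilon=0\ \text{ on }\partial\Omega\times(0,T),\qquad u^\varepsilon(\cdot,T)=f_0^\varepsilon,\ u^\varepsilon_t(\cdot,T)=f_1^\varepsilon\ \text{ in }\Omega ,$$ with $\mathbf{P}_\varepsilon=2\Delta+\mathbf{Q}_\varepsilon$.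 Then for $0\le t\le T$ the following error estimates hold: $$\|u^\varepsilon(t)-u(t)\|^2\le C\left(\varepsilon+(\log(\gamma))^{-1}\gamma^{3C_1(T-t)-2}\right),$$ $$\|\nabla u^\varepsilon(t)-\nabla u(t)\|^2\le C\left(\log(\gamma)\,\varepsilon+\gamma^{3C_1(T-t)-2}\right),$$ $$\|u^\varepsilon_t(t)-u_t(t)\|^2+\int_t^T\|\nabla u^\varepsilon_t(s)-\nabla u_t(s)\|^2\,ds\le C\left((\log(\gamma))^2\varepsilon+\log(\gamma)\,\gamma^{3C_1(T-t)-2}\right),$$ where $C=C(K,M,C_0,C_1)>0$ is independent of $\varepsilon$.
   Context: $T>0$ and $\Omega\subset\mathbb{R}^d$ ($d=1,2,3$) is a regular bounded domain with sufficiently smooth boundary. $\langle\cdot,\cdot\rangle$ and $\|\cdot\|$ denote the inner product and norm of $L^2(\Omega)$; $\langle\cdot,\cdot\rangle_{H^{-1},H^1_0}$ is the duality pairing. $\varepsilon\in(0,1)$ is the noise level; $f_0,f_0^\varepsilon\in H^1(\Omega)$ and $f_1,f_1^\varepsilon\in L^2(\Omega)$. $\gamma=\gamma(\varepsilon)\ge1$ is a function of $\varepsilon$ with $\lim_{\varepsilon\to0}\gamma(\varepsilon)=\infty$. Perturbing operator: a family of $\varepsilon$-dependent linear mappings $\mathbf{Q}_\varepsilon:L^2(\Omega)\to L^2(\Omega)$ for which there exist a function space $\mathbb{W}\subset L^2(\Omega)$ and a constant $C_0>0$ independent of $\varepsilon$ with $\|\mathbf{Q}_\varepsilon h\|\le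 C_0\|h\|_{\mathbb{W}}/\gamma(\varepsilon)$ for any $h\in\mathbb{W}$. Stabilized operator: a family of $\varepsilon$-dependent linear mappings $\mathbf{P}_\varepsilon:L^2(\Omega)\to L^2(\Omega)$ for which there is a constant $C_1>0$ independent of $\varepsilon$ with $\|\mathbf{P}_\varepsilon h\|\le C_1\log(\gamma(\varepsilon))\|h\|$ for any $h\in L^2(\Omega)$. Both operators act in the variable $x$ only. Throughout, $\mathbf{Q}_\varepsilon$ is a perturbing operator (with space $\mathbb{W}$ and constant $C_0$) and $\mathbf{P}_\varepsilon=2\Delta+\mathbf{Q}_\varepsilon$ is a stabilized operator (with constant $C_1$). Weak solution of the regularized system: it is obtained through the equivalent system for $v^\varepsilon(x,t)=e^{\rho(t-T)}u^\varepsilon(x,t)$, where $\rho>1$ is a constant. Here $v=v^\varepsilon\in L^2(0,T;H^1_0(\Omega))$ with $v_t\in L^2(0,T;H^1(\Omega))$ and $v_{tt}\in L^2(0,T;H^{-1}(\Omega))$ satisfies, for every $\varphi\in H^1_0(\Omega)$ and a.e. $t\in(0,T)$, $$\langle v_{tt}(t),\varphi\rangle_{H^{-1},H^1_0}+(1-2\rho)\langle v_t(t),\varphi\rangle+(\rho^2-\rho)\langle v(t),\varphi\rangle+(\rho-1)\langle\nabla v(t),\nabla\varphi\rangle-\langle\nabla v_t(t),\nabla\varphi\rangle=(1-\rho)\langle\mathbf{P}_\varepsilon v(t),\varphi\rangle+\langle\mathbf{P}_\varepsilon v_t(t),\varphi\rangle,$$ together with $v(x,T)=f_0^\varepsilon(x)$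 and $v_t(x,T)=\rho f_0^\varepsilon(x)+f_1^\varepsilon(x)$ in $\Omega$. *)

(* Defs.v *)
From HB Require Import structures.
From mathcomp Require Import all_boot all_order all_algebra.
From mathcomp Require Import all_classical all_reals all_analysis.
Set Implicit Arguments.
Unset Strict Implicit.
Unset Printing Implicit Defensive.
Import Order.TTheory GRing.Theory Num.Theory.
Import numFieldNormedType.Exports.
Local Open Scope classical_set_scope.
Local Open Scope ring_scope.

HB.instance Definition _ (R : realType) (n : nat) :=
  @isMeasurable.Build (sigma_display (@open 'rV[R]_n)) 'rV[R]_n
    <<s @open 'rV[R]_n >> (@sigma_algebra0 _ setT _) (@sigma_algebraC _ _)
    (@sigma_algebra_bigcup _ setT _).

(* Lebesgue measure on R^n (row vectors, with the Borel sigma-algebra), built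
   by iterating the product with the one-dimensional Lebesgue measure;
   [lebesgue_rV_box] characterizes it. *)
Section lebesgue_rV.
Context {R : realType}.

Definition box n (q : {ffun 'I_n -> rat * rat}) : set 'rV[R]_n :=
  [set v | forall i, v 0 i \in `]ratr (q i).1, ratr (q i).2[].

Lemma open_box n (q : {ffun 'I_n -> rat * rat}) : open (box q).
Proof.
rewrite openE => v vq; exists (fun _ j => `]ratr (q j).1, ratr (q j).2[%classic).
  move=> i j; rewrite ord1; apply: open_nbhs_nbhs; split; last exact: vq.
  exact: interval_open.
by move=> w /= wq i; have := wq 0 i.
Qed.

Lemma open_bigcup_box n (U : set 'rV[R]_n) : open U ->
  U = \bigcup_(q in [set q | box q `<=` U]) box q.
Proof.
move=> oU; apply/seteqP; split => [v Uv|v [q qU /qU//]].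
have /nbhs_ballP[e /= e0 veU] : nbhs v U by exact: open_nbhs_nbhs.
have P i : exists q : rat * rat, v 0 i - e < ratr q.1 < v 0 i /\
    v 0 i < ratr q.2 < v 0 i + e.
  have /rat_in_itvoo[p /itvP pe] : v 0 i - e < v 0 i by rewrite ltrBlDr ltrDl.
  have /rat_in_itvoo[q /itvP qe] : v 0 i < v 0 i + e by rewrite ltrDl.
  by exists (p, q); rewrite !pe !qe.
have [f fP] := choice P.
exists [ffun i => f i]; last first.
  by move=> i; rewrite ffunE in_itv/=; have [/andP[_ ->] /andP[-> _]] := fP i.
move=> w wf; apply: veU; rewrite /ball/=; split => // i j; rewrite (ord1 i).
have := wf j; rewrite ffunE in_itv/= => /andP[wl wr].
have [/andP[l _] /andP[_ r]] := fP j.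
rewrite /ball/= distrC ltr_distl (lt_trans l wl)/=; exact: lt_trans r.
Qed.

Lemma measurable_rVE n : @measurable _ 'rV[R]_n = <<s @open 'rV[R]_n >>.
Proof. by []. Qed.

Lemma open_measurable_rV n (U : set 'rV[R]_n) : open U -> measurable U.
Proof. by move=> oU; exact: sub_sigma_algebra. Qed.

Lemma continuous_measurable_rV n (f : 'rV[R]_n -> R) :
  continuous f -> measurable_fun setT f.
Proof.
move=> cf; apply: (measurability _ (measurable_realfun.RGenOpens.measurableE R)) => _ [_ [a [b ->]] <-].
rewrite setTI; apply: open_measurable_rV.
by apply: open_comp => //; exact: interval_open.
Qed.


Definition cons_rV n (p : measurableTypeR R * 'rV[R]_n) : 'rV[R]_n.+1 :=
  \row_j (if unlift ord0 j is Some k then p.2 0 k else p.1).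

Definition uncons_rV n (v : 'rV[R]_n.+1) : measurableTypeR R * 'rV[R]_n :=
  (v 0 0, \row_j v 0 (lift ord0 j)).

Lemma cons_rV0 n p : @cons_rV n p 0 0 = p.1.
Proof. by rewrite mxE unlift_none. Qed.

Lemma cons_rVS n p j : @cons_rV n p 0 (lift ord0 j) = p.2 0 j.
Proof. by rewrite mxE liftK. Qed.

Lemma cons_rVK n : cancel (@cons_rV n) (@uncons_rV n).
Proof.
move=> [x w]; rewrite /uncons_rV cons_rV0; congr pair.
by apply/rowP => j; rewrite mxE cons_rVS.
Qed.

Lemma uncons_rVK n : cancel (@uncons_rV n) (@cons_rV n).
Proof.
move=> v; apply/rowP => j.
case: (unliftP ord0 j) => [k|] ->; first by rewrite cons_rVS mxE.
by rewrite cons_rV0.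
Qed.

Lemma measurable_cons_rV n : measurable_fun setT (@cons_rV n).
Proof.
apply: (measurability _ (measurable_rVE _)) => _ [U oU <-]; rewrite setTI.
rewrite (open_bigcup_box oU) preimage_bigcup.
rewrite bigcup_mkcond; apply: countable_bigcupT_measurable => // q.
case: ifPn => _; last exact: measurable0.
pose q' : {ffun 'I_n -> rat * rat} := [ffun j => q (lift ord0 j)].
rewrite (_ : _ @^-1` _ =
    `]ratr (q ord0).1, ratr (q ord0).2[%classic `*` box q').
  apply: measurableX; first exact: measurable_itv.
  by apply: open_measurable_rV; exact: open_box.
apply/seteqP; split => [[x w] /= h|[x w] /= [hx hw] j].
  split; first by have := h ord0; rewrite cons_rV0.
  by move=> j; have := h (lift ord0 j); rewrite cons_rVS ffunE.
case: (unliftP ord0 j) => [k|] ->; last by rewrite cons_rV0.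
by rewrite cons_rVS; have := hw k; rewrite ffunE.
Qed.

Lemma measurable_uncons_rV n : measurable_fun setT (@uncons_rV n).
Proof.
apply: measurable_fun_pair.
  by apply: continuous_measurable_rV; exact: coord_continuous.
apply: (measurability _ (measurable_rVE _)) => _ [U oU <-]; rewrite setTI.
apply: open_measurable_rV; apply: open_comp => // v _.
move=> A [P PA sPA].
exists (fun i j => if unlift ord0 j is Some k then P 0 k else setT).
  move=> i j; case: unliftP => [k|] -> //; last exact: filterT.
  by have := PA 0 k; rewrite mxE (ord1 i).
move=> w /= wP; apply: sPA => i j; rewrite mxE.
by have := wP 0 (lift ord0 j); rewrite liftK (ord1 i).
Qed.

HB.instance Definition _ n :=
  isMeasurableFun.Build _ _ _ _ (@cons_rV n) (@measurable_cons_rV n).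
HB.instance Definition _ n :=
  isMeasurableFun.Build _ _ _ _ (@uncons_rV n) (@measurable_uncons_rV n).

Section step.
Variables (n : nat) (mu : {sigma_finite_measure set 'rV[R]_n -> \bar R}).

Definition lebesgue_cons : set 'rV[R]_n.+1 -> \bar R :=
  pushforward (lebesgue_measure \x mu)%E (@cons_rV n).

Let lebesgue_cons0 : lebesgue_cons set0 = 0%E.
Proof. exact: measure0. Qed.

Let lebesgue_cons_ge0 A : (0 <= lebesgue_cons A)%E.
Proof. exact: measure_ge0. Qed.

Let lebesgue_cons_sigma_additive : semi_sigma_additive lebesgue_cons.
Proof. exact: measure_semi_sigma_additive. Qed.

HB.instance Definition _ := isMeasure.Build _ _ _ lebesgue_cons
  lebesgue_cons0 lebesgue_cons_ge0 lebesgue_cons_sigma_additive.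

Let lebesgue_cons_sigma_finite : sigma_finite setT lebesgue_cons.
Proof.
have /sigma_finiteP[F [TF ndF Foo]] := sigma_finiteT (@lebesgue_measure R).
have /sigma_finiteP[G [TG ndG Goo]] := sigma_finiteT mu.
exists (fun k => @uncons_rV n @^-1` (F k `*` G k)).
  apply/seteqP; split => // v _.
  have [i _ Fi] : (\bigcup_i F i) (uncons_rV v).1 by rewrite -TF.
  have [j _ Gj] : (\bigcup_i G i) (uncons_rV v).2 by rewrite -TG.
  exists (maxn i j) => //; split.
    by apply: subsetPset Fi; exact: ndF (leq_maxl _ _).
  by apply: subsetPset Gj; exact: ndG (leq_maxr _ _).
move=> k; have [mF Fk] := Foo k; have [mG Gk] := Goo k; split.
  rewrite -[X in measurable X]setTI; apply: measurable_uncons_rV => //.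
  exact: measurableX.
rewrite /lebesgue_cons /pushforward -comp_preimage.
rewrite (_ : _ \o _ = idfun); last by apply/funext => p /=; rewrite cons_rVK.
by rewrite preimage_id product_measure1E// lte_mul_pinfty// ge0_fin_numE.
Qed.

HB.instance Definition _ := Measure_isSigmaFinite.Build _ _ _ lebesgue_cons
  lebesgue_cons_sigma_finite.

End step.

Fixpoint lebesgue_rV n : {sigma_finite_measure set 'rV[R]_n -> \bar R} :=
  if n is m.+1 then lebesgue_cons (lebesgue_rV m) else \d_(0 : 'rV[R]_0).

Lemma measurable_cbox n (a b : 'rV[R]_n) :
  measurable [set v : 'rV[R]_n | forall i, v 0 i \in `[a 0 i, b 0 i]].
Proof.
rewrite (_ : mkset _ = \bigcap_(i in [set: 'I_n])
    ((fun v : 'rV[R]_n => v 0 i) @^-1` `[a 0 i, b 0 i]%classic)).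
  apply: fin_bigcap_measurable => // i _.
  rewrite -[X in measurable X]setTI.
  by apply: continuous_measurable_rV => //; exact: coord_continuous.
by apply/seteqP; split => v vab i; [move=> _; exact: vab|exact: vab].
Qed.

Lemma lebesgue_rV_box n (a b : 'rV[R]_n) : (forall i, a 0 i <= b 0 i) ->
  lebesgue_rV n [set v : 'rV[R]_n | forall i, v 0 i \in `[a 0 i, b 0 i]] =
  (\prod_i (b 0 i - a 0 i))%:E.
Proof.
elim: n a b => [|n IH] a b ab.
  by rewrite big_ord0 /= diracE mem_set// => -[].
rewrite big_ord_recl.
pose t (v : 'rV[R]_n.+1) : 'rV[R]_n := (uncons_rV v).2.
have tE v j : t v 0 j = v 0 (lift ord0 j) by rewrite mxE.
set A := mkset _.
have AE : @cons_rV n @^-1` A = `[a 0 0, b 0 0]%classic `*`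
    [set v : 'rV[R]_n | forall i, v 0 i \in `[t a 0 i, t b 0 i]].
  apply/seteqP; split => [[x w] /= h|[x w] /= [hx hw] j].
    split; first by have := h ord0; rewrite cons_rV0.
    by move=> j; have := h (lift ord0 j); rewrite cons_rVS !tE.
  case: (unliftP ord0 j) => [k|] ->; last by rewrite cons_rV0.
  by rewrite cons_rVS; have := hw k; rewrite !tE.
transitivity ((lebesgue_measure \x lebesgue_rV n)%E (@cons_rV n @^-1` A)) => //.
rewrite AE product_measure1E//; last exact: measurable_cbox.
rewrite IH; last by move=> i; rewrite !tE.
rewrite EFinM; congr (_ * _)%E.
  rewrite [LHS](lebesgue_measure_itv `[a 0 0, b 0 0]) /= lte_fin.
  case: ltP => // ba; rewrite (_ : a 0 0 = b 0 0) ?subrr//.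
  by apply/eqP; rewrite eq_le ba ab.
by congr EFin; apply: eq_bigr => i _; rewrite !tE.
Qed.

End lebesgue_rV.

Section sobolev.
Context {R : realType} {d : nat}.
Local Notation E := 'rV[R]_d.
Local Notation leb := (lebesgue_rV (R := R) d).
Implicit Types (Om : set E) (f g h phi : E -> R) (i : 'I_d).

Definition partial i f : E -> R := 'D_(delta_mx 0 i : E) f.

Fixpoint Ck k f : Prop :=
  continuous f /\
  if k is m.+1 then
    forall i, (forall x, derivable f x (delta_mx 0 i : E)) /\ Ck m (partial i f)
  else True.

(* C_c^oo(Om): smooth on R^d, with compact support contained in Om *)
Definition test_fun Om : set (E -> R) :=
  [set phi | (forall k, Ck k phi) /\
    compact (closure [set x | phi x != 0]) /\
    closure [set x | phi x != 0] `<=` Om].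

Record regular_domain Om : Prop := RegularDomain {
  domain_open : open Om;
  domain_connected : connected Om;
  domain_nonempty : Om !=set0;
  domain_bounded : bounded_set Om;
  (* near each boundary point, Om is one side of a C^2 hypersurface *)
  domain_boundary : forall p, (closure Om `\` Om) p ->
    exists (U : set E) (psi : E -> R),
      [/\ open_nbhs p U, Ck 2 psi, exists i, partial i psi p != 0 &
          Om `&` U = [set x | psi x < 0] `&` U] }.

(* Elements of L^2(Om) are represented by functions on R^d of which only the
   almost-everywhere class on Om matters. *)
Definition eq_ae Om f g : Prop := {ae leb, forall x, Om x -> f x = g x}.

Definition L2 Om : set (E -> R) := [set f | f \_ Om \in Lfun leb 2%:E].

Definition dot Om f g : R := \int[leb]_(x in Om) (f x * g x).

Definition norm2 Om f : R := Num.sqrt (dot Om f f).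

(* g is the weak derivative of f along the i-th coordinate *)
Definition weak_partial Om i f g : Prop :=
  L2 Om g /\ forall phi, test_fun Om phi ->
    dot Om f (partial i phi) = - dot Om g phi.

Definition H1 Om : set (E -> R) :=
  [set f | L2 Om f /\ forall i, exists g, weak_partial Om i f g].

Definition wgrad Om f : 'I_d -> E -> R :=
  fun i => get [set g | weak_partial Om i f g].

Definition dotv Om (F G : 'I_d -> E -> R) : R := \sum_i dot Om (F i) (G i).

Definition normv2 Om (F : 'I_d -> E -> R) : R := Num.sqrt (dotv Om F F).

Definition normH1 Om f : R :=
  Num.sqrt (norm2 Om f ^+ 2 + normv2 Om (wgrad Om f) ^+ 2).

Definition H10 Om : set (E -> R) :=
  [set f | H1 Om f /\ forall e, 0 < e ->
    exists2 phi, test_fun Om phi & normH1 Om (f - phi) < e].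

(* g is the distributional Laplacian of f, as an element of L^2(Om) *)
Definition is_laplacian Om f g : Prop :=
  L2 Om g /\ forall phi, test_fun Om phi ->
    dot Om f (\sum_i partial i (partial i phi)) = dot Om g phi.

(* H^{-1}(Om): an element is a functional of which only the values on H^1_0(Om)
   matter. *)
Definition Hm1 Om : set ((E -> R) -> R) :=
  [set F | (forall a f g, H10 Om f -> H10 Om g ->
              F (a *: f + g) = a * F f + F g) /\
           exists c, forall f, H10 Om f -> `|F f| <= c * normH1 Om f].

Definition normHm1 Om (F : (E -> R) -> R) : R :=
  sup [set `|F f| | f in [set f | H10 Om f /\ normH1 Om f <= 1]].

End sobolev.

(* Bochner spaces over (0, T) and [0, T] with values in the subspace X of V
   seminormed by N. *)
Section bochner.
Context {R : realType} {V : lmodType R}.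
Implicit Types (T : R) (X : set V) (N : V -> R) (u : R -> V).

Definition simple_in X : set (R -> V) :=
  [set s | exists (n : nat) (A : 'I_n -> set R) (h : 'I_n -> V),
    (forall i, measurable (A i) /\ X (h i)) /\
    forall t, s t = \sum_i \1_(A i) t *: h i].

Definition strongly_measurable T X N u : Prop :=
  exists s : nat -> R -> V, (forall n, simple_in X (s n)) /\
    {ae lebesgue_measure, forall t, t \in `]0, T[ ->
      N (s n t - u t) @[n --> \oo] --> (0 : R)}.

Definition L2time T X N u : Prop :=
  [/\ {ae lebesgue_measure, forall t, t \in `]0, T[ -> X (u t)},
      strongly_measurable T X N u &
      (\int[lebesgue_measure]_(t in `]0%R, T[) (N (u t) ^+ 2)%:E < +oo)%E].

Definition Ctime T X N u : Prop :=
  forall t, t \in `[0, T] -> X (u t) /\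
    N (u s - u t) @[s --> within `[0, T]%classic (nbhs t)] --> (0 : R).

End bochner.

Section evolution.
Context {R : realType} {d : nat}.
Local Notation E := 'rV[R]_d.
Implicit Types (Om : set E) (T : R) (u ut v vt : R -> E -> R).

Definition test_time T : set (R -> R) :=
  [set psi : R -> R | (forall n t, derivable (derive1n n psi) t 1) /\
    compact (closure [set t | psi t != 0]) /\
    closure [set t | psi t != 0] `<=` `]0, T[%classic].

(* b is the derivative of a in the sense of H^{-1}(Om)-valued distributions on
   (0, T); f in L^2(Om) is identified with the functional dot Om f. *)
Definition weak_dt Om T (a b : R -> (E -> R) -> R) : Prop :=
  forall phi psi, H10 Om phi -> test_time T psi ->
    \int[lebesgue_measure]_(t in `]0, T[) (a t phi * derive1 psi t) =
    - \int[lebesgue_measure]_(t in `]0, T[) (b t phi * psi t).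

(* vt and vtt are the first two time derivatives of v, in the regularity class
   of weak solutions; v and vt are the representatives which are continuous
   with values in H^1 and L^2 respectively, so that they have values at every
   time of [0, T]. *)
Record evolution Om T v vt (vtt : R -> (E -> R) -> R) : Prop := Evolution {
  evolution_v : L2time T (H10 Om) (normH1 Om) v;
  evolution_vt : L2time T (H1 Om) (normH1 Om) vt;
  evolution_vtt : L2time T (Hm1 Om) (normHm1 Om) vtt;
  evolution_dv : weak_dt Om T (fun t => dot Om (v t)) (fun t => dot Om (vt t));
  evolution_dvt : weak_dt Om T (fun t => dot Om (vt t)) vtt;
  evolution_cv : Ctime T (H1 Om) (normH1 Om) v;
  evolution_cvt : Ctime T (L2 Om) (norm2 Om) vt }.

(* weak solution of u_tt + u_t - Lap u - Lap u_t = 0, u = 0 on the boundary,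
   u(T) = f0 and u_t(T) = f1 *)
Definition original_solution Om T (f0 f1 : E -> R) u ut : Prop :=
  exists utt, [/\ evolution Om T u ut utt,
    forall phi, H10 Om phi ->
      {ae lebesgue_measure, forall t, t \in `]0, T[ ->
        utt t phi + dot Om (ut t) phi
        + dotv Om (wgrad Om (u t)) (wgrad Om phi)
        + dotv Om (wgrad Om (ut t)) (wgrad Om phi) = 0},
    eq_ae Om (u T) f0 & eq_ae Om (ut T) f1].

(* u, with time derivative ut, is the weak solution of
   u_tt + u_t + Lap u + Lap u_t = P u + P u_t, u = 0 on the boundary,
   u(T) = f0 and u_t(T) = f1, defined through the equation satisfied by
   v(t) = e^{rho (t - T)} u(t) *)
Definition regularized_solution Om T (P : (E -> R) -> E -> R) (rho : R)
    (f0 f1 : E -> R) u ut : Prop :=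
  [/\ weak_dt Om T (fun t => dot Om (u t)) (fun t => dot Om (ut t)),
      Ctime T (L2 Om) (norm2 Om) ut &
      let v t := expR (rho * (t - T)) *: u t in
      exists vt vtt, [/\ evolution Om T v vt vtt,
        forall phi, H10 Om phi ->
          {ae lebesgue_measure, forall t, t \in `]0, T[ ->
            vtt t phi + (1 - 2 * rho) * dot Om (vt t) phi
            + (rho ^+ 2 - rho) * dot Om (v t) phi
            + (rho - 1) * dotv Om (wgrad Om (v t)) (wgrad Om phi)
            - dotv Om (wgrad Om (vt t)) (wgrad Om phi)
            = (1 - rho) * dot Om (P (v t)) phi + dot Om (P (vt t)) phi},
        eq_ae Om (v T) f0 & eq_ae Om (vt T) (rho *: f0 + f1)]].

End evolution.

Section operators.
Context {R : realType} {d : nat}.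
Local Notation E := 'rV[R]_d.
Implicit Types (Om : set E) (W : set (E -> R)) (nW : (E -> R) -> R).
Implicit Types (A : (E -> R) -> E -> R) (P Q : R -> (E -> R) -> E -> R).

(* A linear mapping of L^2(Om) into itself, acting on representatives *)
Record linear_L2 Om A : Prop := LinearL2 {
  linear_L2_stable : forall f, L2 Om f -> L2 Om (A f);
  linear_L2_eq_ae : forall f g, L2 Om f -> L2 Om g ->
    eq_ae Om f g -> eq_ae Om (A f) (A g);
  linear_L2_linear : forall a f g, L2 Om f -> L2 Om g ->
    eq_ae Om (A (a *: f + g)) (a *: A f + A g) }.

(* W is a linear subspace of L^2(Om) endowed with the norm nW *)
Record function_space Om W nW : Prop := FunctionSpace {
  fspace_L2 : W `<=` L2 Om;
  fspace_eq_ae : forall f g, W f -> L2 Om g -> eq_ae Om f g ->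
    W g /\ nW g = nW f;
  fspace_0 : W 0;
  fspace_linear : forall a f g, W f -> W g -> W (a *: f + g);
  fspace_eq0 : forall f, W f -> nW f = 0 -> eq_ae Om f 0;
  fspace_normZ : forall a f, W f -> nW (a *: f) = `|a| * nW f;
  fspace_normD : forall f g, W f -> W g -> nW (f + g) <= nW f + nW g }.

Definition perturbing Om W nW (gamma : R -> R) (C0 : R) Q : Prop :=
  [/\ 0 < C0, function_space Om W nW &
      forall eps, 0 < eps < 1 -> linear_L2 Om (Q eps) /\
        forall h, W h -> norm2 Om (Q eps h) <= C0 * nW h / gamma eps].

Definition stabilized Om (gamma : R -> R) (C1 : R) P : Prop :=
  0 < C1 /\ forall eps, 0 < eps < 1 -> linear_L2 Om (P eps) /\
    forall h, L2 Om h -> norm2 Om (P eps h) <= C1 * ln (gamma eps) * norm2 Om h.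

(* P = 2 Lap + Q, with Lap the Dirichlet Laplacian. The identity cannot hold
   on all of L^2(Om), since Lap does not map L^2(Om) into itself. It is required
   for the h in H^1_0(Om) such that Lap h is in L^2(Om), and on W, the space on
   which Q is controlled; as P h and Q h are in L^2(Om), so is Lap h then. *)
Definition twice_laplacian_plus Om W (P Q : (E -> R) -> E -> R) : Prop :=
  forall h, H10 Om h -> W h \/ (exists g, is_laplacian Om h g) ->
    exists2 g, is_laplacian Om h g & eq_ae Om (P h) (2 *: g + Q h).

End operators.

(* Main.v *)
(* Put L = C1 log gamma >= 2, w = u^eps - u and z = e^{L(t-T)} w. In terms of u^eps
   the weighted problem for v does not depend on rho, and paired with test
   functions z satisfies
     z_tt = (2L-1) z_t - (L^2-L) z + (L-1) Lap z - Lap z_t + (1-L) P z + P z_t + q,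
   where q = e^{L(t-T)} (P u + P u_t - 2 Lap u - 2 Lap u_t) is the image of u and u_t
   under Q, so that |q| <= C0 (|u|_W + |u_t|_W) / gamma, while |P h| <= L |h|.
   Multiplying by z_t, the terms in P are absorbed by those in L; a backward
   Gronwall argument bounds
     |z_t|^2 + (L^2-L) |z|^2 + (L-1) |grad z|^2   and   int_t^T |grad z_t|^2
   by e^{L(T-t)} A, where A <= 2 L^2 eps^2 + O(1 / (L gamma^2)). Removing the weight costs
   e^{2L(T-t)}, and the total factor e^{3L(T-t)} = gamma^{3 C1 (T-t)} is at most gamma^2,
   which eps gamma^2 <= K + 1 compensates.
   As P = 2 Lap + Q only holds on H^1_0 (with W), one needs u_t(t) in H^1_0 for
   almost every t. *)
Require Import Defs.
From mathcomp Require Import all_boot all_order all_algebra.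
From mathcomp Require Import all_classical all_reals all_analysis.
From mathcomp Require Import measurable_realfun ring lra.
Set Implicit Arguments.
Unset Strict Implicit.
Unset Printing Implicit Defensive.
Import Order.TTheory GRing.Theory Num.Theory.
Import numFieldNormedType.Exports.
Local Open Scope classical_set_scope.
Local Open Scope ring_scope.

(** * Semi-inner products and functions of time *)

(** The equation is given only against fixed test functions, for almost every time, while [zt] is
    merely continuous in L^2. Everything is therefore reduced to scalar functions of time: the du
    Bois-Reymond lemma turns each tested equation into a primitive valid at every interior time, and
    norms are recovered as suprema of pairings with test functions ([energy_frame]). This calls for
    the density of test functions in L^2 and, for gradients, in L^2 vector fields. The parameter
    [rho] disappears because multiplication by [e^(s (t - T))] sends [damped_eqn c] to
    [damped_eqn (c + s)]: one goes from [rho] to 0, subtracts the original problem there, and goes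
    on to [L]. The Gronwall rate is [L] because the term [P z] costs [(L - 1) L^2 |z|^2], which is
    [L] times the part [(L^2 - L) |z|^2] of the energy. The condition [3 C1 T < 2] makes the
    exponent nonpositive and also bounds [T] by [2 / (3 C1)], which removes [T] from the constant.
    Norms of time derivatives need not be measurable in time, so their integrals are only bounded
    from above, through almost-everywhere majorants. *)

Lemma is_derive_derive1 {R : realType} (f : R -> R) (t df : R) :
  derivable f t 1 -> derive1 f t = df -> is_derive t 1 f df.
Proof. by move=> dF <-; apply: DeriveDef; [exact: dF|rewrite derive1E]. Qed.

Section semi_inner_product.
Context {R : realType} {V : lmodType R}.
Implicit Types (X : set V) (b : V -> V -> R) (f g h : V).

(** The laws are relative to [X] because [dot] is an integral defined on all functions but additive
    only when the products are integrable. Only nonnegativity is asked of [b f f], since functions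
    stand for their almost-everywhere classes. *)
Record semi_dot X b : Prop := SemiDot {
  sd0 : X 0;
  sdX : forall a f g, X f -> X g -> X (a *: f + g);
  sdC : forall f g, X f -> X g -> b f g = b g f;
  sdL : forall a f g h, X f -> X g -> X h -> b (a *: f + g) h = a * b f h + b g h;
  sd_ge0 : forall f, X f -> 0 <= b f f }.

Definition sdnorm b f : R := Num.sqrt (b f f).

Context {X : set V} {b : V -> V -> R} (Xb : semi_dot X b).

Lemma sdXZ a f : X f -> X (a *: f).
Proof. by move=> Xf; rewrite -[_ *: _]addr0; apply: (sdX Xb) => //; exact: sd0 Xb. Qed.

Lemma sdXD f g : X f -> X g -> X (f + g).
Proof. by move=> Xf Xg; rewrite -[f]scale1r; exact: (sdX Xb). Qed.

Lemma sdXB f g : X f -> X g -> X (f - g).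
Proof. by move=> Xf Xg; rewrite addrC -scaleN1r; exact: (sdX Xb). Qed.

Lemma sd0l f : X f -> b 0 f = 0.
Proof.
move=> Xf; have X0 := sd0 Xb.
by have := sdL Xb 1 X0 X0 Xf; rewrite scale1r addr0 mul1r; lra.
Qed.

Lemma sd0r f : X f -> b f 0 = 0.
Proof. by move=> Xf; rewrite (sdC Xb) ?sd0l//; exact: sd0 Xb. Qed.

Lemma sdDl f g h : X f -> X g -> X h -> b (f + g) h = b f h + b g h.
Proof. by move=> Xf Xg Xh; rewrite -[f in LHS]scale1r (sdL Xb)// mul1r. Qed.

Lemma sdZl a f h : X f -> X h -> b (a *: f) h = a * b f h.
Proof.
move=> Xf Xh; rewrite -[_ *: _]addr0 (sdL Xb) ?sd0l ?addr0//; exact: sd0 Xb.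
Qed.

Lemma sdBl f g h : X f -> X g -> X h -> b (f - g) h = b f h - b g h.
Proof.
by move=> Xf Xg Xh; rewrite addrC -scaleN1r (sdL Xb)// mulN1r addrC.
Qed.

Lemma sdDr f g h : X f -> X g -> X h -> b h (f + g) = b h f + b h g.
Proof.
move=> Xf Xg Xh; rewrite (sdC Xb Xh (sdXD Xf Xg)) sdDl//.
by rewrite (sdC Xb Xf Xh) (sdC Xb Xg Xh).
Qed.

Lemma sdZr a f h : X f -> X h -> b h (a *: f) = a * b h f.
Proof.
by move=> Xf Xh; rewrite (sdC Xb Xh (sdXZ a Xf)) sdZl// (sdC Xb Xf Xh).
Qed.

Lemma sdBr f g h : X f -> X g -> X h -> b h (f - g) = b h f - b h g.
Proof.
move=> Xf Xg Xh; rewrite (sdC Xb Xh (sdXB Xf Xg)) sdBl//.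
by rewrite (sdC Xb Xf Xh) (sdC Xb Xg Xh).
Qed.

Lemma sdnorm_ge0 f : 0 <= sdnorm b f. Proof. exact: sqrtr_ge0. Qed.

Lemma sdnorm_sqr f : X f -> sdnorm b f ^+ 2 = b f f.
Proof. by move=> Xf; rewrite sqr_sqrtr//; exact: (sd_ge0 Xb). Qed.

Lemma sdnorm0 : sdnorm b 0 = 0.
Proof. by rewrite /sdnorm sd0l ?sqrtr0//; exact: sd0 Xb. Qed.

Lemma sdnormZ a f : X f -> sdnorm b (a *: f) = `|a| * sdnorm b f.
Proof.
move=> Xf; rewrite /sdnorm sdZl// ?sdZr//; last exact: sdXZ.
by rewrite mulrA -expr2 sqrtrM ?sqr_ge0// sqrtr_sqr.
Qed.

Lemma sdnormBC f g : X f -> X g -> sdnorm b (f - g) = sdnorm b (g - f).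
Proof.
move=> Xf Xg; rewrite -[f - g]opprB -[- (g - f)]scaleN1r sdnormZ ?normrN1 ?mul1r//.
exact: sdXB.
Qed.

(** Nonnegativity of the quadratic polynomial [s |-> b (s f + g) (s f + g)]; the form may have a
    kernel, so the case [b f f = 0] is treated apart. *)
Lemma sd_CS f g : X f -> X g -> `|b f g| <= sdnorm b f * sdnorm b g.
Proof.
move=> Xf Xg; rewrite -[leLHS]sqrtr_sqr -sqrtrM; last exact: (sd_ge0 Xb).
rewrite ler_sqrt ?mulr_ge0 ?(sd_ge0 Xb)//.
set a := b f f; set c := b g g; set d := b f g.
have q s : 0 <= s ^+ 2 * a + s * d *+ 2 + c.
  have Xs := sdXZ s Xf; have Xsg := sdXD Xs Xg.
  have := sd_ge0 Xb Xsg.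
  rewrite sdDl// !sdDr// !sdZl// !sdZr// (sdC Xb Xg Xf) -/a -/c -/d.
  by lra.
have a0 : 0 <= a by exact: (sd_ge0 Xb).
have c0 : 0 <= c by exact: (sd_ge0 Xb).
have [a00|a00] := eqVneq a 0.
  rewrite a00 mul0r; have [->|d0] := eqVneq d 0; first by rewrite expr0n.
  (* As [a = 0] the polynomial is affine, and at this point it takes the value -1. *)
  have := q (- (c + 1) / (d *+ 2)).
  rewrite a00 mulr0 add0r -mulrnAr divfK; last by rewrite mulrn_eq0.
  by lra.
have ap : 0 < a by rewrite lt_def a00.
(* The minimum point of the quadratic; [a] times the minimum is [a c - d^2]. *)
have := q (- d / a); rewrite -(ler_pM2l ap) mulr0.
rewrite (_ : a * _ = a * c - d ^+ 2) ?subr_ge0//; by field.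
Qed.

Lemma sdnormD f g : X f -> X g -> sdnorm b (f + g) <= sdnorm b f + sdnorm b g.
Proof.
move=> Xf Xg; rewrite -[leRHS]ger0_norm ?addr_ge0 ?sdnorm_ge0// -sqrtr_sqr.
rewrite ler_sqrt ?sqr_ge0// sqrrD !sdnorm_sqr// sdDl// ?sdDr//; last exact: sdXD.
rewrite (sdC Xb Xg Xf); have := le_trans (ler_norm _) (sd_CS Xf Xg).
by lra.
Qed.

Lemma sdnorm_tri f g h : X f -> X g -> X h ->
  sdnorm b (f - h) <= sdnorm b (f - g) + sdnorm b (g - h).
Proof.
move=> Xf Xg Xh; rewrite -[f in leLHS](subrK g) -addrA.
by apply: sdnormD; exact: sdXB.
Qed.

Lemma sdnorm_dist f g : X f -> X g ->
  `|sdnorm b f - sdnorm b g| <= sdnorm b (f - g).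
Proof.
move=> Xf Xg; rewrite ler_norml; apply/andP; split.
  by rewrite lerNl opprB lerBlDr sdnormBC//; have := sdnormD (sdXB Xg Xf) Xf; rewrite subrK.
by rewrite lerBlDr; have := sdnormD (sdXB Xf Xg) Xg; rewrite subrK.
Qed.

End semi_inner_product.

(** * Primitives on a closed interval *)

Section primitives.
Context {R : realType}.
Implicit Types (a b c d : R) (f g F G : R -> R).
Local Notation mu := (@lebesgue_measure R).

Definition primitive a b F f : Prop :=
  {within `[a, b], continuous F} /\
  forall t, t \in `]a, b[ -> is_derive t 1 F (f t).

Lemma within_itvP a b f : {within `[a, b], continuous f} <->
  forall t, t \in `[a, b] -> f s @[s --> within `[a, b] (nbhs t)] --> f t.
Proof.
split=> [cf t tab|cf].
  by move/subspace_continuousP: cf => /(_ t); apply.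
by apply/subspace_continuousP => t tab; apply: cf.
Qed.

Lemma within_eps a b f : {within `[a, b], continuous f} <->
  forall t, t \in `[a, b] -> forall e, 0 < e ->
  exists2 r, 0 < r & forall s, s \in `[a, b] -> `|s - t| < r -> `|f s - f t| < e.
Proof.
rewrite within_itvP; split=> [cf t tab e e0|cf t tab].
  have /cvgrPdist_lt/(_ e e0) := cf t tab.
  rewrite near_withinE => /nbhs_ballP[r/= r0 rP]; exists r => // s sab str.
  by rewrite distrC; apply: rP => //; rewrite /ball/= distrC.
apply/cvgrPdist_lt => e e0; rewrite near_withinE.
have [r r0 rP] := cf t tab e e0; apply/nbhs_ballP; exists r => //= s.
by rewrite /ball/= => str sab; rewrite distrC rP// distrC.
Qed.

Lemma primitive_sub a b c d F f : a <= c -> d <= b ->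
  primitive a b F f -> primitive c d F f.
Proof.
move=> ac db [cF dF]; split.
  by apply: continuous_subspaceW cF; apply: subset_itv; rewrite bnd_simp.
move=> t /andP[tc td]; apply: dF; rewrite in_itv/=.
by move: tc td; rewrite !bnd_simp => tc td; rewrite (le_lt_trans ac)// (lt_le_trans td).
Qed.

Lemma primitive_ex a b f : a < b -> {within `[a, b], continuous f} ->
  exists F, primitive a b F f.
Proof.
move=> ab cf; exists (fun x => \int[mu]_(t in `[a, x]) f t).
have intf : mu.-integrable `[a, b] (EFin \o f).
  by apply: continuous_compact_integrable => //; exact: segment_compact.
split; first by apply: parameterized_integral_continuous => //; exact: ltW.
move=> t tab; have := tab; rewrite in_itv/= => /andP[at' tb].
have cft : {for t, continuous f}.
  by have /(continuous_within_itvP _ ab)[+ _ _] := cf; apply.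
have [dF F'f] := continuous_FTC1_closed tb intf at' cft.
exact: is_derive_derive1.
Qed.

(** [G - F] is nondecreasing by the sign of its derivative, so increments are compared without
    integrating anything. *)
Lemma primitive_le a b F G f g : a <= b -> primitive a b F f -> primitive a b G g ->
  (forall t, t \in `]a, b[ -> f t <= g t) -> F b - F a <= G b - G a.
Proof.
move=> ab [cF dF] [cG dG] fg.
have dGF t : t \in `]a, b[ -> is_derive t 1 (G \- F) (g t - f t).
  by move=> tab; apply: is_deriveB; [exact: dG|exact: dF].
have cGF : {within `[a, b], continuous (G \- F)}.
  by move=> t; apply: cvgB; [exact: cG|exact: cF].
have : (G \- F) a <= (G \- F) b.
  apply: (@ger0_derive1_ndecr _ _ a b) => // t tab.
    by have [] := dGF t tab.
  by have D := dGF t tab; rewrite derive1E derive_val subr_ge0 fg.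
by rewrite /=; lra.
Qed.

Lemma primitiveD a b F G f g : primitive a b F f -> primitive a b G g ->
  primitive a b (fun t => F t + G t) (fun t => f t + g t).
Proof.
move=> [cF dF] [cG dG]; split; first by move=> t; apply: cvgD; [exact: cF|exact: cG].
by move=> t tab; apply: is_deriveD; [exact: dF|exact: dG].
Qed.

Lemma primitiveZ a b F f k : primitive a b F f ->
  primitive a b (fun t => k * F t) (fun t => k * f t).
Proof.
move=> [cF dF]; split; first by move=> t; apply: cvgM; [exact: cvg_cst|exact: cF].
by move=> t tab; have D := dF t tab; exact: (@is_deriveZ _ _ _ F k t 1).
Qed.

Lemma primitive_cst a b k : primitive a b (fun=> k) (fun=> 0).
Proof.
split; first by move=> t; exact: cvg_cst.
by move=> t _; exact: is_derive_cst.
Qed.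

Lemma primitive_id a b : primitive a b id (fun=> 1).
Proof.
split; first by apply: continuous_subspaceT => t; exact: cvg_id.
by move=> t _; exact: is_derive_id.
Qed.

Lemma primitive_shift a b F f h : primitive a b F f ->
  primitive (a - h) (b - h) (fun t => F (t + h)) (fun t => f (t + h)).
Proof.
move=> [cF dF]; split.
  apply/within_eps => t tab e e0.
  move/within_eps: cF => /(_ (t + h) _ e e0) []; first by move: tab; rewrite !in_itv/=; lra.
  move=> r r0 rP; exists r => // s sab str; apply: rP.
    by move: sab; rewrite !in_itv/=; lra.
  by rewrite opprD addrACA subrr addr0.
move=> t tab.
have D : is_derive (t + h) 1 F (f (t + h)).
  by apply: dF; move: tab; rewrite !in_itv/=; lra.
have := @is_derive1_comp _ F (fun t => t + h) t _ _ D.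
move=> /(_ 1); rewrite mulr1; apply.
by apply: is_derive_eq; rewrite addr0.
Qed.

Lemma primitive_integral a b F f : a <= b -> {within `[a, b], continuous f} ->
  primitive a b F f -> \int[mu]_(t in `[a, b]) f t = F b - F a.
Proof.
rewrite le_eqVlt => /predU1P[<-|ab] cf [cF dF].
  by rewrite set_itv1 Rintegral_set1 subrr.
rewrite /Rintegral (@continuous_FTC2 _ _ F)//.
- split => //.
  + by move=> t tab; have [] := dF t tab.
  + by have /(continuous_within_itvP _ ab)[] := cF.
  + by have /(continuous_within_itvP _ ab)[] := cF.
- by move=> t tab; have D := dF t tab; rewrite derive1E derive_val.
Qed.

End primitives.

(** * Smooth functions of one variable and bumps *)

Section smooth.
Context {R : realType}.
Implicit Types (a b c x t : R) (f g : R -> R) (S : set (R -> R)).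

Definition smooth f : Prop := forall n t, derivable (derive1n n f) t 1.

Lemma smoothP S : (forall f, S f -> (forall t, derivable f t 1) /\ S (derive1 f)) ->
  S `<=` smooth.
Proof.
move=> SP f Sf n; suff : S (derive1n n f) by case/SP.
by elim: n => // n IH; rewrite derive1nS; case/SP: IH.
Qed.

Lemma smooth_derivable f t : smooth f -> derivable f t 1.
Proof. by move=> /(_ 0%N). Qed.

Lemma smooth_derive1 f : smooth f -> smooth (derive1 f).
Proof.
move=> sf n t; have := sf n.+1 t; rewrite (_ : derive1n n.+1 f = derive1n n (derive1 f))//.
by rewrite /derive1n iterSr.
Qed.

Lemma smooth_is_derive f t : smooth f -> is_derive t 1 f (derive1 f t).
Proof. by move=> sf; apply: DeriveDef; [exact: smooth_derivable|rewrite derive1E]. Qed.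

Lemma smooth_continuous f : smooth f -> continuous f.
Proof.
move=> sf t; apply/differentiable_continuous/derivable1_diffP.
exact: smooth_derivable.
Qed.

Inductive smooth_alg (G : set (R -> R)) : set (R -> R) :=
| smooth_alg_gen f : G f -> smooth_alg G f
| smooth_alg_cst c : smooth_alg G (fun=> c)
| smooth_alg_add f g : smooth_alg G f -> smooth_alg G g ->
    smooth_alg G (fun x => f x + g x)
| smooth_alg_mul f g : smooth_alg G f -> smooth_alg G g ->
    smooth_alg G (fun x => f x * g x).

(** By the sum and product rules the algebra generated by [G] is stable under derivation as soon as
    the derivatives of the generators lie in it. The generators are not assumed smooth beforehand,
    which suits the family [theta k], whose derivatives involve higher [k]. *)
Lemma smooth_alg_smooth G :
  (forall g, G g -> exists2 g', smooth_alg G g' & forall t, is_derive t 1 g (g' t)) ->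
  smooth_alg G `<=` smooth.
Proof.
move=> GP.
have H f : smooth_alg G f ->
    exists2 f', smooth_alg G f' & forall t, is_derive t 1 f (f' t).
  elim=> {f}[f Gf|c|f g Gf [f' Gf' Df] Gg [g' Gg' Dg]|f g Gf [f' Gf' Df] Gg [g' Gg' Dg]].
  - exact: GP.
  - by exists (fun=> 0); [exact: smooth_alg_cst|move=> t; exact: is_derive_cst].
  - exists (fun x => f' x + g' x); first exact: smooth_alg_add.
    by move=> t; exact: is_deriveD.
  - exists (fun x => f x * g' x + g x * f' x).
      by apply: smooth_alg_add; apply: smooth_alg_mul.
    by move=> t; exact: is_deriveM.
apply: smoothP => f /H[f' Gf' Df]; split; first by move=> t; have [] := Df t.
rewrite (_ : derive1 f = f')//; apply/funext => t.
by have D := Df t; rewrite derive1E derive_val.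
Qed.

Lemma smooth_alg_smooth_id : smooth_alg smooth `<=` smooth.
Proof.
apply: smooth_alg_smooth => f sf; exists (derive1 f) => [|t].
  by apply: smooth_alg_gen; exact: smooth_derive1.
exact: smooth_is_derive.
Qed.

Lemma smooth_cst c : smooth (fun=> c).
Proof. by apply: smooth_alg_smooth_id; exact: smooth_alg_cst. Qed.

Lemma smoothD f g : smooth f -> smooth g -> smooth (fun x => f x + g x).
Proof.
by move=> sf sg; apply: smooth_alg_smooth_id; apply: smooth_alg_add; exact: smooth_alg_gen.
Qed.

Lemma smoothM f g : smooth f -> smooth g -> smooth (fun x => f x * g x).
Proof.
by move=> sf sg; apply: smooth_alg_smooth_id; apply: smooth_alg_mul; exact: smooth_alg_gen.
Qed.

Lemma smooth_antiderivative f g : smooth g -> (forall t, is_derive t 1 f (g t)) ->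
  smooth f.
Proof.
move=> sg D [|n] t; first by have [] := D t.
rewrite /derive1n iterSr (_ : derive1 f = g); first exact: sg.
by apply/funext => x; have Dx := D x; rewrite derive1E derive_val.
Qed.

Lemma smooth_affine f a b : smooth f -> smooth (fun x => f (a * x + b)).
Proof.
move=> sf.
pose G := [set g | exists2 f, smooth f & g = fun x => f (a * x + b)].
apply: (@smooth_alg_smooth G); last by apply: smooth_alg_gen; exists f.
move=> _ [h sh ->]; exists (fun x => derive1 h (a * x + b) * a).
  apply: smooth_alg_mul; last exact: smooth_alg_cst.
  by apply: smooth_alg_gen; exists (derive1 h); [exact: smooth_derive1 sh|].
move=> t; apply: is_derive1_comp; first exact: smooth_is_derive.
by apply: is_derive_eq; rewrite addr0 [_ *: _]mulr1.
Qed.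

(* [theta k x = x^-k e^(-1/x)] for [x > 0], so that [theta 0] is smooth and
   vanishes exactly on the negative half line. *)
Definition theta k x : R := if 0 < x then x^-1 ^+ k * expR (- x^-1) else 0.

Lemma theta_ge0 k x : 0 <= theta k x.
Proof. by rewrite /theta; case: ifPn => // x0; rewrite mulr_ge0 ?expR_ge0// exprn_ge0// invr_ge0 ltW. Qed.

(** With [y = 1/x], one term of the exponential series gives [y^(k+2) <= (k+2)! e^y]; the two extra
    powers leave the factor [x^2], whence continuity at 0 for every [k]. *)
Lemma theta_le k x : theta k x <= (k.+2)`!%:R * x ^+ 2.
Proof.
rewrite /theta; case: ifPn => [x0|_]; last by rewrite mulr_ge0 ?sqr_ge0.
have xV0 : 0 < x^-1 by rewrite invr_gt0.
have := expR_ge1Dxn k.+1 (ltW xV0).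
set F := (_`!%:R) => h.
have F0 : 0 < F by rewrite ltr0n fact_gt0.
have {}h : x^-1 ^+ k.+2 <= F * expR x^-1.
  by rewrite mulrC -ler_pdivrMr//; apply: le_trans h; rewrite lerDr.
rewrite expRN ler_pdivrMr ?expR_gt0//.
have -> : x^-1 ^+ k = x^-1 ^+ k.+2 * x ^+ 2.
  by rewrite -addn2 exprD -mulrA -exprMn mulVf ?expr1n ?mulr1// gt_eqF.
by rewrite [leRHS]mulrAC ler_wpM2r// sqr_ge0.
Qed.

Lemma theta_continuous0 k : {for 0, continuous (theta k)}.
Proof.
have t0 : theta k 0 = 0 by rewrite /theta ltxx.
rewrite /prop_for/continuous_at t0; apply: (@squeeze_cvgr _ _ _ _ (fun=> 0) (fun x => (k.+2)`!%:R * x ^+ 2)).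
- by near=> x; rewrite theta_ge0 theta_le.
- exact: cvg_cst.
- have H : (k.+2)`!%:R * x ^+ 2 @[x --> (0 : R)] --> ((k.+2)`!%:R * 0 ^+ 2 : R).
    by apply: cvgM; [exact: cvg_cst|exact: exprn_continuous].
  by move: H; rewrite expr0n mulr0.
Unshelve. all: by end_near. Qed.

Lemma theta_is_derive k x :
  is_derive x 1 (theta k) (theta k.+2 x + (- k%:R) * theta k.+1 x).
Proof.
have [x0|x0|->] := ltgtP x 0.
- rewrite {2 3}/theta !ltNge !(ltW x0)/= mulr0 addr0.
  apply: (@near_eq_is_derive _ _ _ (fun=> 0)).
  by near=> y; rewrite /theta ltNge ltW//; near: y; exact: lt_nbhsl.
- rewrite {2 3}/theta x0.
  have xn0 : x != 0 by rewrite gt_eqF.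
  have DV : is_derive x 1 (fun y : R => y^-1) (- x^-1 ^+ 2).
    by apply: (is_derive_eq (is_deriveV xn0 (is_derive_id x 1))); rewrite scaler1 exprVn.
  have DX := is_deriveX k DV.
  have DE : is_derive x 1 (fun y : R => expR (- y^-1)) (expR (- x^-1) * x^-1 ^+ 2).
    apply: is_derive1_comp.
    by apply: (is_derive_eq (is_deriveN DV)); rewrite opprK.
  have DM := is_deriveM DX DE.
  have ND : \near x, ((fun y : R => y^-1) ^+ k * (fun y : R => expR (- y^-1))) x = theta k x.
    near=> y; rewrite /theta ifT; last by near: y; exact: lt_nbhsr.
    by rewrite [in LHS]/GRing.mul/= exprfctE.
  apply: (is_derive_eq (near_eq_is_derive ND DM)).
  rewrite [LHS]/= !fctE /GRing.scale/=.
  case: k {DX DM ND} => [|k]/=; first by rewrite !expr0 !mul0r !mulr0 mul1r oppr0; ring.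
  by rewrite !exprS; ring.
- rewrite /theta ltxx mulr0 addr0 -/(theta _ _).
  (* The slope from 0 is [theta k z / z = theta (k+1) z], continuous at 0 with value 0. *)
  apply/is_derive1_caratheodory; exists (theta k.+1); split.
  + move=> z; rewrite !subr0 /theta ltxx subr0; case: ifPn => [z0|_]; last by rewrite mul0r.
    by rewrite exprS [RHS]mulrC !mulrA divff ?mul1r ?gt_eqF.
  + exact: theta_continuous0.
  + by rewrite /theta ltxx.
Unshelve. all: by end_near. Qed.

Lemma theta_smooth : smooth (theta 0).
Proof.
pose G := [set f | exists k, f = theta k].
apply: (@smooth_alg_smooth G); last by apply: smooth_alg_gen; exists 0%N.
move=> _ [k ->]; exists (fun x => theta k.+2 x + (- k%:R) * theta k.+1 x).
  apply: smooth_alg_add; first by apply: smooth_alg_gen; exists k.+2.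
  apply: smooth_alg_mul; first exact: smooth_alg_cst.
  by apply: smooth_alg_gen; exists k.+1.
exact: theta_is_derive.
Qed.

Lemma theta0_gt0 x : 0 < x -> 0 < theta 0 x.
Proof. by move=> x0; rewrite /theta x0 expr0 mul1r expR_gt0. Qed.

Lemma theta0_le1 x : theta 0 x <= 1.
Proof.
rewrite /theta; case: ifPn => // x0.
by rewrite expr0 mul1r expR_le1 oppr_le0 invr_ge0 ltW.
Qed.

(** Positive exactly on []a, b[], with values in [[0, 1]]. The dilation by [n + 1] makes these
    functions tend pointwise to the indicator of the interval; [n = 0] serves where a single bump is
    enough. *)
Definition sbump a b (n : nat) x : R :=
  theta 0 (n.+1%:R * (x - a)) * theta 0 (n.+1%:R * (b - x)).

Lemma sbump_smooth a b n : smooth (sbump a b n).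
Proof.
rewrite /sbump; apply: smoothM.
  rewrite (_ : (fun x => _) = (fun x => theta 0 (n.+1%:R * x + - (n.+1%:R * a)))).
    by apply: smooth_affine; exact: theta_smooth.
  by apply/funext => x; rewrite mulrBr.
rewrite (_ : (fun x => _) = (fun x => theta 0 (- n.+1%:R * x + n.+1%:R * b))).
  by apply: smooth_affine; exact: theta_smooth.
by apply/funext => x; rewrite mulrBr addrC mulNr.
Qed.

Lemma sbump_ge0 a b n x : 0 <= sbump a b n x.
Proof. by rewrite mulr_ge0 ?theta_ge0. Qed.

Lemma sbump_le1 a b n x : sbump a b n x <= 1.
Proof. by rewrite mulr_ile1 ?theta_ge0 ?theta0_le1. Qed.

Lemma sbump_gt0 a b n x : a < x < b -> 0 < sbump a b n x.
Proof.
by move=> /andP[ax xb]; rewrite mulr_gt0// theta0_gt0// mulr_gt0// subr_gt0.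
Qed.

Lemma sbump_eq0 a b n x : ~~ (a < x < b) -> sbump a b n x = 0.
Proof.
rewrite negb_and -!leNgt /sbump /theta => /orP[xa|bx].
  by rewrite ifF ?mul0r//; apply/negbTE; rewrite -leNgt mulr_ge0_le0// subr_le0.
by rewrite mulrC ifF ?mul0r//; apply/negbTE; rewrite -leNgt mulr_ge0_le0// subr_le0.
Qed.

Lemma theta_cvg x : 0 < x -> theta 0 (n.+1%:R * x) @[n --> \oo] --> (1 : R).
Proof.
move=> x0; rewrite (_ : (fun n => _) = (fun n : nat => expR (- (n.+1%:R^-1 * x^-1)))).
  have H : expR (- (n.+1%:R^-1 * x^-1)) @[n --> \oo] --> (expR (- (0 * x^-1)) : R).
    apply: continuous_cvg; first exact: continuous_expR.
    by apply: cvgN; apply: cvgMr_tmp; exact: cvg_harmonic.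
  by move: H; rewrite mul0r oppr0 expR0.
by apply/funext => n; rewrite /theta mulr_gt0// expr0 mul1r invfM.
Qed.

Lemma sbump_cvg a b x : sbump a b n x @[n --> \oo] --> (\1_(`]a, b[%classic) x : R).
Proof.
rewrite indicE; have [|xab] := boolP (x \in `]a, b[).
  rewrite in_itv/= => /andP[ax xb].
  rewrite mem_set/= ?in_itv/= ?ax// -[X in _ --> X](mulr1 1).
  by apply: cvgM; apply: theta_cvg; rewrite subr_gt0.
rewrite memNset/=; last exact/negP.
rewrite (_ : (fun n => _) = (fun=> 0)); first exact: cvg_cst.
by apply/funext => n; rewrite sbump_eq0//; move: xab; rewrite in_itv.
Qed.

End smooth.

(** * The du Bois-Reymond lemma for continuous functions of time *)

Section du_bois_reymond.
Context {R : realType}.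
Implicit Types (a b c r s t x T : R) (f g A B D psi : R -> R).
Local Notation mu := (@lebesgue_measure R).

(** A smooth step: the difference of two of its translates has compact support, and the derivative
    of that difference is a difference of two bumps. *)
Lemma sbump_antiderivative a b : exists2 H : R -> R,
  (forall t, is_derive t 1 H (sbump a b 0 t)) &
  (forall x, x <= a -> H x = 0) /\ (forall x, b <= x -> H x = H b).
Proof.
(* The integral starts at [a - 1], so that [a] itself is an interior point for the fundamental
   theorem. *)
pose H x : R := \int[mu]_(t in `[a - 1, x]) sbump a b 0 t.
have H0 x : x <= a -> H x = 0.
  move=> xa; rewrite /H (@eq_Rintegral _ _ _ _ _ (fun=> 0)); first by rewrite Rintegral_cst// mul0r.
  move=> y; rewrite inE/= in_itv/= => /andP[_ yx]; rewrite sbump_eq0//.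
  by rewrite negb_and -leNgt (le_trans yx).
have DH t : is_derive t 1 H (sbump a b 0 t).
  have [ta|at'] := ltP t a.
    rewrite sbump_eq0; last by rewrite negb_and -leNgt ltW.
    apply: (@near_eq_is_derive _ _ _ (fun=> 0)).
    by near=> y; rewrite H0// ltW//; near: y; exact: lt_nbhsl.
  have iu : mu.-integrable `[a - 1, t + 1] (EFin \o sbump a b 0).
    apply: continuous_compact_integrable; first exact: segment_compact.
    by apply: continuous_subspaceT => x; apply: smooth_continuous; exact: sbump_smooth.
  have a1t : a - 1 < t by lra.
  have ct : {for t, continuous (sbump a b 0)}.
    by apply: smooth_continuous; exact: sbump_smooth.
  have [dH H'] := continuous_FTC1_closed (ltr_pwDr ltr01 (lexx t) : t < t + 1) iu a1t ct.
  exact: is_derive_derive1.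
exists H => //; split => // x bx.
have [|c cbx] := @MVT_segment _ H (sbump a b 0) b x bx.
  by apply: derivable_within_continuous => t _; have [] := DH t.
rewrite sbump_eq0 ?mul0r; last by move: cbx; rewrite in_itv/= => /andP[bc _]; rewrite negb_and -!leNgt bc orbT.
by move=> /eqP; rewrite subr_eq0 => /eqP.
Unshelve. all: by end_near. Qed.

Lemma test_time_bump_diff T s t r : 0 < r -> r < s -> r < t -> s < T - r -> t < T - r ->
  exists2 psi, test_time T psi &
    forall x, derive1 psi x = sbump (- r) r 0 (x - t) - sbump (- r) r 0 (x - s).
Proof.
move=> r0 rs rt sT tT; have [H DH [H0 H1]] := sbump_antiderivative (- r) r.
have sH : smooth H by apply: smooth_antiderivative DH; exact: sbump_smooth.
have sHs u : smooth (fun x => H (x - u)).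
  rewrite (_ : (fun x => _) = (fun x => H (1 * x + - u))); first exact: smooth_affine.
  by apply/funext => x; rewrite mul1r.
have [ms mt] : Num.min s t <= s /\ Num.min s t <= t by rewrite !ge_min !lexx orbT.
have [Ms Mt] : s <= Num.max s t /\ t <= Num.max s t by rewrite !le_max !lexx orbT.
have mr : r < Num.min s t by rewrite lt_min rs rt.
have Mr : Num.max s t < T - r by rewrite gt_max sT tT.
have sub : [set x | H (x - t) + -1 * H (x - s) != 0] `<=`
    `[Num.min s t - r, Num.max s t + r]%classic.
  move=> x /=; apply: contraR; rewrite in_itv/= negb_and -!ltNge => /orP[xm|mx].
    by rewrite !H0 ?mulr0 ?addr0//; lra.
  by rewrite !(@H1 (x - _)) ?mulN1r ?subrr//; lra.
exists (fun x => H (x - t) + -1 * H (x - s)).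
  split; first by apply: smoothD; [exact: sHs|apply: smoothM; [exact: smooth_cst|exact: sHs]].
  have cl : closure [set x | H (x - t) + -1 * H (x - s) != 0] `<=`
    `[Num.min s t - r, Num.max s t + r]%classic.
    rewrite [X in _ `<=` X](_ : _ = closure `[Num.min s t - r, Num.max s t + r]%classic).
      exact: closure_subset.
    by apply/closure_id; exact: interval_closed.
  split.
    apply: (subclosed_compact _ (@segment_compact _ _ _) cl).
    exact: closed_closure.
  move=> x /cl /=; rewrite !in_itv/=; lra.
move=> x; rewrite derive1E; apply: derive_val.
have Du u : is_derive x 1 (fun x => H (x - u)) (sbump (- r) r 0 (x - u)).
  have D2 : is_derive x 1 (fun x : R => x - u) 1 by apply: is_derive_eq; rewrite subr0.
  by have := @is_derive1_comp _ H _ x _ _ (DH _) D2; rewrite mulr1.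
have := is_deriveD (Du t) (is_deriveM (is_derive_cst (-1 : R) x 1) (Du s)).
move=> D; apply: (is_derive_eq D).
by rewrite /GRing.scale/= mulr0 addr0 mulN1r.
Qed.

Lemma within_integrable a b f : {within `[a, b], continuous f} ->
  mu.-integrable `[a, b] (EFin \o f).
Proof. by apply: continuous_compact_integrable; exact: segment_compact. Qed.

Lemma withinM a b f g : {within `[a, b], continuous f} ->
  {within `[a, b], continuous g} -> {within `[a, b], continuous (fun x => f x * g x)}.
Proof. by move=> cf cg x; apply: cvgM; [exact: cf|exact: cg]. Qed.

Lemma withinD a b f g : {within `[a, b], continuous f} ->
  {within `[a, b], continuous g} -> {within `[a, b], continuous (fun x => f x + g x)}.
Proof. by move=> cf cg x; apply: cvgD; [exact: cf|exact: cg]. Qed.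

Lemma withinB a b f g : {within `[a, b], continuous f} ->
  {within `[a, b], continuous g} -> {within `[a, b], continuous (fun x => f x - g x)}.
Proof. by move=> cf cg x; apply: cvgB; [exact: cf|exact: cg]. Qed.

Lemma Rintegral_oo_cc a b f : {within `[a, b], continuous f} ->
  \int[mu]_(t in `]a, b[) f t = \int[mu]_(t in `[a, b]) f t.
Proof.
move=> cf; rewrite Rintegral_itv_bndo_bndc; last by apply: integrableS (within_integrable cf) => //; exact: subset_itv_oo_cc.
rewrite Rintegral_itv_obnd_cbnd//; apply: integrableS (within_integrable cf) => //.
by apply: subset_itvr; rewrite bnd_simp.
Qed.

Lemma within_derive1_smooth a b f : smooth f -> {within `[a, b], continuous (derive1 f)}.
Proof.
by move=> sf; apply: continuous_subspaceT; apply: smooth_continuous; exact: smooth_derive1.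
Qed.

Lemma within_smooth a b f : smooth f -> {within `[a, b], continuous f}.
Proof. by move=> sf; apply: continuous_subspaceT; exact: smooth_continuous. Qed.

Lemma test_time0 T psi t : test_time T psi -> ~~ (0 < t < T) -> psi t = 0.
Proof.
move=> [_ [_ sub]] tT; apply/eqP; apply: contraNT tT => pt.
have : closure [set t | psi t != 0] t by exact: subset_closure.
by move=> /sub; rewrite /= in_itv.
Qed.

(** Suppose [D s < D t] and test with [psi] whose derivative is a bump near [t] minus the same bump
    near [s]. As [psi] vanishes at both ends, a constant may be subtracted from [D]; with the mean
    [m] of the two values, [(D - m) psi'] is nonnegative, positive at [t], and yet integrates to
    0. *)
Lemma du_bois_reymond0 T D : 0 < T -> {within `[0, T], continuous D} ->
  (forall psi, test_time T psi ->
    \int[mu]_(t in `[0, T]) (D t * derive1 psi t) = 0) ->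
  forall s t, s \in `]0, T[ -> t \in `]0, T[ -> D t <= D s.
Proof.
move=> T0 cD H s t; rewrite !in_itv/= => /andP[s0 sT] /andP[t0 tT].
rewrite leNgt; apply/negP => st.
pose m := (D s + D t) / 2.
have near u : 0 < u < T -> forall e, 0 < e -> exists2 r, 0 < r < Num.min u (T - u) &
    forall x, `|x - u| < r -> `|D x - D u| < e.
  move=> /andP[u0 uT] e e0; move/within_eps: cD => /(_ u _ e e0)[].
    by rewrite in_itv/= !ltW.
  move=> r r0 rP; set mm := Num.min u (T - u).
  have [m1 m2] : mm <= u /\ mm <= T - u by rewrite !ge_min !lexx orbT.
  have m0 : 0 < mm by rewrite lt_min u0 subr_gt0.
  exists (Num.min r (mm / 2)).
    apply/andP; split; first by rewrite lt_min r0 divr_gt0.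
    by rewrite gt_min; apply/orP; right; lra.
  move=> x; rewrite lt_min => /andP[xr]; rewrite ltr_norml => xm; apply: rP => //.
  by rewrite in_itv/=; lra.
have e0 : 0 < (D t - D s) / 2 by lra.
have [|r1 /andP[r10] + r1P] := near s _ _ e0; first by rewrite s0.
rewrite lt_min => /andP[r1s r1T].
have [|r2 /andP[r20] + r2P] := near t _ _ e0; first by rewrite t0.
rewrite lt_min => /andP[r2t r2T].
pose r := Num.min r1 r2.
have rr1 : r <= r1 by rewrite ge_min lexx.
have rr2 : r <= r2 by rewrite ge_min lexx orbT.
have r0 : 0 < r by rewrite lt_min r10.
have [||||psi tpsi dpsi] := @test_time_bump_diff T s t r r0; [lra|lra|lra|lra|].
have cdp : {within `[0, T], continuous (derive1 psi)}.
  by apply: within_derive1_smooth; exact: tpsi.1.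
have cDp := withinM cD cdp.
have [F pF] := primitive_ex T0 cDp.
have pP : primitive 0 T psi (derive1 psi).
  split; first by apply: within_smooth; exact: tpsi.1.
  by move=> x _; apply: smooth_is_derive; exact: tpsi.1.
have pG := primitiveD pF (primitiveZ (- m) pP).
set G := (fun x => _) in pG.
have GT : G T = G 0.
  have := H _ tpsi; rewrite (primitive_integral (ltW T0) cDp pF) /G.
  rewrite !(test_time0 tpsi) ?mulr0 ?addr0 ?ltxx ?andbF//.
  by move=> /eqP; rewrite subr_eq0 => /eqP.
have dG_ge0 x : D x * derive1 psi x + - m * derive1 psi x >= 0.
  rewrite -mulrDl dpsi.
  have [xt|xt] := boolP (`|x - t| < r).
    have := r2P x (lt_le_trans xt rr2); rewrite ltr_norml => /andP[Dx _].
    rewrite (@sbump_eq0 _ _ _ _ (x - s)); last first.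
      apply/negP => xs; have /r1P : `|x - s| < r1 by rewrite ltr_norml; lra.
      by rewrite ltr_norml /= => Dx'; move: Dx Dx'; rewrite /m; lra.
    by rewrite subr0 mulr_ge0 ?sbump_ge0//; move: Dx; rewrite /m; lra.
  rewrite (@sbump_eq0 _ _ _ _ (x - t)) ?sub0r; last by rewrite -ltr_norml.
  have [xs|xs] := boolP (`|x - s| < r).
    have := r1P x (lt_le_trans xs rr1); rewrite ltr_norml => /andP[_ Dx].
    rewrite -mulrNN opprK mulr_ge0 ?sbump_ge0//.
    by move: Dx; rewrite /m; lra.
  by rewrite sbump_eq0 ?oppr0 ?mulr0// -ltr_norml.
(* A nondecreasing [G] with [G T = G 0] is constant, so its derivative [(D t - m) psi'(t)] at [t]
   vanishes; both factors are however positive. *)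
have Gmono x y : 0 <= x -> x <= y -> y <= T -> G x <= G y.
  move=> x0 xy yT; have := primitive_le xy (primitive_cst _ _ 0) (primitive_sub x0 yT pG).
  by rewrite subrr subr_ge0; apply.
have Gcst x : 0 < x < T -> G x = G 0.
  move=> /andP[x0 xT]; apply/eqP; rewrite eq_le -{1}GT.
  by rewrite !Gmono ?lexx ?ltW.
have dG0 : is_derive t 1 G 0.
  apply: (@near_eq_is_derive _ _ _ (fun=> G 0)).
  near=> x; rewrite Gcst//; apply/andP; split.
    by near: x; exact: lt_nbhsr.
  by near: x; exact: lt_nbhsl.
have tT' : t \in `]0, T[ by rewrite in_itv/= t0.
have dG := pG.2 t tT'.
have : D t * derive1 psi t + - m * derive1 psi t = 0.
  by have [_ <-] := dG; have [_ ->] := dG0.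
rewrite -mulrDl dpsi subrr => /eqP; rewrite mulf_eq0 => /orP[/eqP|].
  by rewrite /m; lra.
rewrite (@sbump_eq0 _ _ _ _ (t - s)) ?subr0; last first.
  apply/negP => xs; have /r1P : `|t - s| < r1 by rewrite ltr_norml; lra.
  by rewrite ltr_norml; lra.
by rewrite gt_eqF// sbump_gt0// oppr_lt0 r0.
Unshelve. all: by end_near. Qed.

(** Let [B] be a primitive of [f]. Integration by parts shows that [A - B] is orthogonal to all
    derivatives of test functions, hence constant on the open interval, and [A] inherits the
    derivative of [B]. *)
Lemma du_bois_reymond T A f : 0 < T -> {within `[0, T], continuous A} ->
  {within `[0, T], continuous f} ->
  (forall psi, test_time T psi ->
    \int[mu]_(t in `]0, T[) (A t * derive1 psi t) =
    - \int[mu]_(t in `]0, T[) (f t * psi t)) ->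
  primitive 0 T A f.
Proof.
move=> T0 cA cf H; split => // t tT.
have [B pB] := primitive_ex T0 cf.
have cB := pB.1.
have DD := @du_bois_reymond0 T (fun t => A t - B t) T0 (withinB cA cB).
have /DD{DD} DD : forall psi, test_time T psi ->
    \int[mu]_(t in `[0, T]) ((A t - B t) * derive1 psi t) = 0.
  move=> psi tpsi; have := H psi tpsi.
  have cp : {within `[0, T], continuous psi} by apply: within_smooth; exact: tpsi.1.
  have cdp : {within `[0, T], continuous (derive1 psi)}.
    by apply: within_derive1_smooth; exact: tpsi.1.
  have cAp := withinM cA cdp; have cBp := withinM cB cdp; have cfp := withinM cf cp.
  rewrite !Rintegral_oo_cc// => HA.
  have HB : \int[mu]_(t in `[0, T]) (B t * derive1 psi t + f t * psi t) = 0.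
    have c2 := withinD cBp cfp.
    rewrite (primitive_integral (ltW T0) c2 (F := fun t => B t * psi t)).
      by rewrite !(test_time0 tpsi) ?mulr0 ?subrr ?ltxx ?andbF.
    split; first exact: withinM.
    move=> x xT; have dB := pB.2 x xT; have dp := @smooth_is_derive _ psi x tpsi.1.
    by apply: (is_derive_eq (is_deriveM dB dp)); rewrite /GRing.scale/= [psi x * _]mulrC.
  move: HB; rewrite RintegralD//; [|exact: within_integrable..] => HB.
  transitivity (\int[mu]_(t in `[0, T]) (A t * derive1 psi t - B t * derive1 psi t)).
    by apply: eq_Rintegral => x _; rewrite mulrBl.
  by rewrite RintegralB//; [lra|exact: within_integrable..].
have := pB.2 t tT; set k := A t - B t => dB.
apply: (@near_eq_is_derive _ _ _ (fun x => B x + k)).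
  near=> x; suff : A x - B x = k by lra.
  have xT : x \in `]0, T[ by near: x; exact: near_in_itvoo.
  by apply/eqP; rewrite eq_le !DD.
by apply: (is_derive_eq (is_deriveD dB (is_derive_cst k t 1))); rewrite addr0.
Unshelve. all: by end_near. Qed.

End du_bois_reymond.

(** * Integrals of possibly nonmeasurable functions *)

Section nonmeasurable_integrands.
Context d (T : measurableType d) (R : realType).
Variable mu : {measure set T -> \bar R}.
Implicit Types (D : set T).
Import HBNNSimple.

Lemma ae_imp (P Q : T -> Prop) : (forall x, P x -> Q x) ->
  {ae mu, forall x, P x} -> {ae mu, forall x, Q x}.
Proof. by move=> PQ; exact: filterS. Qed.

Lemma ae_imp2 (P P' Q : T -> Prop) : (forall x, P x -> P' x -> Q x) ->
  {ae mu, forall x, P x} -> {ae mu, forall x, P' x} -> {ae mu, forall x, Q x}.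
Proof. by move=> PQ; exact: filterS2. Qed.

(* No measurability is required: the integral of a nonnegative function is the
   supremum of the integrals of the simple functions below it. *)
Lemma ge0_ae_le_integral D (f g : T -> \bar R) : 
  (forall x, D x -> (0 <= f x)%E) -> (forall x, D x -> (0 <= g x)%E) ->
  {ae mu, forall x, D x -> (f x <= g x)%E} ->
  (\int[mu]_(x in D) f x <= \int[mu]_(x in D) g x)%E.
Proof.
move=> f0 g0 [N [mN N0 fgN]].
rewrite !ge0_integralE//; apply: ge_ereal_sup => _ [h hf <-].
have mCN : measurable (~` N) by exact: measurableC.
(* Cutting [h] off on the null set [N] keeps its integral and makes the bound by [g] valid
   everywhere. *)
have -> : sintegral mu h = sintegral mu (proj_nnsfun h mCN).
  rewrite -!integralT_nnsfun; apply: ae_eq_integral => //.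
  - by apply/measurable_EFinP.
  - by apply/measurable_EFinP.
  exists N; split => // x /= hx; apply: contrapT => Nx; apply: hx => _.
  by rewrite mindicE mem_set// mulr1.
apply: ereal_sup_ubound; exists (proj_nnsfun h mCN) => // x.
rewrite /= mindicE; have [Nx|Nx] := pselect (N x).
  rewrite memNset ?mulr0; last by move=> /(_ Nx).
  by rewrite patchE; case: ifPn => // /set_mem; exact: g0.
rewrite mem_set// mulr1; apply: le_trans (hf x) _; rewrite !patchE.
case: ifPn => // /set_mem Dx.
by apply: contrapT => h'; apply: Nx; apply: fgN => /= /(_ Dx).
Qed.

Lemma ge0_ae_eq_integral_nm D (f g : T -> \bar R) : 
  (forall x, D x -> (0 <= f x)%E) -> (forall x, D x -> (0 <= g x)%E) ->
  {ae mu, forall x, D x -> f x = g x} ->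
  (\int[mu]_(x in D) f x = \int[mu]_(x in D) g x)%E.
Proof.
move=> f0 g0 fg; apply/eqP; rewrite eq_le !ge0_ae_le_integral//;
  by apply: filterS fg => x /[apply] ->.
Qed.

Lemma ae_eq_Rintegral D (f g : T -> R) :
  {ae mu, forall x, D x -> f x = g x} ->
  \int[mu]_(x in D) f x = \int[mu]_(x in D) g x.
Proof.
move=> fg; congr fine; rewrite [LHS]integralE [RHS]integralE.
congr (_ - _)%E; apply: ge0_ae_eq_integral_nm => //.
  by apply: filterS fg => x /[apply]; rewrite !funeposE => ->.
by apply: filterS fg => x /[apply]; rewrite !funenegE => ->.
Qed.

End nonmeasurable_integrands.

Lemma ae_itv_oo {R : realType} (a b : R) :
  {ae @lebesgue_measure R, forall s, `[a, b]%classic s -> s \in `]a, b[}.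
Proof.
exists ([set a] `|` [set b]); split.
- by apply: measurableU; exact: measurable_set1.
- by rewrite measureU0//; exact: lebesgue_measure_set1.
move=> s /= /not_implyP[]; rewrite !in_itv/= => /andP[as' sT] /negP.
rewrite negb_and -!leNgt => /orP[sa|Ts]; [left|right]; apply/eqP; rewrite eq_le.
  by rewrite sa.
by rewrite sT.
Qed.

(** * Integrated inequalities and Gronwall's lemma *)

Section primitive_bounds.
Context {R : realType}.
Implicit Types (a b s t T L A : R) (f g k F : R -> R).
Local Notation mu := (@lebesgue_measure R).

Lemma ae_ge0_Rintegral (D : set R) f :
  {ae mu, forall x, D x -> 0 <= f x} -> 0 <= \int[mu]_(x in D) f x.
Proof.
move=> f0.
have -> : \int[mu]_(x in D) f x = \int[mu]_(x in D) Num.max (f x) 0.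
  by apply: ae_eq_Rintegral; apply: ae_imp f0 => x /[apply] fx; rewrite max_l.
by apply: Rintegral_ge0 => x _; rewrite le_max lexx orbT.
Qed.

Lemma Rintegral_oo_cc_integrable a b f : mu.-integrable `[a, b] (EFin \o f) ->
  \int[mu]_(t in `]a, b[) f t = \int[mu]_(t in `[a, b]) f t.
Proof.
move=> cf; rewrite Rintegral_itv_bndo_bndc; last first.
  by apply: integrableS cf => //; exact: subset_itv_oo_cc.
rewrite Rintegral_itv_obnd_cbnd//; apply: integrableS cf => //.
by apply: subset_itvr; rewrite bnd_simp.
Qed.

(** The lower bound on [f] holds only almost everywhere and with a merely integrable [k], so it has
    to be integrated in the sense of Lebesgue; continuity of [f] identifies its integral with the
    increment of [F]. *)
Lemma primitive_ge_ae a b A F f k : a <= b -> {within `[a, b], continuous f} ->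
  primitive a b F f -> mu.-integrable `[a, b] (EFin \o k) ->
  {ae mu, forall t, t \in `]a, b[ -> A - k t <= f t} ->
  A * (b - a) - \int[mu]_(t in `[a, b]) k t <= F b - F a.
Proof.
move=> ab cf pF ik H.
rewrite -(primitive_integral ab cf pF) lerBlDr.
have cA : {within `[a, b], continuous (fun=> A)} by move=> t; exact: cvg_cst.
have pA : primitive a b (fun t => A * t) (fun=> A).
  by have := primitiveZ A (primitive_id a b); rewrite mulr1.
rewrite mulrBr -(primitive_integral ab cA pA) -subr_ge0.
have ifk : mu.-integrable `[a, b] (EFin \o (fun t => f t + k t)).
  have -> : EFin \o (fun t => f t + k t) = ((EFin \o f) \+ (EFin \o k))%E by [].
  by apply: integrableD => //; exact: within_integrable.
rewrite -RintegralD//; last exact: within_integrable.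
rewrite -RintegralB//; last exact: within_integrable.
rewrite -Rintegral_oo_cc_integrable; last first.
  have -> : EFin \o (fun t => f t + k t - A) =
    ((EFin \o (fun t => f t + k t)%R) \- (EFin \o (fun=> A)))%E by [].
  by apply: integrableB => //; exact: within_integrable.
by apply: ae_ge0_Rintegral; apply: ae_imp H => t /[apply]; lra.
Qed.

Lemma Rintegral_itvcB T s t k : mu.-integrable `[0, T] (EFin \o k) ->
  0 <= s -> s <= t -> t <= T ->
  \int[mu]_(x in `[0, t]) k x - \int[mu]_(x in `[0, s]) k x = \int[mu]_(x in `[s, t]) k x.
Proof.
move=> ik s0 st tT.
have ikt : mu.-integrable `[0, t] (EFin \o k).
  by apply: integrableS ik => //; apply: subset_itvl; rewrite bnd_simp.
rewrite (@Rintegral_itvB _ _ _ _ _ ikt) ?bnd_simp// Rintegral_itv_obnd_cbnd//.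
apply: integrableS ikt => //; apply: subset_itv; rewrite bnd_simp//.
Qed.

(** Backward in time: by hypothesis [e^(L x) (A + L (Pe T - Pe x))] has a nonnegative derivative,
    and its value at [T] is [e^(L T) A]. *)
Lemma gronwall T L A e Pe : 0 < T -> 0 <= L -> {within `[0, T], continuous e} ->
  primitive 0 T Pe e ->
  (forall t, t \in `[0, T] -> e t <= A + L * (Pe T - Pe t)) ->
  forall t, t \in `[0, T] -> A + L * (Pe T - Pe t) <= expR (L * (T - t)) * A.
Proof.
move=> T0 L0 ce pe H t; rewrite in_itv/= => /andP[t0 tT].
have cE s u : {within `[s, u], continuous (fun x => expR (L * x))}.
  apply: continuous_subspaceT => x; apply: continuous_comp; last exact: continuous_expR.
  by apply: cvgM; [exact: cvg_cst|exact: cvg_id].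
have pG : primitive t T (fun x => expR (L * x) * (A + L * (Pe T - Pe x)))
    (fun x => expR (L * x) * (L * (A + L * (Pe T - Pe x) - e x))).
  split.
    apply: withinM => //; apply: withinD; first by move=> x; exact: cvg_cst.
    apply: withinM; first by move=> x; exact: cvg_cst.
    apply: withinB; first by move=> x; exact: cvg_cst.
    exact: (primitive_sub t0 (lexx T) pe).1.
  move=> x xT; have dP := (primitive_sub t0 (lexx T) pe).2 x xT.
  have dL : is_derive x 1 (fun x => L * x) L.
    by apply: is_derive_eq; rewrite /GRing.scale/= mulr1.
  have dE := is_derive1_comp (is_derive_expR (L * x)) dL.
  have dG : is_derive x 1 (fun x => A + L * (Pe T - Pe x)) (- L * e x).
    have := is_deriveD (is_derive_cst A x 1) (is_deriveZ L (is_deriveB (is_derive_cst (Pe T) x 1) dP)).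
    by move=> D; apply: (is_derive_eq D); rewrite add0r sub0r /GRing.scale/= mulrN mulNr.
  apply: (is_derive_eq (is_deriveM dE dG)); rewrite /GRing.scale/=; ring.
have h := primitive_le tT (primitive_cst _ _ 0) pG.
rewrite [L * (T - t)]mulrBr expRB mulrAC ler_pdivlMr ?expR_gt0// mulrC.
rewrite -subr_ge0; have := h _; rewrite !subrr mulr0 addr0; apply.
move=> x; rewrite in_itv/= => /andP[tx xT].
rewrite mulr_ge0 ?expR_ge0// mulr_ge0// subr_ge0 H// in_itv/=.
by rewrite (le_trans t0 (ltW tx)) ltW.
Qed.

End primitive_bounds.

(** * Weakly differentiable curves in a pair of spaces *)

Section Ctime_theory.
Context {R : realType} {V : lmodType R}.
Implicit Types (X : set V) (b : V -> V -> R) (N : V -> R) (T s t e r : R) (z : R -> V).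

Lemma CtimeP T X N z : (forall f, 0 <= N f) -> Ctime T X N z <->
  forall t, t \in `[0, T] -> X (z t) /\ forall e, 0 < e -> exists2 r, 0 < r &
    forall s, s \in `[0, T] -> `|s - t| < r -> N (z s - z t) < e.
Proof.
move=> N0; split=> H t tT; have [Xz zt] := H t tT; split => //.
  move=> e e0; have /cvgrPdist_lt/(_ e e0) := zt.
  rewrite near_withinE => /nbhs_ballP[r/= r0 rP]; exists r => // s sT st.
  have := rP s _ sT; rewrite sub0r normrN ger0_norm//; apply.
  by rewrite /ball/= distrC.
apply/cvgrPdist_lt => e e0; rewrite near_withinE.
have [r r0 rP] := zt e e0; apply/nbhs_ballP; exists r => //= s.
move=> st sT; rewrite sub0r normrN ger0_norm//; apply: rP => //.
by move: st; rewrite /ball/= distrC.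
Qed.

Lemma Ctime_in T X N z t : Ctime T X N z -> t \in `[0, T] -> X (z t).
Proof. by move=> cz /cz[]. Qed.

Lemma Ctime_sub T X X' N N' z : (forall f, 0 <= N f) -> (forall f, 0 <= N' f) ->
  (forall f g, X f -> X g -> X (f - g)) ->
  X `<=` X' -> (forall f, X f -> N' f <= N f) -> Ctime T X N z -> Ctime T X' N' z.
Proof.
move=> N0 N0' XB XX' NN' /(CtimeP _ _ _ N0) cz.
apply/(CtimeP _ _ _ N0') => t tT; have [Xz zt] := cz t tT; split; first exact: XX'.
move=> e e0; have [r r0 rP] := zt e e0; exists r => // s sT st.
by apply: le_lt_trans (rP s sT st); apply: NN'; apply: XB => //; have [] := cz s sT.
Qed.

(** Heine's theorem for a curve in a seminormed space, from the compactness of [[0, T]] in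
    near-covering form. *)
Lemma Ctime_unif T X b z : semi_dot X b -> Ctime T X (sdnorm b) z ->
  forall e, 0 < e -> exists2 r, 0 < r &
    forall s t, s \in `[0, T] -> t \in `[0, T] -> `|s - t| < r -> sdnorm b (z s - z t) < e.
Proof.
move=> Xb /(CtimeP _ _ _ (sdnorm_ge0 (b := b))) cz e e0.
have Xz t : t \in `[0, T] -> X (z t) by move=> /cz[].
have /compact_near_coveringP cov := @segment_compact R 0 T.
pose P (r x : R) := x \in `[0, T] -> forall s, s \in `[0, T] -> `|s - x| < r ->
  sdnorm b (z s - z x) < e.
have : \forall r \near 0^'+, `[0, T] `<=` P r.
  apply: cov => x xT; have [_ /(_ (e / 2))[|r r0 rP]] := cz x xT; first by rewrite divr_gt0.
  exists (ball x (r / 2), [set d | 0 < d < r / 2]).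
    split; first by apply: nbhsx_ballx; rewrite divr_gt0.
    near=> d; apply/andP; split => //.
    by near: d; apply: nbhs_right_lt; rewrite divr_gt0.
  move=> [y d]/= [xy /andP[d0 dr]] yT s sT sy.
  apply: le_lt_trans (sdnorm_tri Xb (Xz _ sT) (Xz _ xT) (Xz _ yT)) _.
  rewrite (splitr e) ltrD//.
    apply: rP => //; rewrite -(subrK y s) -addrA (le_lt_trans (ler_normD _ _))//.
    by move: xy; rewrite /ball/= distrC => xy; lra.
  rewrite (sdnormBC Xb (Xz _ xT) (Xz _ yT)); apply: rP => //.
  by move: xy; rewrite /ball/= distrC => xy; lra.
move=> H; near (0%R : R)^'+ => r; exists r => //.
move=> s t sT tT st; have HP : `[0, T] `<=` P r by near: r.
exact: (HP _ tT tT _ sT st).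
Unshelve. all: by end_near. Qed.

Lemma Ctime_linear T X b z (l : V -> R) C : semi_dot X b -> Ctime T X (sdnorm b) z ->
  (forall f g, X f -> X g -> `|l f - l g| <= C * sdnorm b (f - g)) ->
  {within `[0, T], continuous (fun t => l (z t))}.
Proof.
move=> Xb /(CtimeP _ _ _ (sdnorm_ge0 (b := b))) cz lC; apply/within_eps => t tT e e0.
have [Xz /(_ (e / (`|C| + 1)))[|r r0 rP]] := cz t tT.
  by rewrite divr_gt0// ltr_pwDr.
exists r => // s sT st; apply: le_lt_trans (lC _ _ (cz _ sT).1 Xz) _.
apply: (@le_lt_trans _ _ ((`|C| + 1) * sdnorm b (z s - z t))).
  by rewrite ler_wpM2r ?sdnorm_ge0// (le_trans (ler_norm _))// lerDl.
by rewrite mulrC -ltr_pdivlMr ?ltr_pwDr//; exact: rP.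
Qed.

Lemma Ctime_dot T X b z f : semi_dot X b -> Ctime T X (sdnorm b) z -> X f ->
  {within `[0, T], continuous (fun t => b (z t) f)}.
Proof.
move=> Xb cz Xf; apply: (@Ctime_linear T X b z (b^~ f) (sdnorm b f)) => // g h Xg Xh.
by rewrite -(sdBl Xb Xg Xh Xf) mulrC; apply: (sd_CS Xb) => //; exact: (sdXB Xb).
Qed.

Lemma Ctime_norm T X b z : semi_dot X b -> Ctime T X (sdnorm b) z ->
  {within `[0, T], continuous (fun t => sdnorm b (z t))}.
Proof.
move=> Xb cz; apply: (@Ctime_linear T X b z (sdnorm b) 1) => // f g Xf Xg.
by rewrite mul1r; exact: (sdnorm_dist Xb).
Qed.

Lemma within_eq T (f g : R -> R) : (forall t, t \in `[0, T] -> f t = g t) ->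
  {within `[0, T], continuous f} -> {within `[0, T], continuous g}.
Proof.
move=> fg /within_eps cf; apply/within_eps => t tT e e0.
by have [r r0 rP] := cf t tT e e0; exists r => // s sT st; rewrite -!fg//; exact: rP.
Qed.

Lemma Ctime_sqr T X b z : semi_dot X b -> Ctime T X (sdnorm b) z ->
  {within `[0, T], continuous (fun t => b (z t) (z t))}.
Proof.
move=> Xb cz; have cn := Ctime_norm Xb cz.
apply: within_eq (withinM cn cn) => t tT.
by rewrite -expr2 (sdnorm_sqr Xb)//; exact: Ctime_in cz tT.
Qed.

Lemma Ctime_lin T X b z1 z2 (f : R -> R) : semi_dot X b ->
  Ctime T X (sdnorm b) z1 -> Ctime T X (sdnorm b) z2 -> 
  {within `[0, T], continuous f} ->
  Ctime T X (sdnorm b) (fun t => f t *: z1 t + z2 t).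
Proof.
move=> Xb c1 c2 cf; have cn := Ctime_norm Xb c1.
have X1 t : t \in `[0, T] -> X (z1 t) by move=> /(Ctime_in c1).
have X2 t : t \in `[0, T] -> X (z2 t) by move=> /(Ctime_in c2).
apply/(CtimeP _ _ _ (sdnorm_ge0 (b := b))) => t tT.
split; first by apply: (sdX Xb); auto.
move=> e e0; have Xt1 := X1 t tT; have Xt2 := X2 t tT.
have /within_eps/(_ t tT (e / 3 / (sdnorm b (z1 t) + 1)))[|r1 r10 P1] := cf.
  by rewrite !divr_gt0// ltr_pwDr// sdnorm_ge0.
have /within_eps/(_ t tT 1 ltr01)[r2 r20 P2] := cf.
have [_ /(_ (e / 3 / (`|f t| + 1)))[|r3 r30 P3]] :=
    (CtimeP _ _ _ (sdnorm_ge0 (b := b))).1 c1 t tT.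
  by rewrite !divr_gt0// ltr_pwDr.
have [_ /(_ (e / 3))[|r4 r40 P4]] :=
    (CtimeP _ _ _ (sdnorm_ge0 (b := b))).1 c2 t tT; first by rewrite !divr_gt0.
exists (Num.min (Num.min r1 r2) (Num.min r3 r4)); first by rewrite !lt_min r10 r20 r30.
move=> s sT; rewrite !lt_min => /andP[/andP[/(P1 s sT) q1 /(P2 s sT) q2] /andP[/(P3 s sT) q3 /(P4 s sT) q4]].
have Xs1 := X1 s sT; have Xs2 := X2 s sT.
have -> : f s *: z1 s + z2 s - (f t *: z1 t + z2 t) =
    f s *: (z1 s - z1 t) + ((f s - f t) *: z1 t + (z2 s - z2 t)).
  rewrite scalerBr scalerBl -[f s *: z1 t - _ + _]addrA [RHS]addrA subrK.
  by rewrite opprD addrACA -addrA.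
have XB1 := sdXB Xb Xs1 Xt1; have XB2 := sdXB Xb Xs2 Xt2.
apply: le_lt_trans (sdnormD Xb (sdXZ Xb _ XB1) (sdXD Xb (sdXZ Xb _ Xt1) XB2)) _.
have := sdnormD Xb (sdXZ Xb (f s - f t) Xt1) XB2.
rewrite !(sdnormZ Xb)// => h.
have h1 : `|f s| * sdnorm b (z1 s - z1 t) <= e / 3.
  have fs : `|f s| <= `|f t| + 1.
    by rewrite -(subrK (f t) (f s)) (le_trans (ler_normD _ _))// addrC lerD2l ltW.
  apply: le_trans (ler_wpM2r (sdnorm_ge0 _) fs) _.
  by rewrite mulrC -ler_pdivlMr ?ltr_pwDr// ltW.
have h2 : `|f s - f t| * sdnorm b (z1 t) <= e / 3.
  have n1 : sdnorm b (z1 t) <= sdnorm b (z1 t) + 1 by rewrite lerDl.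
  apply: le_trans (ler_wpM2l (normr_ge0 _) n1) _.
  by rewrite -ler_pdivlMr ?ltr_pwDr ?sdnorm_ge0// ltW.
by lra.
Qed.

End Ctime_theory.

Lemma is_derive_eps {R : realType} (f : R -> R) (t df : R) :
  (forall e, 0 < e -> exists2 r, 0 < r & forall s, `|s - t| < r ->
    `|f s - f t - (s - t) * df| <= e * `|s - t|) -> is_derive t 1 f df.
Proof.
move=> H; suff C : h^-1 *: (f (h + t) - f t) @[h --> (0 : R)^'] --> df.
  have E : (fun h => h^-1 *: ((f \o shift t) (h *: 1) - f t)) =
      (fun h => h^-1 *: (f (h + t) - f t)).
    by apply/funext => h /=; rewrite [h *: 1]mulr1.
  apply: DeriveDef; first by rewrite /derivable E; apply/cvg_ex; exists df.
  by rewrite /derive E; apply/cvg_lim.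
apply/cvgrPdist_le => e e0; have [r r0 rP] := H e e0.
apply/nbhs_ballP; exists r => // h; rewrite /ball/= sub0r normrN => hr h0.
have := rP (h + t); rewrite addrK => /(_ hr).
rewrite -ler_pdivrMr ?normr_gt0// -normf_div distrC mulrBl.
by rewrite [h * df]mulrC mulfK// [_ *: _]mulrC.
Qed.

Section frame.
Context {R : realType} {V : lmodType R}.
Implicit Types (f h psi phi : V) (z : R -> V) (s t e r T : R).

(* The pivot space X with inner product b, the energy space Y with Dirichlet
   form g, the test functions D with Laplacian Lap; both seminorms are
   recovered by duality against test functions. *)
Record energy_frame (X Y D : set V) (b g : V -> V -> R) (Lap : V -> V) : Prop :=
  EnergyFrame {
  ef_X : semi_dot X b;
  ef_Y : semi_dot Y g;
  ef_YX : Y `<=` X;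
  ef_DY : D `<=` Y;
  ef_D : forall a psi phi, D psi -> D phi -> D (a *: psi + phi);
  ef_Lap : forall psi, D psi -> X (Lap psi);
  ef_green : forall f psi, Y f -> D psi -> b f (Lap psi) = - g f psi;
  ef_dualX : forall f e, X f -> 0 < e -> exists psi, [/\ D psi,
    sdnorm b f <= b f psi + e & forall h, X h -> `|b h psi| <= sdnorm b h];
  ef_dualY : forall f e, Y f -> 0 < e -> exists psi, [/\ D psi,
    sdnorm g f <= b f psi + e & forall h, Y h -> `|b h psi| <= sdnorm g h] }.

Context {X Y D : set V} {b g : V -> V -> R} {Lap : V -> V}.
Hypothesis F : energy_frame X Y D b g Lap.
Let Xb := ef_X F.
Let Yg := ef_Y F.
Let YX := ef_YX F.
Let DY := ef_DY F.
Let DX : D `<=` X. Proof. by move=> f /DY /YX. Qed.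

Definition hdot f h : R := b f h + g f h.
Notation nb := (sdnorm b).
Notation ng := (sdnorm g).
Notation nh := (sdnorm hdot).

Lemma semi_dot_hdot : semi_dot Y hdot.
Proof.
split; first exact: (sd0 Yg).
- exact: (sdX Yg).
- by move=> f h Yf Yh; rewrite /hdot (sdC Yg Yf Yh) (sdC Xb (YX Yf) (YX Yh)).
- move=> a f f' h Yf Yf' Yh.
  rewrite /hdot (sdL Yg a Yf Yf' Yh) (sdL Xb a (YX Yf) (YX Yf') (YX Yh)); ring.
- by move=> f Yf; rewrite addr_ge0// ?(sd_ge0 Yg)// (sd_ge0 Xb)//; exact: YX.
Qed.
Let Yh := semi_dot_hdot.

Lemma nb_le_nh f : Y f -> nb f <= nh f.
Proof.
move=> Yf; rewrite ler_sqrt; last by rewrite (sd_ge0 Yh).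
by rewrite lerDl (sd_ge0 Yg).
Qed.

Lemma ng_le_nh f : Y f -> ng f <= nh f.
Proof.
move=> Yf; rewrite ler_sqrt; last by rewrite (sd_ge0 Yh).
by rewrite lerDr (sd_ge0 Xb)//; exact: YX.
Qed.

Lemma nh_le f : Y f -> nh f <= nb f + ng f.
Proof.
move=> Yf; rewrite -[leRHS]ger0_norm ?addr_ge0 ?sdnorm_ge0// -[leRHS]sqrtr_sqr.
rewrite ler_sqrt ?sqr_ge0// sqrrD (sdnorm_sqr Yg)// (sdnorm_sqr Xb (YX Yf)).
by rewrite /hdot lerD2r lerDl mulrn_wge0// mulr_ge0 ?sdnorm_ge0.
Qed.

(** The abstract counterpart of [H10]: the closure of the test functions for the full norm. *)
Definition energy0 : set V :=
  [set f | Y f /\ forall e, 0 < e -> exists2 psi, D psi & nh (f - psi) < e].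
Notation H0 := energy0.

Lemma energy0_seq f : H0 f -> exists psi : nat -> V,
  (forall n, D (psi n)) /\ nh (psi n - f) @[n --> \oo] --> (0 : R).
Proof.
move=> [Yf H]; have E n : exists psi, D psi /\ nh (f - psi) < harmonic n.
  by have [psi] := H (harmonic n) (harmonic_gt0 n); exists psi.
have [psi psiP] := choice E; exists psi; split; first by move=> n; case: (psiP n).
apply: (@squeeze_cvgr _ _ _ _ (fun=> 0) harmonic).
- near=> n; have [Dn /ltW] := psiP n.
  by rewrite (sdnormBC Yh Yf (DY Dn)) => ->; rewrite sdnorm_ge0.
- exact: cvg_cst.
- exact: cvg_harmonic.
Unshelve. all: by end_near. Qed.

Lemma energy0_cvg f (psi : nat -> V) (l : V -> R) C : Y f -> (forall n, D (psi n)) ->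
  nh (psi n - f) @[n --> \oo] --> (0 : R) ->
  (forall f1 f2, Y f1 -> Y f2 -> `|l f1 - l f2| <= C * nh (f1 - f2)) ->
  l (psi n) @[n --> \oo] --> l f.
Proof.
move=> Yf Dpsi H lC; apply/cvgrPdist_le => e e0.
have C0 : 0 < `|C| + 1 by rewrite ltr_pwDr.
have /cvgrPdist_le/(_ (e / (`|C| + 1))) := H.
rewrite divr_gt0// => /(_ isT); apply: filterS => n; rewrite sub0r normrN ger0_norm ?sdnorm_ge0// => h.
rewrite distrC; apply: le_trans (lC _ _ (DY (Dpsi n)) Yf) _.
apply: (@le_trans _ _ ((`|C| + 1) * nh (psi n - f))).
  by rewrite ler_wpM2r ?sdnorm_ge0// (le_trans (ler_norm _))// lerDl.
by rewrite mulrC -ler_pdivlMr.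
Qed.

Lemma energy0_closed f : Y f ->
  (forall e, 0 < e -> exists2 f', H0 f' & nh (f - f') < e) -> H0 f.
Proof.
move=> Yf H; split => // e e0; have e2 : 0 < e / 2 by rewrite divr_gt0.
have [f' [Yf' /(_ _ e2)[psi Dpsi h2]] h1] := H _ e2.
exists psi => //; apply: le_lt_trans (sdnorm_tri Yh Yf Yf' (DY Dpsi)) _.
by rewrite (splitr e) ltrD.
Qed.

Lemma energy0_lin a f f' : H0 f -> H0 f' -> H0 (a *: f + f').
Proof.
move=> [Yf Hf] [Yf' Hf']; split; first exact: (sdX Yg).
move=> e e0; have [|psi Dpsi h] := Hf (e / 2 / (`|a| + 1)); first by rewrite !divr_gt0// ltr_pwDr.
have [|psi' Dpsi' h'] := Hf' (e / 2); first by rewrite divr_gt0.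
exists (a *: psi + psi'); first exact: (ef_D F).
have -> : a *: f + f' - (a *: psi + psi') = a *: (f - psi) + (f' - psi').
  by rewrite scalerBr opprD addrACA.
have Yd := sdXB Yg Yf (DY Dpsi); have Yd' := sdXB Yg Yf' (DY Dpsi').
apply: le_lt_trans (sdnormD Yh (sdXZ Yg a Yd) Yd') _.
rewrite (sdnormZ Yh)// (splitr e) ler_ltD//.
apply: (@le_trans _ _ ((`|a| + 1) * nh (f - psi))).
  by rewrite ler_wpM2r ?sdnorm_ge0// lerDl.
by rewrite mulrC -ler_pdivlMr ?ltr_pwDr// ltW.
Qed.

Lemma energy0_Y f : H0 f -> Y f. Proof. by case. Qed.

(* [zt] is the time derivative of [z]; this is only asked weakly, against test
   functions, which suffices because both are continuous in X. *)
Record C1pair T z zt : Prop := {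
  C1_z : Ctime T X nb z;
  C1_zt : Ctime T X nb zt;
  C1_weak : forall psi, D psi ->
    primitive 0 T (fun t => b (z t) psi) (fun t => b (zt t) psi) }.

(** Against one test function, the mean value theorem bounds the remainder by the oscillation of
    [zt], uniformly over the normalized test functions of [ef_dualX]. Their supremum yields
    differentiability in the norm of [X], with a modulus uniform on [[0, T]]. *)
Lemma C1_strong T z zt : C1pair T z zt -> forall e, 0 < e -> exists2 r, 0 < r &
  forall s t, s \in `[0, T] -> t \in `[0, T] -> `|s - t| < r ->
    nb (z s - z t - (s - t) *: zt t) <= e * `|s - t|.
Proof.
move=> [cz czt wz] e e0; have [r r0 rP] := Ctime_unif Xb czt e0.
have Xz t : t \in `[0, T] -> X (z t) by exact: Ctime_in cz.
have Xzt t : t \in `[0, T] -> X (zt t) by exact: Ctime_in czt.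
exists r => // s t sT tT st.
have Xs := Xz s sT; have Xt := Xz t tT; have Xtt := Xzt t tT.
have Xd := sdXB Xb (sdXB Xb Xs Xt) (sdXZ Xb (s - t) Xtt).
apply/ler_addgt0Pr => d d0; have [psi [Dpsi h1 h2]] := ef_dualX F Xd d0.
apply: le_trans h1 _; rewrite lerD2r.
have Xpsi := DX Dpsi.
rewrite !(sdBl Xb) ?(sdZl Xb)//; [|exact: (sdXB Xb)|exact: (sdXZ Xb)].
have K u v : u \in `[0, T] -> v \in `[0, T] -> u <= v ->
    exists2 c, u <= c <= v & b (z v) psi - b (z u) psi = (v - u) * b (zt c) psi.
  move=> /itvP uT /itvP vT uv.
  have [cP dP] := @primitive_sub _ 0 T u v _ _ ltac:(by rewrite uT) ltac:(by rewrite vT) (wz psi Dpsi).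
  have [|c cuv ->] := MVT_segment uv dP; first exact: cP.
  by exists c; rewrite ?(itvP cuv)// mulrC.
have [c [cT cr] ->] : exists2 c, c \in `[0, T] /\ `|c - t| < r &
    b (z s) psi - b (z t) psi = (s - t) * b (zt c) psi.
  have [stl|tsl] := leP s t.
    have [c /andP[c1 c2] E] := K s t sT tT stl; exists c; last by rewrite -opprB E; ring.
    split; first by rewrite in_itv/= (le_trans _ c1) ?(itvP sT)// (le_trans c2) ?(itvP tT).
    by move: st; rewrite !ltr_norml; lra.
  have [c /andP[c1 c2] E] := K t s tT sT (ltW tsl); exists c; last by rewrite E.
  split; first by rewrite in_itv/= (le_trans _ c1) ?(itvP tT)// (le_trans c2) ?(itvP sT).
  by move: st; rewrite !ltr_norml; lra.
rewrite -mulrBr -(sdBl Xb (Xzt _ cT) Xtt Xpsi) mulrC.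
apply: le_trans (ler_norm _) _; rewrite normrM ler_wpM2r//.
by apply: le_trans (h2 _ (sdXB Xb (Xzt _ cT) Xtt)) _; apply/ltW/rP.
Qed.

Lemma itv_ball t T : t \in `]0, T[ -> exists2 r, 0 < r &
  forall s, `|s - t| < r -> s \in `[0, T].
Proof.
rewrite in_itv/= => /andP[t0 tT]; exists (Num.min t (T - t)).
  by rewrite lt_min t0 subr_gt0.
by move=> s; rewrite lt_min !ltr_norml in_itv/=; lra.
Qed.

(** Strong differentiability lets every bounded linear functional through the time derivative, in
    particular [f |-> b (P f) psi], where [P] acts on the curve itself. *)
Lemma C1_linear T z zt (l : V -> R) C : C1pair T z zt -> 0 <= C ->
  (forall a f f', X f -> X f' -> l (a *: f + f') = a * l f + l f') ->
  (forall f, X f -> `|l f| <= C * nb f) ->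
  primitive 0 T (fun t => l (z t)) (fun t => l (zt t)).
Proof.
move=> Hz C0 lL lC; have [cz czt wz] := Hz.
have lB f f' : X f -> X f' -> l (f - f') = l f - l f'.
  by move=> Xf Xf'; rewrite addrC -scaleN1r lL// mulN1r addrC.
split.
  apply: (Ctime_linear Xb cz (C := C)) => f f' Xf Xf'.
  by rewrite -lB//; apply: lC; exact: (sdXB Xb).
move=> t tT; have tT' : t \in `[0, T] by exact: subset_itv_oo_cc tT.
have Xt := Ctime_in cz tT'; have Xtt := Ctime_in czt tT'.
apply: is_derive_eps => e e0.
have [r1 r10 P1] := C1_strong Hz (divr_gt0 e0 (ltr_pwDr ltr01 C0)).
have [r2 r20 P2] := itv_ball tT.
exists (Num.min r1 r2); first by rewrite lt_min r10.
move=> s; rewrite lt_min => /andP[s1 s2]; have sT := P2 s s2.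
have Xs := Ctime_in cz sT.
have -> : l (z s) - l (z t) - (s - t) * l (zt t) = l (z s - z t - (s - t) *: zt t).
  have -> : z s - z t - (s - t) *: zt t = (- (s - t)) *: zt t + (z s - z t).
    by rewrite addrC scaleNr.
  by rewrite lL ?lB//; [ring|exact: (sdXB Xb)].
apply: le_trans (lC _ (sdXB Xb (sdXB Xb Xs Xt) (sdXZ Xb _ Xtt))) _.
apply: le_trans (ler_wpM2l C0 (P1 s t sT tT' s1)) _.
rewrite mulrA ler_wpM2r// mulrCA ler_piMr ?(ltW e0)//.
by rewrite ler_pdivrMr ?ltr_pwDr// mul1r lerDl.
Qed.

Lemma C1_dot T z zt f : C1pair T z zt -> X f ->
  primitive 0 T (fun t => b (z t) f) (fun t => b (zt t) f).
Proof.
move=> Hz Xf; apply: (@C1_linear T z zt (b^~ f) (nb f)) => //; first exact: sdnorm_ge0.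
  by move=> a h h' Xh Xh'; rewrite (sdL Xb a Xh Xh' Xf).
by move=> h Xh; rewrite mulrC; exact: (sd_CS Xb).
Qed.

(** One expands [b (z s) (z s) = b (z s - z t) (z s - z t) + 2 b (z s) (z t) - b (z t) (z t)]: the
    first term is of order [(s - t)^2], and the second is a pairing with a fixed vector, already
    known to be differentiable. *)
Lemma C1_sqr T z zt : C1pair T z zt ->
  primitive 0 T (fun t => b (z t) (z t)) (fun t => 2 * b (zt t) (z t)).
Proof.
move=> Hz; have [cz czt wz] := Hz; split; first exact: (Ctime_sqr Xb cz).
move=> t tT; have tT' : t \in `[0, T] by exact: subset_itv_oo_cc tT.
have Xt := Ctime_in cz tT'; have Xtt := Ctime_in czt tT'.
have [_ dz] := C1_dot Hz Xt; have dzt := dz t tT.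
have [r1 r10 P1] := C1_strong Hz ltr01.
have [r2 r20 P2] := itv_ball tT.
have dsq : is_derive t 1 (fun s => b (z s - z t) (z s - z t)) 0.
  apply: is_derive_eps => e e0; pose M := nb (zt t) + 1.
  have M0 : 0 < M by rewrite ltr_pwDr// sdnorm_ge0.
  exists (Num.min (Num.min r1 r2) (e / M ^+ 2)).
    by rewrite !lt_min r10 r20 divr_gt0// exprn_gt0.
  move=> s; rewrite !lt_min => /andP[/andP[s1 s2] s3]; have sT := P2 s s2.
  have Xs := Ctime_in cz sT; have Xst := sdXB Xb Xs Xt.
  have X0 := sd0 Xb.
  rewrite subrr (sd0l Xb X0) mulr0 !subr0 ger0_norm ?(sd_ge0 Xb)// -(sdnorm_sqr Xb)//.
  have h : nb (z s - z t) <= M * `|s - t|.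
    rewrite -(subrK ((s - t) *: zt t) (z s - z t)).
    apply: le_trans (sdnormD Xb (sdXB Xb Xst (sdXZ Xb _ Xtt)) (sdXZ Xb _ Xtt)) _.
    rewrite (sdnormZ Xb)// /M mulrDl addrC mulrC lerD2l; exact: P1.
  apply: (@le_trans _ _ ((M * `|s - t|) ^+ 2)).
    by rewrite ler_pXn2r ?nnegrE ?sdnorm_ge0 ?mulr_ge0// ltW.
  rewrite exprMn [_ ^+ 2 as X in _ * X]expr2 mulrA ler_wpM2r// mulrC.
  by rewrite -ler_pdivlMr ?exprn_gt0// ltW.
have dc := is_derive_cst (- b (z t) (z t)) t (1 : R).
have D1 := is_deriveD (is_deriveD dsq (is_deriveZ 2 dzt)) dc.
apply: (@near_eq_is_derive _ _ _ ((fun s => b (z s - z t) (z s - z t)) + (2 \*: (fun s => b (z s) (z t))) + cst (- b (z t) (z t)))).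
  apply/nbhs_ballP; exists r2 => // s; rewrite /ball/= distrC => sr.
  have sT := P2 s sr; have Xs := Ctime_in cz sT.
  rewrite !fctE /= (sdBl Xb)//; last exact: (sdXB Xb).
  rewrite !(sdBr Xb)// (sdC Xb Xt Xs) /GRing.scale/=; ring.
by apply: (is_derive_eq D1); rewrite add0r addr0.
Qed.

Lemma C1_lin T z1 zt1 z2 zt2 a : C1pair T z1 zt1 -> C1pair T z2 zt2 ->
  C1pair T (fun t => a *: z1 t + z2 t) (fun t => a *: zt1 t + zt2 t).
Proof.
move=> H1 H2; have [c1 ct1 w1] := H1; have [c2 ct2 w2] := H2.
have ca : {within `[0, T], continuous (fun=> a)} by move=> t; exact: cvg_cst.
split; [exact: (Ctime_lin Xb c1 c2 ca)|exact: (Ctime_lin Xb ct1 ct2 ca)|].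
move=> psi Dpsi; have Xpsi := DX Dpsi.
have [cP dP] := primitiveD (primitiveZ a (w1 psi Dpsi)) (w2 psi Dpsi); split.
  apply: within_eq cP => t tT.
  by rewrite (sdL Xb a (Ctime_in c1 tT) (Ctime_in c2 tT) Xpsi).
move=> t tT; have tT' : t \in `[0, T] by exact: subset_itv_oo_cc tT.
rewrite (sdL Xb a (Ctime_in ct1 tT') (Ctime_in ct2 tT') Xpsi).
apply: near_eq_is_derive (dP t tT); have [r r0 rP] := itv_ball tT.
apply/nbhs_ballP; exists r => // s; rewrite /ball/= distrC => sr.
by rewrite (sdL Xb a (Ctime_in c1 (rP s sr)) (Ctime_in c2 (rP s sr)) Xpsi).
Qed.

End frame.

Arguments hdot {R V} b g f h.
Arguments energy0 {R V} Y D b g.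
Arguments C1pair {R V} X D b T z zt.

(** * The energy estimate *)

Section difference_quotient.
Context {R : realType} {V : lmodType R}.
Implicit Types (h s t e r T : R) (z : R -> V).

Definition dq z h t : V := h^-1 *: (z (t + h) - z t).

Lemma dqE z h : dq z h = fun t => h^-1 *: z (t + h) + (- h^-1) *: z t.
Proof. by apply/funext => t; rewrite /dq scalerBr scaleNr. Qed.

Lemma Ctime_shift T X (b : V -> V -> R) z h : 0 <= h -> Ctime T X (sdnorm b) z ->
  Ctime (T - h) X (sdnorm b) (fun t => z (t + h)).
Proof.
move=> h0 /(CtimeP _ _ _ (sdnorm_ge0 (b := b))) cz.
apply/(CtimeP _ _ _ (sdnorm_ge0 (b := b))) => t; rewrite in_itv/= => tT.
have [|Xt H] := cz (t + h); first by rewrite in_itv/=; lra.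
split => // e /H[r r0 rP]; exists r => // s; rewrite in_itv/= => sT st.
by apply: rP; [rewrite in_itv/=; lra|rewrite opprD addrACA subrr addr0].
Qed.

Lemma Ctime_le T T' X (b : V -> V -> R) z : T' <= T -> Ctime T X (sdnorm b) z ->
  Ctime T' X (sdnorm b) z.
Proof.
move=> TT' /(CtimeP _ _ _ (sdnorm_ge0 (b := b))) cz.
apply/(CtimeP _ _ _ (sdnorm_ge0 (b := b))) => t; rewrite in_itv/= => tT.
have [|Xt H] := cz t; first by rewrite in_itv/=; lra.
split => // e /H[r r0 rP]; exists r => // s; rewrite in_itv/= => sT st.
by apply: rP => //; rewrite in_itv/=; lra.
Qed.

Lemma Ctime0 T X (b : V -> V -> R) : semi_dot X b -> Ctime T X (sdnorm b) (fun=> 0).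
Proof.
move=> Xb; apply/(CtimeP _ _ _ (sdnorm_ge0 (b := b))) => t tT; split; first exact: (sd0 Xb).
by move=> e e0; exists 1 => // s _ _; rewrite subrr (sdnorm0 Xb).
Qed.

Lemma Ctime_dq T X (b : V -> V -> R) z h : semi_dot X b -> 0 <= h ->
  Ctime T X (sdnorm b) z -> Ctime (T - h) X (sdnorm b) (dq z h).
Proof.
move=> Xb h0 cz; have c1 := Ctime_shift h0 cz.
have c2 : Ctime (T - h) X (sdnorm b) z by apply: Ctime_le cz; lra.
have cc (a : R) : {within `[0, T - h], continuous (fun=> a)} by move=> t; exact: cvg_cst.
rewrite dqE; apply: (Ctime_lin Xb c1 _ (cc _)).
have := Ctime_lin Xb c2 (Ctime0 Xb) (cc (- h^-1)).
by under [X in Ctime _ _ _ X]eq_fun do rewrite addr0.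
Qed.

Context {X Y D : set V} {b g : V -> V -> R} {Lap : V -> V}.
Hypothesis F : energy_frame X Y D b g Lap.
Let Xb := ef_X F.

Lemma C1_dq T z zt h : 0 <= h < T -> C1pair X D b T z zt ->
  C1pair X D b (T - h) (dq z h) (dq zt h).
Proof.
move=> /andP[h0 hT] Hz; have [cz czt wz] := Hz.
have H1 : C1pair X D b (T - h) (fun t => z (t + h)) (fun t => zt (t + h)).
  split; [exact: Ctime_shift|exact: Ctime_shift|].
  move=> psi Dpsi; have := primitive_shift h (wz psi Dpsi).
  by apply: primitive_sub; lra.
have H2 : C1pair X D b (T - h) z zt.
  split; [by apply: Ctime_le cz; lra|by apply: Ctime_le czt; lra|].
  by move=> psi Dpsi; apply: primitive_sub (wz psi Dpsi); lra.
have H0 : C1pair X D b (T - h) (fun=> 0) (fun=> 0).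
  split; [exact: Ctime0|exact: Ctime0|].
  move=> psi Dpsi; rewrite (sd0l Xb); last by apply: (ef_YX F); exact: (ef_DY F).
  exact: primitive_cst.
rewrite !dqE.
have E (w : R -> V) : (fun t => (- h^-1) *: w t + 0) = (fun t => (- h^-1) *: w t).
  by apply/funext => t; rewrite addr0.
have H3 := C1_lin F (- h^-1) H2 H0; rewrite !E in H3.
exact: (C1_lin F h^-1 H1 H3).
Qed.

End difference_quotient.

(** The absorption. Of the damping [2 (2 L - 1) yy], the term [P zt] takes [2 L yy], the term [P z]
    takes [(L - 1) yy] and the source takes [(L - 1) / 2 yy]. The rest, [(L - 1) / 2 yy], covers the
    [yy / 2] of the freezing error [k] since [L >= 2]. The term [P z] also costs [(L - 1) L^2 zz],
    which is [L] times the first part of the energy and fixes the Gronwall rate. Of [2 gy], at most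
    [gy / 2] is lost to [k], and [gy] is kept as dissipation. *)
Lemma step_algebra {R : realFieldType} (L h k A yy gy py bz gz pz zz zg ny my nz dJ : R) :
  2 <= L -> 0 < h -> 0 <= k <= 1 / 2 -> yy = ny ^+ 2 -> gy = my ^+ 2 -> zz = nz ^+ 2 ->
  0 <= ny -> 0 <= my -> 0 <= nz -> 0 <= zg ->
  `|pz| <= L * nz * ny -> `|py| <= L * yy ->
  2 * h * (- (L ^+ 2 - L) * bz - (L - 1) * gz + (1 - L) * pz) - 2 * h * k * (ny + my)
    - (L - 1) / 2 * h * yy - dJ / ((L - 1) / 2)
    <= 2 * (h * (A - (2 * L - 1) * yy - gy - py)) ->
  gy - L * ((L ^+ 2 - L) * zz + (L - 1) * zg) - 2 * k <=
  2 * A + (((L ^+ 2 - L) * (zz + 2 * h * bz + h ^+ 2 * yy)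
    + (L - 1) * (zg + 2 * h * gz + h ^+ 2 * gy))
    - ((L ^+ 2 - L) * zz + (L - 1) * zg)) / h + 2 / (L - 1) * (dJ / h).
Proof.
move=> L2 h0 /andP[k0 k1] yyE gyE zzE ny0 my0 nz0 zg0 pzL pyL H.
have L10 : 0 < L - 1 by lra.
have -> : (((L ^+ 2 - L) * (zz + 2 * h * bz + h ^+ 2 * yy)
    + (L - 1) * (zg + 2 * h * gz + h ^+ 2 * gy))
    - ((L ^+ 2 - L) * zz + (L - 1) * zg)) / h =
    (L ^+ 2 - L) * (2 * bz + h * yy) + (L - 1) * (2 * gz + h * gy).
  by field; rewrite gt_eqF.
set j := 2 / (L - 1) * (dJ / h).
have {}H : 2 * (- (L ^+ 2 - L) * bz - (L - 1) * gz + (1 - L) * pz) - 2 * k * (ny + my)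
    - (L - 1) / 2 * yy - j <= 2 * (A - (2 * L - 1) * yy - gy - py).
  rewrite -(ler_pM2l h0); apply: le_trans (le_trans _ H) _; last by rewrite mulrCA.
  rewrite (_ : h * _ = 2 * h * (- (L ^+ 2 - L) * bz - (L - 1) * gz + (1 - L) * pz)
    - 2 * h * k * (ny + my) - (L - 1) / 2 * h * yy - dJ / ((L - 1) / 2))//.
  by rewrite /j; field; rewrite !gt_eqF.
have yy0 : 0 <= yy by rewrite yyE sqr_ge0.
have gy0 : 0 <= gy by rewrite gyE sqr_ge0.
have zz0 : 0 <= zz by rewrite zzE sqr_ge0.
have p1 : (L - 1) * (2 * pz) <= (L - 1) * (yy + L ^+ 2 * zz).
  apply: ler_wpM2l; first exact: ltW.
  have := le_trans (ler_norm _) pzL; rewrite yyE zzE => h1.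
  have := sqr_ge0 (ny - L * nz); rewrite sqrrB => h2; nra.
have p2 : - (L * yy) <= py by move: pyL; rewrite ler_norml => /andP[].
have p3 : 2 * k * (ny + my) <= k * (2 + yy + gy).
  rewrite mulrAC mulrC ler_wpM2l// yyE gyE.
  have := sqr_ge0 (ny - 1); have := sqr_ge0 (my - 1); rewrite !expr2; nra.
have p4 : k * (yy + gy) <= 1 / 2 * (yy + gy) by rewrite ler_wpM2r// addr_ge0.
have p5 : 0 <= (L ^+ 2 - L) * (h * yy).
  by rewrite mulr_ge0 ?mulr_ge0 ?(ltW h0)//; rewrite expr2; nra.
have p6 : 0 <= (L - 1) * (h * gy) by rewrite !mulr_ge0 ?(ltW h0)// ltW.
have p7 : 0 <= L * ((L - 1) * zg) by rewrite !mulr_ge0//; lra.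
have p8 : 0 <= (L - 2) * yy by rewrite mulr_ge0//; lra.
rewrite mulrDr in p3; nra.
Qed.

(** The quotient is a mean of [k] over [[s, s + h]], equal to a value of [k] near [t] by the mean
    value theorem. The window may lie on either side of [t], so both ends of the time interval are
    covered. *)
Lemma mean_close {R : realType} (T : R) G k t e : primitive 0 T G k ->
  {within `[0, T], continuous k} -> t \in `[0, T] -> 0 < e ->
  exists2 r, 0 < r & forall s h, 0 < h -> 0 <= s -> s + h <= T ->
    `|s - t| < r -> `|s + h - t| < r -> `|(G (s + h) - G s) / h - k t| <= e.
Proof.
move=> pG /within_eps ck tT e0; have [r r0 rP] := ck t tT e e0.
exists r => // s h h0 s0 shT sr shr.
have [cG dG] := primitive_sub s0 shT pG.
have ssh : s <= s + h by lra.
have [c cs ->] := MVT_segment ssh dG cG.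
rewrite (_ : s + h - s = h); last by ring.
rewrite mulfK ?gt_eqF// ltW// rP//; move: cs sr shr; rewrite !in_itv/=; first lra.
by rewrite !ltr_norml; lra.
Qed.

Lemma step_bounds {R : realFieldType} (T a h : R) : 0 <= a -> 0 < h -> h < T - a ->
  [/\ a < T - h, 0 <= T - h, T - h <= T, 0 <= a + h & a + h <= T].
Proof. by move=> *; split; lra. Qed.

Lemma step_bounds' {R : realFieldType} (T h t s : R) : 0 <= t -> t <= T - h ->
  t <= s -> s <= t + h -> [/\ 0 <= s, s <= T, t <= T & s - t <= h].
Proof. by move=> *; split; lra. Qed.

(** Nine shares of size [e / 9]: two for [E], two for [N], one for [w], and four for [J], whose two
    errors are doubled by [c <= 2]. *)
Lemma limit_algebra {R : realFieldType} (e c Ea Na ET NT Ja JT Ea' ET' Na' NT' Ja' JT' I Q Q' w : R) :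
  0 <= c -> c <= 2 -> 0 < e ->
  `|Ea' - Ea| <= e / 9 -> `|ET' - ET| <= e / 9 -> `|Ja' - Ja| <= e / 9 ->
  `|JT' - JT| <= e / 9 -> `|Na' - Na| <= e / 9 -> `|NT' - NT| <= e / 9 ->
  w <= e / 9 -> Q' <= Q -> I - Q' - w <= (NT' - Na') + (ET' - Ea') + c * (JT' - Ja') ->
  Na + Ea + I <= NT + ET + c * (JT - Ja) + Q + e.
Proof.
move=> c0 c2 e0 + + E3 E4; rewrite !ler_norml.
have : c * (JT' - Ja') <= c * (JT - Ja) + 2 * (e / 9 + e / 9).
  have hd : JT' - Ja' <= JT - Ja + (e / 9 + e / 9).
    by move: E3 E4; rewrite !ler_norml; lra.
  have e9 : 0 <= e / 9 + e / 9 by lra.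
  have := ler_wpM2l c0 hd; have := ler_wpM2r e9 c2; lra.
lra.
Qed.

Lemma sd_sqr_close {R : realType} {V : lmodType R} (X : set V) b (Xb : semi_dot X b) f e :
  X f -> 0 < e -> exists2 r : R, 0 < r &
    forall f', X f' -> sdnorm b (f' - f) <= r -> `|b f' f' - b f f| <= e.
Proof.
move=> Xf e0; have n0 := sdnorm_ge0 (b := b) f.
exists (Num.min 1 (e / (2 * sdnorm b f + 1))).
  by rewrite lt_min ltr01 divr_gt0// ltr_pwDr// mulr_ge0.
move=> f' Xf'; rewrite le_min => /andP[h1 h2].
have h3 := le_trans (sdnorm_dist Xb Xf' Xf) h1.
have h4 := le_trans (sdnorm_dist Xb Xf' Xf) h2.
rewrite -!(sdnorm_sqr Xb)// subr_sqr normrM.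
have n1 := sdnorm_ge0 (b := b) f'.
rewrite [X in _ * X]ger0_norm ?addr_ge0//.
apply: le_trans (ler_wpM2r _ h4) _; first by rewrite addr_ge0.
rewrite mulrAC ler_pdivrMr ?ltr_pwDr ?mulr_ge0// ler_pM2l//.
by move: h3; rewrite ler_norml => /andP[_]; lra.
Qed.

Lemma measurable_fun_limn_einf d (T : measurableType d) (R : realType) (D : set T)
    (f : nat -> T -> \bar R) :
  (forall n, measurable_fun D (f n)) -> measurable_fun D (fun x => limn_einf (f ^~ x)).
Proof.
move=> mf; have mf' n : measurable_fun D (\- f n)%E by exact: (measurableT_comp (f := -%E)).
have H := measurable_fun_limn_esup mf'.
exact: (measurableT_comp (f := -%E) _ H).
Qed.

Section limn_einf_bounds.
Context {R : realType}.
Local Open Scope ereal_scope.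

Lemma limn_einf_ge (u : (\bar R)^nat) c :
  (\forall n \near \oo, c <= u n) -> c <= limn_einf u.
Proof.
move=> [N _ H]; rewrite limn_einf_lim; apply: lime_ge; first exact: is_cvg_einfs.
exists N => // n Nn; apply: le_ereal_inf_tmp => _ [m /= nm <-].
by apply: H => /=; exact: leq_trans nm.
Qed.

Lemma limn_einf_le (u : (\bar R)^nat) c : (forall n, u n <= c) -> limn_einf u <= c.
Proof.
move=> H; rewrite limn_einf_lim; apply: lime_le; first exact: is_cvg_einfs.
apply: nearW => n; apply: le_trans (H n).
by apply: ereal_inf_lbound; exists n => /=.
Qed.

End limn_einf_bounds.

(* The equation is tested with difference quotients of [z], which belong to the
   energy space at every time, instead of with [zt]; the estimate then survives
   the passage to the limit by lower semicontinuity. *)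
Section energy_estimate.
Context {R : realType} {V : lmodType R}.
Implicit Types (f psi phi : V) (h s t e r w c : R).
Context {X Y D : set V} {b g : V -> V -> R} {Lap : V -> V}.
Hypothesis F : energy_frame X Y D b g Lap.
Local Notation nb := (sdnorm b).
Local Notation ng := (sdnorm g).
Local Notation nh := (sdnorm (hdot b g)).
Local Notation H0 := (energy0 Y D b g).
Local Notation mu := (@lebesgue_measure R).

Context (T L : R) (P : V -> V) (q : V -> R -> R) (k2 : R -> R) (z zt : R -> V).
Hypothesis (T0 : 0 < T) (L_ge2 : 2 <= L).
Hypothesis PX : forall f, X f -> X (P f).
Hypothesis PL : forall a f f' psi, X f -> X f' -> X psi ->
  b (P (a *: f + f')) psi = a * b (P f) psi + b (P f') psi.
Hypothesis Pb : forall f, X f -> nb (P f) <= L * nb f.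
Hypothesis Hz : C1pair X D b T z zt.
Hypothesis zH0 : forall t, t \in `[0, T] -> H0 (z t).
Hypothesis cz : Ctime T Y nh z.
Hypothesis qc : forall psi, D psi -> {within `[0, T], continuous (q psi)}.
Hypothesis k2i : mu.-integrable `[0, T] (EFin \o k2).
Hypothesis k2ge0 : forall t, 0 <= k2 t.
(** Cauchy-Schwarz for the source, in the form of Young's inequality with a free parameter [c]. The
    exceptional times depend on [psi], hence the bound must be integrated in time before [psi] tends
    to a general element of [H0]. *)
Hypothesis qk : forall psi c, D psi -> 0 < c ->
  {ae mu, forall t, t \in `]0, T[ -> - (c * b psi psi + k2 t / c) <= 2 * q psi t}.
Hypothesis eqn : forall psi, D psi -> primitive 0 T (fun t => b (zt t) psi)
  (fun t => (2 * L - 1) * b (zt t) psi - (L ^+ 2 - L) * b (z t) psi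
    + (L - 1) * b (z t) (Lap psi) - b (zt t) (Lap psi)
    + (1 - L) * b (P (z t)) psi + b (P (zt t)) psi + q psi t).

Let Xb := ef_X F.
Let Yg := ef_Y F.
Let Yh := semi_dot_hdot F.
Let YX f : Y f -> X f. Proof. exact: (ef_YX F). Qed.
Let DY f : D f -> Y f. Proof. exact: (ef_DY F). Qed.
Let DX f : D f -> X f. Proof. by move=> /DY/YX. Qed.

Let J t : R := \int[mu]_(s in `[0, t]) k2 s.
(** On the right of the equation, every term in [zt] is the time derivative of a term in [z]. Moving
    these terms under the derivative leaves, besides the source, the expression [B (z t) psi], which
    is controlled by the energy norms of [z t] and [psi], without [zt] and without [Lap psi]. *)
Let Psi phi t := b (zt t) phi - (2 * L - 1) * b (z t) phi - g (z t) phi - b (P (z t)) phi.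
Let B f phi := - (L ^+ 2 - L) * b f phi - (L - 1) * g f phi + (1 - L) * b (P f) phi.
(** An upper bound for [(L^2 - L) + (L - 1) + (L - 1) L], the sum of the coefficients that appear in
    [B_lip]. *)
Let K := L ^+ 2 + L * L.

Let Yz t : t \in `[0, T] -> Y (z t). Proof. by move=> /zH0[]. Qed.
Let Xz t : t \in `[0, T] -> X (z t). Proof. by move=> /Yz/YX. Qed.
Let Xzt t : t \in `[0, T] -> X (zt t). Proof. by move=> tT; exact: Ctime_in (C1_zt Hz) tT. Qed.

Let Plin psi : X psi -> primitive 0 T (fun t => b (P (z t)) psi) (fun t => b (P (zt t)) psi).
Proof.
move=> Xpsi; apply: (@C1_linear _ _ _ _ _ _ _ _ F T z zt (fun f => b (P f) psi) (L * nb psi)) => //.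
- by rewrite mulr_ge0 ?sdnorm_ge0//; have := L_ge2; lra.
- by move=> a f f' Xf Xf'; exact: PL.
- move=> f Xf; apply: le_trans (sd_CS Xb (PX Xf) Xpsi) _.
  by rewrite mulrAC ler_wpM2r ?sdnorm_ge0//; exact: Pb.
Qed.

Let Psi_primitive psi : D psi -> primitive 0 T (Psi psi) (fun t => B (z t) psi + q psi t).
Proof.
move=> Dpsi; have Xpsi := DX Dpsi.
have p1 := C1_dot F Hz Xpsi; have p2 := C1_dot F Hz (ef_Lap F Dpsi).
have p3 := Plin Xpsi; have p4 := eqn Dpsi.
have [cc dd] := primitiveD (primitiveD (primitiveD p4 (primitiveZ (- (2 * L - 1)) p1)) p2) (primitiveZ (-1) p3).
have gE t : t \in `[0, T] -> b (z t) (Lap psi) = - g (z t) psi.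
  by move=> tT; rewrite (ef_green F (Yz tT) Dpsi).
split.
  by apply: within_eq cc => t tT; rewrite gE// /Psi; ring.
move=> t tT; have tT' : t \in `[0, T] by exact: subset_itv_oo_cc tT.
have := dd t tT.
set lhs := (X in is_derive _ _ _ X -> _).
have -> : lhs = B (z t) psi + q psi t by rewrite /lhs gE// /B; ring.
apply: near_eq_is_derive; have [r r0 rP] := itv_ball tT.
apply/nbhs_ballP; exists r => // s; rewrite /ball/= distrC => sr.
by rewrite gE ?rP// /Psi; ring.
Qed.

Let B_lip f f' psi : Y f -> Y f' -> Y psi ->
  `|B f psi - B f' psi| <= K * nh (f - f') * nh psi.
Proof.
move=> Yf Yf' Ypsi; have Xf := YX Yf; have Xf' := YX Yf'; have Xpsi := YX Ypsi.
have Yd := sdXB Yg Yf Yf'; have Xd := YX Yd.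
have PB : b (P (f - f')) psi = b (P f) psi - b (P f') psi.
  by rewrite addrC -scaleN1r PL// mulN1r addrC.
have -> : B f psi - B f' psi = - (L ^+ 2 - L) * b (f - f') psi
    - (L - 1) * g (f - f') psi + (1 - L) * b (P (f - f')) psi.
  rewrite PB (sdBl Xb Xf Xf' Xpsi) (sdBl Yg Yf Yf' Ypsi) /B; ring.
have n1 : nb (f - f') * nb psi <= nh (f - f') * nh psi.
  by apply: ler_pM; rewrite ?sdnorm_ge0 ?(nb_le_nh F).
have n2 : ng (f - f') * ng psi <= nh (f - f') * nh psi.
  by apply: ler_pM; rewrite ?sdnorm_ge0 ?(ng_le_nh F).
have h1 : `|b (f - f') psi| <= nh (f - f') * nh psi.
  by apply: le_trans n1; exact: (sd_CS Xb).
have h2 : `|g (f - f') psi| <= nh (f - f') * nh psi.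
  by apply: le_trans n2; exact: (sd_CS Yg).
have h3 : `|b (P (f - f')) psi| <= L * (nh (f - f') * nh psi).
  apply: le_trans (sd_CS Xb (PX Xd) Xpsi) _.
  apply: le_trans (ler_wpM2r (sdnorm_ge0 _) (Pb Xd)) _.
  by rewrite -mulrA ler_wpM2l//; have := L_ge2; lra.
have m0 : 0 <= nh (f - f') * nh psi by rewrite mulr_ge0 ?sdnorm_ge0.
rewrite -mulrA; move: h1 h2 h3 m0; set m := nh _ * nh _.
set x := b _ _; set y := g _ _; set v := b _ _.
have L_ge2' := L_ge2; have La : 0 <= L - 1 by lra.
have Lb : 0 <= L ^+ 2 - L by rewrite expr2; nra.
move=> h1 h2 h3 m0.
rewrite -mulNr; apply: le_trans (ler_normD _ _) _.
apply: le_trans (lerD (ler_normD _ _) (lexx _)) _.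
rewrite !normrM !normrN (ger0_norm La) (ger0_norm Lb) -[`|1 - L|]normrN opprB (ger0_norm La).
apply: le_trans (lerD (lerD (ler_wpM2l Lb h1) (ler_wpM2l La h2)) (ler_wpM2l La h3)) _.
rewrite /K; nra.
Qed.

Let en t := (L ^+ 2 - L) * b (z t) (z t) + (L - 1) * g (z t) (z t).

Let B_cont psi : Y psi -> {within `[0, T], continuous (fun t => B (z t) psi)}.
Proof.
move=> Ypsi; apply: (Ctime_linear Yh cz (l := fun f => B f psi) (C := K * nh psi)).
by move=> f f' Yf Yf'; rewrite mulrAC; exact: B_lip.
Qed.

Let JB s t : 0 <= s -> s <= t -> t <= T -> J t - J s = \int[mu]_(x in `[s, t]) k2 x.
Proof. by move=> *; rewrite /J (Rintegral_itvcB k2i). Qed.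

(** The tested equation integrated over [[t, t + h]], with [z s] frozen at [z t] inside [B] at the
    cost [K w], and the source bounded from below by [qk]. *)
Let test_increment psi t h w c : D psi -> 0 < h -> 0 <= t -> t + h <= T -> 0 < c ->
  (forall s, t <= s <= t + h -> nh (z s - z t) <= w) ->
  2 * h * B (z t) psi - 2 * h * (K * w) * nh psi - c * h * b psi psi - (J (t + h) - J t) / c
    <= 2 * (Psi psi (t + h) - Psi psi t).
Proof.
move=> Dpsi h0 t0 thT c0 zw; have Ypsi := DY Dpsi.
have tth : t <= t + h by lra.
have p : primitive t (t + h) (fun s => 2 * Psi psi s) (fun s => 2 * (B (z s) psi + q psi s)).
  by apply: primitiveZ; apply: primitive_sub (Psi_primitive Dpsi).
have cf : {within `[t, t + h], continuous (fun s => 2 * (B (z s) psi + q psi s))}.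
  have : {within `[0, T], continuous (fun s => 2 * (B (z s) psi + q psi s))}.
    apply: withinM; first by move=> s; exact: cvg_cst.
    by apply: withinD; [exact: B_cont|exact: qc].
  by apply: continuous_subspaceW; apply: subset_itv; rewrite bnd_simp.
have sub : `[t, t + h]%classic `<=` `[0, T] by apply: subset_itv; rewrite bnd_simp.
have ki : mu.-integrable `[t, t + h] (EFin \o k2) by exact: integrableS k2i.
have ki' : mu.-integrable `[t, t + h] (EFin \o (fun s => c^-1 * k2 s)).
  have -> : EFin \o (fun s => c^-1 * k2 s) = (fun s => c^-1%:E * (k2 s)%:E)%E by [].
  exact: integrableZl.
have := primitive_ge_ae (A := 2 * B (z t) psi - 2 * (K * w) * nh psi - c * b psi psi)
  tth cf p ki'.
rewrite RintegralZl// -(JB t0 tth thT) => H.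
have {}H := H _; rewrite mulrBr; apply: le_trans (H _); last first.
  apply: ae_imp (qk Dpsi c0) => s qs; rewrite in_itv/= => /andP[ts sth].
  have sT : s \in `]0, T[ by rewrite in_itv/=; lra.
  have sT' : s \in `[0, T] by exact: subset_itv_oo_cc sT.
  have tT : t \in `[0, T] by rewrite in_itv/=; lra.
  have := B_lip (Yz sT') (Yz tT) Ypsi; have := qs sT.
  have zws : nh (z s - z t) <= w by apply: zw; lra.
  have K0 : 0 <= K by rewrite /K addr_ge0 ?sqr_ge0// mulr_ge0//; have := L_ge2; lra.
  have := ler_wpM2r (sdnorm_ge0 (b := hdot b g) psi) (ler_wpM2l K0 zws).
  rewrite [c^-1 * _]mulrC ler_norml => h1 h2 /andP[h3 _]; lra.
rewrite (_ : t + h - t = h); last by ring.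
rewrite [c^-1 * _]mulrC lerD2r; lra.
Qed.

Let cvg_dot v (psi : nat -> V) phi : X v -> Y phi -> (forall n, D (psi n)) ->
  nh (psi n - phi) @[n --> \oo] --> (0 : R) -> b v (psi n) @[n --> \oo] --> b v phi.
Proof.
move=> Xv Yphi Dpsi H; apply: (energy0_cvg F (l := b v) Yphi Dpsi H (C := nb v)).
move=> f f' Yf Yf'; have Xf := YX Yf; have Xf' := YX Yf'.
rewrite -(sdBr Xb Xf Xf' Xv); apply: le_trans (sd_CS Xb Xv (sdXB Xb Xf Xf')) _.
by rewrite ler_wpM2l ?sdnorm_ge0// (nb_le_nh F)//; exact: (sdXB Yg).
Qed.

Let cvg_form v (psi : nat -> V) phi : Y v -> Y phi -> (forall n, D (psi n)) ->
  nh (psi n - phi) @[n --> \oo] --> (0 : R) -> g v (psi n) @[n --> \oo] --> g v phi.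
Proof.
move=> Yv Yphi Dpsi H; apply: (energy0_cvg F (l := g v) Yphi Dpsi H (C := ng v)).
move=> f f' Yf Yf'.
rewrite -(sdBr Yg Yf Yf' Yv); apply: le_trans (sd_CS Yg Yv (sdXB Yg Yf Yf')) _.
by rewrite ler_wpM2l ?sdnorm_ge0// (ng_le_nh F)//; exact: (sdXB Yg).
Qed.

(** Every term of [test_increment] is continuous in the test function for the norm [nh], so density
    extends the inequality to [H0]. This is what makes a difference quotient of [z] admissible as
    [phi]. *)
Let increment phi t h w c : H0 phi -> 0 < h -> 0 <= t -> t + h <= T -> 0 < c ->
  (forall s, t <= s <= t + h -> nh (z s - z t) <= w) ->
  2 * h * B (z t) phi - 2 * h * (K * w) * nh phi - c * h * b phi phi - (J (t + h) - J t) / c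
    <= 2 * (Psi phi (t + h) - Psi phi t).
Proof.
move=> Hphi h0 t0 thT c0 zw; have Yphi := Hphi.1.
have [psi [Dpsi psiphi]] := energy0_seq F Hphi.
have tT : t \in `[0, T] by rewrite in_itv/=; lra.
have thT' : t + h \in `[0, T] by rewrite in_itv/=; lra.
have cb v (Xv : X v) := cvg_dot Xv Yphi Dpsi psiphi.
have cg v (Yv : Y v) := cvg_form Yv Yphi Dpsi psiphi.
have cn : nh (psi n) @[n --> \oo] --> nh phi.
  apply: (energy0_cvg F (l := nh) Yphi Dpsi psiphi (C := 1)) => f f' Yf Yf'.
  by rewrite mul1r; exact: (sdnorm_dist Yh).
have cnb : nb (psi n) @[n --> \oo] --> nb phi.
  apply: (energy0_cvg F (l := nb) Yphi Dpsi psiphi (C := 1)) => f f' Yf Yf'.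
  rewrite mul1r; apply: le_trans (sdnorm_dist Xb (YX Yf) (YX Yf')) _.
  by apply: (nb_le_nh F); exact: (sdXB Yg).
have cB v : Y v -> B v (psi n) @[n --> \oo] --> B v phi.
  move=> Yv; apply: cvgD; last by apply: cvgMl_tmp; apply: cb; exact/PX/YX.
  by apply: cvgB; apply: cvgMl_tmp; [apply: cb; exact: YX|exact: cg].
have cPsi s : s \in `[0, T] -> Psi (psi n) s @[n --> \oo] --> Psi phi s.
  move=> sT; apply: cvgB; last by apply: cb; exact/PX/Xz.
  apply: cvgB; last by apply: cg; exact: Yz.
  apply: cvgB; first by apply: cb; exact: Xzt.
  by apply: cvgMl_tmp; apply: cb; exact: Xz.
have csq : b (psi n) (psi n) @[n --> \oo] --> b phi phi.
  rewrite -(sdnorm_sqr Xb (YX Yphi)) expr2.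
  rewrite (_ : (fun n => _) = (fun n => nb (psi n) * nb (psi n))); first exact: cvgM.
  by apply/funext => n; rewrite -expr2 (sdnorm_sqr Xb (DX (Dpsi n))).
have lhs : 2 * h * B (z t) (psi n) - 2 * h * (K * w) * nh (psi n) - c * h * b (psi n) (psi n)
    - (J (t + h) - J t) / c @[n --> \oo] -->
    (2 * h * B (z t) phi - 2 * h * (K * w) * nh phi - c * h * b phi phi
    - (J (t + h) - J t) / c).
  apply: cvgB; last exact: cvg_cst.
  apply: cvgB; last exact: cvgMl_tmp.
  by apply: cvgB; apply: cvgMl_tmp => //; apply: cB; exact: Yz.
have rhs : 2 * (Psi (psi n) (t + h) - Psi (psi n) t) @[n --> \oo] -->
    (2 * (Psi phi (t + h) - Psi phi t)).
  by apply: cvgMl_tmp; apply: cvgB; exact: cPsi.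
by apply: (ler_cvg_to lhs rhs); apply: nearW => n; exact: test_increment.
Qed.

Let dq_H0 t h : t \in `[0, T] -> t + h \in `[0, T] -> H0 (dq z h t).
Proof.
move=> tT thT; have H1 := zH0 tT; have H2 := zH0 thT.
have H00 : H0 0 by rewrite -(subrr (z t)) addrC -scaleN1r; exact: (energy0_lin F).
rewrite /dq -[_ *: _]addr0; apply: (energy0_lin F) => //.
by rewrite addrC -scaleN1r; exact: (energy0_lin F).
Qed.

(** With [phi = dq z h t], the increments of [z] and [zt] over [[t, t + h]] are [h] times the
    difference quotients, so the increment of [Psi] becomes [h] times an exact expression in these.
    The parameter [c = (L - 1) / 2] is the share of the damping spent on the source. *)
Let step t h w : 0 < h -> 0 <= t -> t + h <= T -> 0 <= w -> K * w <= 1 / 2 ->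
  (forall s, t <= s <= t + h -> nh (z s - z t) <= w) ->
  g (dq z h t) (dq z h t) - L * en t - 2 * (K * w) <=
  2 * b (dq zt h t) (dq z h t) + (en (t + h) - en t) / h
    + 2 / (L - 1) * ((J (t + h) - J t) / h).
Proof.
move=> h0 t0 thT w0 Kw zw.
have tT : t \in `[0, T] by rewrite in_itv/=; lra.
have thT' : t + h \in `[0, T] by rewrite in_itv/=; lra.
have Hy := dq_H0 tT thT'; set y := dq z h t in Hy *; set yt := dq zt h t.
have Yy := Hy.1; have Xy := YX Yy.
have Y1 := Yz tT; have Y2 := Yz thT'; have X1 := YX Y1; have X2 := YX Y2.
have Xt1 := Xzt tT; have Xt2 := Xzt thT'.
have hn0 : h != 0 by rewrite gt_eqF.
have zE : z (t + h) = h *: y + z t by rewrite /y /dq scalerA divff// scale1r subrK.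
have ztE : zt (t + h) = h *: yt + zt t by rewrite /yt /dq scalerA divff// scale1r subrK.
have Xyt : X yt by apply: (sdXZ Xb); exact: (sdXB Xb).
have L1 : 0 < (L - 1) / 2 by have := L_ge2; lra.
have := increment Hy h0 t0 thT L1 zw.
have -> : Psi y (t + h) - Psi y t = h * (b yt y - (2 * L - 1) * b y y - g y y - b (P y) y).
  rewrite /Psi zE ztE (sdL Xb h Xyt Xt1 Xy) (sdL Xb h Xy X1 Xy) (sdL Yg h Yy Y1 Yy) PL//; ring.
have nhy : nh y <= nb y + ng y by exact: (nh_le F).
have K0 : 0 <= K by rewrite /K addr_ge0 ?sqr_ge0// mulr_ge0//; have := L_ge2; lra.
have Kw0 : 0 <= K * w by rewrite mulr_ge0.
have hKw : 2 * h * (K * w) * nh y <= 2 * h * (K * w) * (nb y + ng y).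
  by rewrite ler_wpM2l// !mulr_ge0// ltW.
rewrite /B => H.
have enE : en (t + h) = (L ^+ 2 - L) * (b (z t) (z t) + 2 * h * b (z t) y + h ^+ 2 * b y y)
    + (L - 1) * (g (z t) (z t) + 2 * h * g (z t) y + h ^+ 2 * g y y).
  rewrite /en zE; congr (_ * _ + _ * _).
    have Xzz := sdX Xb h Xy X1.
    rewrite (sdL Xb h Xy X1 Xzz) (sdC Xb Xy Xzz) (sdC Xb X1 Xzz).
    by rewrite (sdL Xb h Xy X1 Xy) (sdL Xb h Xy X1 X1) (sdC Xb Xy X1); ring.
  have Yzz := sdX Yg h Yy Y1.
  rewrite (sdL Yg h Yy Y1 Yzz) (sdC Yg Yy Yzz) (sdC Yg Y1 Yzz).
  by rewrite (sdL Yg h Yy Y1 Yy) (sdL Yg h Yy Y1 Y1) (sdC Yg Yy Y1); ring.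
rewrite enE /en; apply: (@step_algebra _ L h (K * w) (b yt y) (b y y) (g y y) (b (P y) y)
  (b (z t) y) (g (z t) y) (b (P (z t)) y) (b (z t) (z t)) (g (z t) (z t)) (nb y) (ng y)
  (nb (z t)) (J (t + h) - J t)); rewrite ?(sdnorm_sqr Xb)// ?(sdnorm_sqr Yg)// ?sdnorm_ge0//.
- by rewrite Kw0.
- exact: (sd_ge0 Yg).
- apply: le_trans (sd_CS Xb (PX X1) Xy) _.
  by rewrite ler_wpM2r ?sdnorm_ge0//; exact: Pb.
- apply: le_trans (sd_CS Xb (PX Xy) Xy) _.
  by rewrite -(sdnorm_sqr Xb)// expr2 mulrA ler_wpM2r ?sdnorm_ge0//; exact: Pb.
- move: H; lra.
Qed.

Let en_ge0 t : t \in `[0, T] -> 0 <= en t.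
Proof.
move=> tT; have L_ge2' := L_ge2; rewrite /en addr_ge0// mulr_ge0//.
- by rewrite expr2; nra.
- exact: (sd_ge0 Xb (Xz tT)).
- by lra.
- exact: (sd_ge0 Yg (Yz tT)).
Qed.

Let cg : Ctime T Y ng z.
Proof.
apply: Ctime_sub cz => //; [exact: sdnorm_ge0|exact: sdnorm_ge0| |].
  by move=> f f' Yf Yf'; exact: (sdXB Yg).
by move=> f Yf; exact: (ng_le_nh F).
Qed.

Let en_cont : {within `[0, T], continuous en}.
Proof.
apply: withinD; apply: withinM; try by move=> t; exact: cvg_cst.
  exact: Ctime_sqr Xb (C1_z Hz).
exact: Ctime_sqr Yg cg.
Qed.

Let J_cont : {within `[0, T], continuous J}.
Proof. by apply: parameterized_integral_continuous => //; exact: ltW. Qed.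

Let c2 := 2 / (L - 1).

Let L1_gt0 : 0 < L - 1. Proof. by rewrite subr_gt0 (lt_le_trans _ L_ge2)// ltr1n. Qed.

Let c2_ge0 : 0 <= c2. Proof. by rewrite /c2 divr_ge0// ltW. Qed.

Let c2_le2 : c2 <= 2.
Proof. by rewrite /c2 ler_pdivrMr// ler_peMr// lerBrDr. Qed.

(** [step] integrated over [[a, T - h]]. The quotients of [en] and [J] telescope: their integrals
    are means over [[T - h, T]] minus means over [[a, a + h]], from which the boundary values arise
    as [h] tends to 0. *)
Let energy_h h a w Pe PJ Gh : 0 < h -> 0 <= a -> a < T - h -> 0 <= w -> K * w <= 1 / 2 ->
  (forall t s, 0 <= t -> t <= T - h -> t <= s <= t + h -> nh (z s - z t) <= w) ->
  primitive 0 T Pe en -> primitive 0 T PJ J ->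
  primitive 0 (T - h) Gh (fun t => g (dq z h t) (dq z h t)) ->
  Gh (T - h) - Gh a - L * (Pe (T - h) - Pe a) - 2 * (K * w) * (T - h - a) <=
    (b (dq z h (T - h)) (dq z h (T - h)) - b (dq z h a) (dq z h a))
    + ((Pe T - Pe (T - h)) / h - (Pe (a + h) - Pe a) / h)
    + c2 * ((PJ T - PJ (T - h)) / h - (PJ (a + h) - PJ a) / h).
Proof.
move=> h0 a0 aT w0 Kw zw pe pj pg.
have hT : 0 <= h < T by lra.
have py := primitive_sub a0 (lexx _) (C1_sqr F (C1_dq F hT Hz)).
have sub G k (p : primitive 0 T G k) : primitive a (T - h) G k.
  by apply: primitive_sub p; lra.
have shift G k (p : primitive 0 T G k) :
    primitive a (T - h) (fun t => G (t + h)) (fun t => k (t + h)).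
  by have := primitive_shift h p; apply: primitive_sub; lra.
have inc G k (p : primitive 0 T G k) :=
  primitiveZ h^-1 (primitiveD (shift _ _ p) (primitiveZ (-1) (sub _ _ p))).
have R1 := primitiveD (primitiveD py (inc _ _ pe)) (primitiveZ c2 (inc _ _ pj)).
have L1 := primitiveD (primitiveD (primitive_sub a0 (lexx _) pg)
  (primitiveZ (- L) (sub _ _ pe))) (primitiveZ (- (2 * (K * w))) (primitive_id a (T - h))).
have := primitive_le (ltW aT) L1 R1.
rewrite /= subrK => /(_ _)/wrap[|H]; last by move: H; lra.
move=> t; rewrite in_itv/= => /andP[at' tT].
have thT : t + h <= T by lra.
have t0 : 0 <= t by lra.
have tTh : t <= T - h by lra.
have := @step t h w h0 t0 thT w0 Kw (fun s => zw t s t0 tTh).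
by rewrite -/c2; lra.
Qed.

(** The dissipation of the quotients is kept for each small [h], since its limit is identified only
    later by lower semicontinuity; all the other terms are replaced by their limits up to [e]. *)
Let energy_limit a e Pe : 0 <= a < T -> 0 < e -> primitive 0 T Pe en ->
  exists2 r, 0 < r & forall h, 0 < h < r -> a < T - h /\
    forall Gh, primitive 0 (T - h) Gh (fun t => g (dq z h t) (dq z h t)) ->
    b (zt a) (zt a) + en a + (Gh (T - h) - Gh a) <=
    b (zt T) (zt T) + en T + c2 * (J T - J a) + L * (Pe T - Pe a) + e.
Proof.
move=> /andP[a0 aT] e0 pe; have L_ge2' := L_ge2.
have e9' : 0 < e / 9 by rewrite divr_gt0.
have [PJ pj] := primitive_ex T0 J_cont.
have aT' : a \in `[0, T] by rewrite in_itv/= a0 ltW.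
have TT : T \in `[0, T] by rewrite in_itv/= lexx ltW.
have [r1 r10 P1] := mean_close pe en_cont aT' e9'.
have [r2 r20 P2] := mean_close pe en_cont TT e9'.
have [r3 r30 P3] := mean_close pj J_cont aT' e9'.
have [r4 r40 P4] := mean_close pj J_cont TT e9'.
have [s5 s50 Q5] := sd_sqr_close Xb (Xzt aT') e9'.
have [s6 s60 Q6] := sd_sqr_close Xb (Xzt TT) e9'.
have [r5 r50 P5] := C1_strong F Hz s50.
have [r6 r60 P6] := C1_strong F Hz s60.
have K0 : 0 < K by rewrite /K ltr_pwDr ?sqr_ge0// mulr_gt0// (lt_le_trans _ L_ge2').
(* The first bound lets [step] absorb the freezing error, the second makes its total over [[0, T]]
   at most [e / 9]. *)
pose w := Num.min (1 / 2 / K) (e / 9 / (2 * K * T)).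
have w0 : 0 < w by rewrite lt_min !divr_gt0// !mulr_gt0.
have Kw : K * w <= 1 / 2 by rewrite mulrC -ler_pdivlMr// ge_min lexx.
have KwT : 2 * (K * w) * T <= e / 9.
  by rewrite (_ : 2 * (K * w) * T = w * (2 * K * T)); [rewrite -ler_pdivlMr ?mulr_gt0// ge_min lexx orbT|ring].
have [r7 r70 P7] := Ctime_unif Yh cz w0.
exists (Num.min (T - a) (Num.min (Num.min (Num.min r1 r2) (Num.min r3 r4)) (Num.min (Num.min r5 r6) r7))).
  by rewrite !lt_min subr_gt0 aT r10 r20 r30 r40 r50 r60.
move=> h; rewrite !lt_min => /andP[h0 /andP[haT /andP[/andP[/andP[h1 h2] /andP[h3 h4]] /andP[/andP[h5 h6] h7]]]].
have [aTh hT0 ThT' ah0 ahT'] := step_bounds a0 h0 haT.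
split => // Gh pg.
have zw t s : 0 <= t -> t <= T - h -> t <= s <= t + h -> nh (z s - z t) <= w.
  move=> t0 tTh /andP[ts sth]; have [s0 sT tT sth'] := step_bounds' t0 tTh ts sth.
  apply/ltW/P7; rewrite ?in_itv/= ?s0 ?t0//.
  by rewrite ger0_norm ?subr_ge0// (le_lt_trans sth').
have H := energy_h h0 a0 aTh (ltW w0) Kw zw pe pj pg.
have hn0 : h != 0 by rewrite gt_eqF.
have ThT : T - h \in `[0, T] by rewrite in_itv/= hT0.
have ahT : a + h \in `[0, T] by rewrite in_itv/= ah0.
have aha : `|a + h - a| = h by rewrite addrC addKr gtr0_norm.
have ThTh : `|T - h - T| = h by rewrite addrC addKr normrN gtr0_norm.
have E1 : `|(Pe (a + h) - Pe a) / h - en a| <= e / 9.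
  by apply: P1 => //; rewrite ?aha// subrr normr0.
have E2 : `|(Pe T - Pe (T - h)) / h - en T| <= e / 9.
  by have := P2 (T - h) h h0; rewrite subrK subrr normr0 ThTh; apply.
have E3 : `|(PJ (a + h) - PJ a) / h - J a| <= e / 9.
  by apply: P3 => //; rewrite ?aha// subrr normr0.
have E4 : `|(PJ T - PJ (T - h)) / h - J T| <= e / 9.
  by have := P4 (T - h) h h0; rewrite subrK subrr normr0 ThTh; apply.
have Xa := Xz aT'; have Xa' := Xz ahT; have XT := Xz TT; have XT' := Xz ThT.
have Xta := Xzt aT'; have XtT := Xzt TT.
have dqX t : t \in `[0, T] -> t + h \in `[0, T] -> X (dq z h t).
  by move=> tT thT; apply: (sdXZ Xb); apply: (sdXB Xb); exact: Xz.
have E5 : `|b (dq z h a) (dq z h a) - b (zt a) (zt a)| <= e / 9.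
  apply: Q5; first exact: dqX.
  have := P5 (a + h) a ahT aT'; rewrite aha => /(_ h5).
  rewrite (_ : a + h - a = h); last by rewrite addrC addKr.
  move=> hh.
  have -> : dq z h a - zt a = h^-1 *: (z (a + h) - z a - h *: zt a).
    by rewrite /dq [in RHS]scalerBr scalerA mulVf// scale1r.
  rewrite (sdnormZ Xb); last by apply: (sdXB Xb); [exact: (sdXB Xb)|exact: (sdXZ Xb)].
  by rewrite gtr0_norm ?invr_gt0// mulrC ler_pdivrMr.
have E6 : `|b (dq z h (T - h)) (dq z h (T - h)) - b (zt T) (zt T)| <= e / 9.
  apply: Q6; first by apply: dqX => //; rewrite subrK.
  have := P6 (T - h) T ThT TT; rewrite ThTh => /(_ h6).
  rewrite (_ : T - h - T = - h); last by rewrite addrC addKr.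
  move=> hh.
  have -> : dq z h (T - h) - zt T = (- h^-1) *: (z (T - h) - z T - (- h) *: zt T).
    rewrite /dq subrK [in RHS]scalerBr scalerA mulrNN mulVf// scale1r.
    by rewrite scaleNr -scalerN opprB.
  rewrite (sdnormZ Xb); last by apply: (sdXB Xb); [exact: (sdXB Xb)|exact: (sdXZ Xb)].
  by rewrite normrN gtr0_norm ?invr_gt0// mulrC ler_pdivrMr.
have hw : 2 * (K * w) * (T - h - a) <= e / 9.
  apply: le_trans KwT; apply: ler_wpM2l; first by rewrite !mulr_ge0// ltW.
  by rewrite (le_trans _ ThT')// gerBl.
have hL : L * (Pe (T - h) - Pe a) <= L * (Pe T - Pe a).
  apply: ler_wpM2l; first exact: le_trans L_ge2'.
  rewrite lerD2r; have := primitive_le ThT' (primitive_cst _ _ 0) (primitive_sub hT0 (lexx T) pe).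
  rewrite subrr subr_ge0; apply => t; rewrite in_itv/= => /andP[tT1 tT2].
  by apply: en_ge0; rewrite in_itv/= (le_trans hT0 (ltW tT1)) ltW.
exact: (limit_algebra c2_ge0 c2_le2 e0 E1 E2 E3 E4 E5 E6 hw hL H).
Qed.

Let A := b (zt T) (zt T) + en T + c2 * J T.

Let J_ge0 t : 0 <= J t.
Proof. by apply: Rintegral_ge0. Qed.

(** [energy_limit] serves twice: without its dissipation it gives the integral inequality required
    by [gronwall]; then at time [a] the dissipation is kept, and Gronwall bounds the remaining
    integral of the energy. *)
Let energy_gronwall a e : 0 <= a < T -> 0 < e -> exists2 r, 0 < r &
  forall h, 0 < h < r -> a < T - h /\
    forall Gh, primitive 0 (T - h) Gh (fun t => g (dq z h t) (dq z h t)) ->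
    b (zt a) (zt a) + en a + (Gh (T - h) - Gh a) <= expR (L * (T - a)) * A + e.
Proof.
move=> /andP[a0 aT] e0.
have [Pe pe] := primitive_ex T0 en_cont.
have L_ge2' := L_ge2.
have JA t : c2 * (J T - J t) <= c2 * J T.
  by rewrite ler_wpM2l ?c2_ge0// gerBl J_ge0.
have TT : T \in `[0, T] by rewrite in_itv/= lexx ltW.
have GE t : t \in `[0, T] -> en t <= A + L * (Pe T - Pe t).
  rewrite in_itv/= => /andP[t0]; rewrite le_eqVlt => /predU1P[->|tT].
    rewrite subrr mulr0 addr0 /A addrAC lerDr addr_ge0//; last by rewrite mulr_ge0 ?c2_ge0// J_ge0.
    exact: (sd_ge0 Xb (Xzt TT)).
  apply/ler_addgt0Pr => d d0; have [|r r0 H] := @energy_limit t d Pe _ d0 pe.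
    by rewrite t0 tT.
  have [h hr] : exists h, 0 < h < r by exists (r / 2); lra.
  have [tTh {}H] := H h hr.
  have hT : 0 <= h < T by lra.
  have TH : 0 < T - h by lra.
  have Th0 : T - h <= T by lra.
  have cy := Ctime_sqr Yg (Ctime_dq Yg (proj1 (andP hT)) cg).
  have [Gh pg] := primitive_ex TH cy.
  have := H Gh pg; have := JA t.
  have := sd_ge0 Xb (Xzt (_ : t \in `[0, T])); rewrite in_itv/= t0 (ltW tT) => /(_ isT) h1.
  have : 0 <= Gh (T - h) - Gh t.
    have p0 := primitive_sub t0 (lexx _) pg.
    have := primitive_le (ltW tTh) (primitive_cst _ _ 0) p0; rewrite subrr; apply.
    move=> s; rewrite in_itv/= => /andP[ts sT].
    have ys : s \in `[0, T - h] by rewrite in_itv/=; lra.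
    by apply: (sd_ge0 Yg); exact: Ctime_in (Ctime_dq Yg (proj1 (andP hT)) cg) ys.
  rewrite /A; lra.
have G := gronwall T0 (_ : 0 <= L) en_cont pe GE.
have [|r r0 H] := @energy_limit a e Pe _ e0 pe; first by rewrite a0 aT.
exists r => // h hr; have [aTh {}H] := H h hr; split => // Gh pg.
have aT' : a \in `[0, T] by rewrite in_itv/= a0 ltW.
have := H Gh pg; have := JA a; have := G _ a aT'; rewrite /A.
move=> /(_ _)/wrap[|]; lra.
Qed.

Lemma energy_bound a : 0 <= a <= T ->
  b (zt a) (zt a) + en a <= expR (L * (T - a)) * A.
Proof.
move=> /andP[a0]; rewrite le_eqVlt => /predU1P[->|aT].
  rewrite subrr mulr0 expR0 mul1r /A lerDl.
  by rewrite mulr_ge0 ?J_ge0 ?c2_ge0.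
apply/ler_addgt0Pr => d d0; have [|r r0 H] := @energy_gronwall a d _ d0.
  by rewrite a0 aT.
have [h hr] : exists h, 0 < h < r by exists (r / 2); lra.
have [aTh {}H] := H h hr.
have hT : 0 <= h < T by lra.
have TH : 0 < T - h by lra.
have cy := Ctime_sqr Yg (Ctime_dq Yg (proj1 (andP hT)) cg).
have [Gh pg] := primitive_ex TH cy.
have := H Gh pg.
have : 0 <= Gh (T - h) - Gh a.
  have p0 := primitive_sub a0 (lexx _) pg.
  have := primitive_le (ltW aTh) (primitive_cst _ _ 0) p0; rewrite subrr; apply.
  move=> s; rewrite in_itv/= => /andP[ts sT].
  have ys : s \in `[0, T - h] by rewrite in_itv/=; lra.
  by apply: (sd_ge0 Yg); exact: Ctime_in (Ctime_dq Yg (proj1 (andP hT)) cg) ys.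
lra.
Qed.

Let dq_cvg t e : t \in `]0, T[ -> 0 < e -> exists2 r, 0 < r &
  forall h, 0 < h < r -> t + h \in `[0, T] /\ nb (dq z h t - zt t) <= e.
Proof.
move=> tT e0; have [r1 r10 P1] := C1_strong F Hz e0.
have [r2 r20 P2] := itv_ball tT.
exists (Num.min r1 r2); first by rewrite lt_min r10.
move=> h; rewrite lt_min => /andP[h0 /andP[h1 h2]].
have tT' : t \in `[0, T] by exact: subset_itv_oo_cc tT.
have E : t + h - t = h by ring.
have thT : t + h \in `[0, T] by apply: P2; rewrite E gtr0_norm.
split => //.
have := P1 (t + h) t thT tT'; rewrite E gtr0_norm// => /(_ h1) hh.
have hn0 : h != 0 by rewrite gt_eqF.
have -> : dq z h t - zt t = h^-1 *: (z (t + h) - z t - h *: zt t).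
  by rewrite /dq [in RHS]scalerBr scalerA mulVf// scale1r.
have Xa := Xz tT'; have Xb' := Xz thT; have Xc := Xzt tT'.
rewrite (sdnormZ Xb); last by apply: (sdXB Xb); [exact: (sdXB Xb)|exact: (sdXZ Xb)].
by rewrite gtr0_norm ?invr_gt0// mulrC ler_pdivrMr.
Qed.

(** [ng (zt t)] is nearly attained against one fixed test function, and that pairing is continuous
    for [nb], in which the quotients converge. *)
Let ng_lsc t e : t \in `]0, T[ -> Y (zt t) -> 0 < e -> exists2 r, 0 < r &
  forall h, 0 < h < r -> ng (zt t) - e <= ng (dq z h t).
Proof.
move=> tT Yt e0; have e2 : 0 < e / 2 by rewrite divr_gt0.
have [psi [Dpsi p1 p2]] := ef_dualY F Yt e2.
have Xpsi := DX Dpsi; have np := sdnorm_ge0 (b := b) psi.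
have [|r r0 P1] := dq_cvg tT (_ : 0 < e / 2 / (nb psi + 1)).
  by rewrite divr_gt0// ltr_pwDr.
exists r => // h hr; have [thT hh] := P1 h hr.
have tT' : t \in `[0, T] by exact: subset_itv_oo_cc tT.
have Yd := (dq_H0 tT' thT).1; have Xd := YX Yd; have Xt := YX Yt.
have := le_trans (ler_norm _) (p2 _ Yd).
have := sd_CS Xb (sdXB Xb Xd Xt) Xpsi; rewrite (sdBl Xb Xd Xt Xpsi) ler_norml => /andP[q1 _].
have q2 : nb (dq z h t - zt t) * nb psi <= e / 2.
  apply: le_trans (ler_wpM2r np hh) _.
  by rewrite mulrAC ler_pdivrMr ?ltr_pwDr// ler_pM2l// lerDl.
lra.
Qed.

Hypothesis ztY : {ae mu, forall t, t \in `]0, T[ -> Y (zt t)}.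

(* [s |-> ng (zt s)] need not be measurable, hence the majorant. *)
Lemma energy_dissipation a e : 0 <= a < T -> 0 < e -> exists f : R -> \bar R,
  [/\ measurable_fun `[a, T] f, forall s, (0 <= f s)%E,
      {ae mu, forall s, `[a, T]%classic s -> ((ng (zt s) ^+ 2)%:E <= f s)%E} &
      (\int[mu]_(s in `[a, T]) f s <= (expR (L * (T - a)) * A + e)%:E)%E].
Proof.
move=> /andP[a0 aT] e0.
have [|r r0 H] := @energy_gronwall a e _ e0; first by rewrite a0 aT.
(* Dividing by at least 2 keeps [h n] strictly below [r]. *)
pose h n := r / n.+2%:R.
have h0 n : 0 < h n by rewrite divr_gt0.
have hr n : h n < r by rewrite ltr_pdivrMr// ltr_pMr// ltr1n.
have hT n : 0 <= h n < T by have [|+ _] := H (h n); [rewrite h0 hr|have := h0 n; lra].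
have aTh n : a < T - h n by have [|+ _] := H (h n); [rewrite h0 hr|].
have cy n := Ctime_sqr Yg (Ctime_dq Yg (proj1 (andP (hT n))) cg).
(* Extension by zero brings the quotients, available only up to [T - h n], to the common interval
   [[a, T]] on which Fatou's lemma is applied. *)
pose f n t := ((fun t => g (dq z (h n) t) (dq z (h n) t)) \_ `[a, T - h n]) t.
have cya n : {within `[a, T - h n], continuous (fun t => g (dq z (h n) t) (dq z (h n) t))}.
  by apply: continuous_subspaceW (cy n); apply: subset_itvr; rewrite bnd_simp.
have yge0 n t : t \in `[a, T - h n] -> 0 <= g (dq z (h n) t) (dq z (h n) t).
  rewrite in_itv/= => taT; have ys : t \in `[0, T - h n] by rewrite in_itv/=; lra.
  by apply: (sd_ge0 Yg); exact: Ctime_in (Ctime_dq Yg (proj1 (andP (hT n))) cg) ys.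
have f0 n t : 0 <= f n t.
  by rewrite /f patchE; case: ifPn => // /set_mem /= /yge0.
have mf n : measurable_fun `[a, T] (EFin \o f n).
  apply/measurable_EFinP; apply: measurable_funTS.
  apply/(measurable_restrictT _ _).1 => //.
  apply/measurable_EFinP; exact: measurable_int (within_integrable (cya n)).
have If n : (\int[mu]_(s in `[a, T]) (f n s)%:E <= (expR (L * (T - a)) * A + e)%:E)%E.
  have [|_ Hn] := H (h n); first by rewrite h0 hr.
  have TH : 0 < T - h n by have := hT n; lra.
  have [Gh pg] := primitive_ex TH (cy n).
  have -> : (\int[mu]_(s in `[a, T]) (f n s)%:E)%E =
      (\int[mu]_(s in `[a, (T - h n)%R]) (g (dq z (h n) s) (dq z (h n) s))%:E)%E.
    have sub : `[a, T - h n]%classic `<=` `[a, T]%classic.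
      by apply: subset_itvl; rewrite bnd_simp; have := h0 n; lra.
    rewrite -[in RHS](setIidr sub) integral_mkcondr; apply: eq_integral => s _.
    by rewrite /f !patchE; case: ifPn.
  have := primitive_integral (ltW (aTh n)) (cya n) (primitive_sub a0 (lexx _) pg).
  rewrite /Rintegral => E; rewrite -[X in (X <= _)%E]fineK ?E; last first.
    exact: integrable_fin_num (within_integrable (cya n)).
  rewrite lee_fin; have := Hn Gh pg.
  have aT' : a \in `[0, T] by rewrite in_itv/= a0 ltW.
  have := sd_ge0 Xb (Xzt aT'); have := en_ge0 aT'; lra.
exists (fun s => limn_einf (fun n => (f n s)%:E)); split.
- exact: measurable_fun_limn_einf mf.
- by move=> s; apply: limn_einf_ge; apply: nearW => n; rewrite lee_fin.
- have oo := ae_itv_oo a T.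
  apply: ae_imp2 oo ztY => s so zs /so; rewrite in_itv/= => /andP[as' sT].
  have s0T : s \in `]0, T[ by rewrite in_itv/= sT (le_lt_trans a0 as').
  have Ys := zs s0T.
  apply/lee_subgt0Pr => d d0.
  have n0 := sdnorm_ge0 (b := g) (zt s).
  (* With [x = ng (zt s)] and [v = d / (2 x + 1)] one has [2 x v <= d], hence
     [(x - v)^2 >= x^2 - d]: this converts the error on norms into an error on squares. *)
  have d1 : 0 < d / (2 * ng (zt s) + 1) by rewrite divr_gt0// ltr_pwDr// mulr_ge0.
  have [r1 r10 P1] := ng_lsc s0T Ys d1.
  rewrite -EFinB; apply: limn_einf_ge.
  have hc : h n @[n --> \oo] --> (0 : R).
    have : r * n.+1%:R^-1 @[n --> \oo] --> (r * 0 : R).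
      by apply: cvgMl_tmp; exact: cvg_harmonic.
    rewrite mulr0 => rc; apply: (squeeze_cvgr _ (cvg_cst 0) rc).
    by apply: nearW => n; rewrite (ltW (h0 n)) ler_wpM2l ?(ltW r0)// lef_pV2 ?posrE// ler_nat.
  have m0 : 0 < Num.min r1 (T - s) by rewrite lt_min r10 subr_gt0.
  have /cvgrPdist_lt/(_ _ m0) := hc; apply: filterS => n; rewrite sub0r normrN gtr0_norm// lt_min => /andP[hn1 hn2].
  rewrite lee_fin /f patchE mem_set; last by rewrite /= in_itv/=; lra.
  have ys : s \in `[0, T - h n] by rewrite in_itv/=; lra.
  have Yd := Ctime_in (Ctime_dq Yg (proj1 (andP (hT n))) cg) ys.
  rewrite -(sdnorm_sqr Yg Yd).
  have hrn : 0 < h n < r1 by rewrite h0.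
  have h1 := P1 _ hrn; have n1 := sdnorm_ge0 (b := g) (dq z (h n) s).
  have [le|lt] := leP (ng (zt s)) (d / (2 * ng (zt s) + 1)).
    apply: le_trans (sqr_ge0 _); rewrite subr_le0 expr2.
    apply: le_trans (ler_wpM2l n0 le) _.
    by rewrite mulrCA ler_piMr ?(ltW d0)// ler_pdivrMr ?ltr_pwDr ?mulr_ge0// mul1r; lra.
  set x := ng (zt s) in h1 n0 d1 lt *; set v := d / _ in h1 d1 lt.
  have vE : v * (2 * x + 1) = d by rewrite /v divfK// gt_eqF// ltr_pwDr// mulr_ge0.
  have : (x - v) ^+ 2 <= ng (dq z (h n) s) ^+ 2 by rewrite ler_pXn2r ?nnegrE//; lra.
  by apply: le_trans; rewrite -vE sqrrB; have := sqr_ge0 v; nra.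
- have mI : measurable `[a, T] by exact: measurable_itv.
  have f0' n s : `[a, T]%classic s -> (0 <= (f n s)%:E)%E by rewrite lee_fin.
  apply: (le_trans (@fatou _ _ _ mu _ mI (fun n => EFin \o f n) mf f0')).
  exact: limn_einf_le.
Unshelve. all: by end_near. Qed.

End energy_estimate.

Lemma ge0_subset_integral_nm d (T : measurableType d) (R : realType)
    (mu : {measure set T -> \bar R}) (A B : set T) (f : T -> \bar R) :
  A `<=` B -> (forall x, 0 <= f x)%E ->
  (\int[mu]_(x in A) f x <= \int[mu]_(x in B) f x)%E.
Proof.
move=> AB f0; rewrite integral_mkcond [leRHS]integral_mkcond.
apply: ge0_ae_le_integral.
- by move=> x _; rewrite patchE; case: ifPn.
- by move=> x _; rewrite patchE; case: ifPn.
apply: aeW => x _; rewrite !patchE; case: ifPn => [/set_mem/AB Bx|_].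
  by rewrite mem_set.
by case: ifPn.
Qed.

(** * Time derivatives belong to the energy space almost everywhere *)

Section L2time_theory.
Context {R : realType} {V : lmodType R}.
Implicit Types (X : set V) (N : V -> R) (T s t e r : R) (u : R -> V).
Local Notation mu := (@lebesgue_measure R).

(** A simple function takes finitely many values on measurable sets, so it may be composed with an
    arbitrary [Fn]. The induction distinguishes whether [t] is in the first set and shifts the
    argument of [Fn] accordingly. *)
Lemma simple_comp_measurable n (A : 'I_n -> set R) (h : 'I_n -> V) (Fn : V -> R) :
  (forall i, measurable (A i)) ->
  measurable_fun setT (fun t : R => Fn (\sum_i \1_(A i) t *: h i)).
Proof.
elim: n A h Fn => [|n IH] A h Fn mA.
  rewrite (_ : (fun t => _) = fun=> Fn 0); first exact: measurable_cst.
  by apply/funext => t; rewrite big_ord0.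
rewrite (_ : (fun t => _) = (fun t => if t \in A ord0
    then Fn (h ord0 + \sum_(i < n) \1_(A (lift ord0 i)) t *: h (lift ord0 i))
    else Fn (\sum_(i < n) \1_(A (lift ord0 i)) t *: h (lift ord0 i)))).
  apply: measurable_fun_ifT.
  - apply: (measurable_fun_bool true); rewrite setTI.
    rewrite (_ : _ @^-1` _ = A ord0)//; apply/seteqP; split => t /=; first by move/set_mem.
    by move/mem_set.
  - by apply: (IH _ _ (fun v => Fn (h ord0 + v))) => i; exact: mA.
  - by apply: IH => i; exact: mA.
apply/funext => t; rewrite big_ord_recl indicE; case: ifPn => _.
  by rewrite scale1r.
by rewrite scale0r add0r.
Qed.

Lemma simple_range X n (A : 'I_n -> set R) (h : 'I_n -> V) :
  X 0 -> (forall f g, X f -> X g -> X (f + g)) -> (forall i, X (h i)) ->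
  exists l : seq V, (forall v, v \in l -> X v) /\
    forall t, \sum_i \1_(A i) t *: h i \in l.
Proof.
move=> X0 XD; elim: n A h => [|n IH] A h Xh.
  exists [:: 0]; split; first by move=> v; rewrite inE => /eqP ->.
  by move=> t; rewrite big_ord0 inE.
have [l [Xl lP]] := IH (fun i => A (lift ord0 i)) (fun i => h (lift ord0 i)) (fun i => Xh _).
exists (l ++ [seq h ord0 + v | v <- l]); split.
  move=> v; rewrite mem_cat => /orP[/Xl//|/mapP[w /Xl Xw ->]].
  exact: XD.
move=> t; rewrite big_ord_recl indicE mem_cat; case: (t \in A ord0).
  by rewrite scale1r map_f ?orbT.
by rewrite scale0r add0r lP.
Qed.

Record seminorm_on X N : Prop := {
  sn_0 : X 0;
  sn_D : forall f g, X f -> X g -> X (f + g);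
  sn_B : forall f g, X f -> X g -> X (f - g);
  sn_ge0 : forall f, X f -> 0 <= N f;
  sn_C : forall f g, X f -> X g -> N (f - g) = N (g - f);
  sn_dist : forall f g, X f -> X g -> `|N f - N g| <= N (f - g) }.

(** [G] is meant to collect the times at which [u] lies in [X] and is the limit of its simple
    approximations; [c] enumerates the values of the latter, so that the range of [u] on [G] is
    separable. Norms are set to zero off [G], which makes them measurable. *)
Record good_times T X N u (G : set R) (c : nat -> V) : Prop := {
  gt_measurable : measurable G;
  gt_sub : G `<=` `]0, T[;
  gt_ae : {ae mu, forall t, t \in `]0, T[ -> G t};
  gt_X : forall t, G t -> X (u t);
  gt_fun : forall f, X f -> measurable_fun setT ((fun t => N (u t - f)) \_ G);
  gt_c : forall k, X (c k);
  gt_dense : forall t e, G t -> 0 < e -> exists k, N (u t - c k) < e;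
  gt_sqr : (\int[mu]_(t in G) (N (u t) ^+ 2)%:E < +oo)%E }.

Lemma L2time_good T X N u : seminorm_on X N -> L2time T X N u ->
  exists G c, good_times T X N u G c.
Proof.
move=> sN [[N1 [mN1 N10 XN1]] [s [simp [N2 [mN2 N20 cN2]]]] fin].
pose G : set R := `]0, T[%classic `\` (N1 `|` N2).
have mG : measurable G by apply: measurableD => //; exact: measurableU.
have XG t : G t -> X (u t).
  move=> [t0T nN]; apply: contrapT => nX; apply: nN; left; apply: XN1 => /=.
  by move=> /(_ t0T).
have cG t : G t -> N (s n t - u t) @[n --> \oo] --> (0 : R).
  move=> [t0T nN]; apply: contrapT => nX; apply: nN; right; apply: cN2 => /=.
  by move=> /(_ t0T).
have Xs n t : X (s n t).
  have [k [A [h [mAh ->]]]] := simp n.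
  have [l [Xl lP]] := simple_range A (sn_0 sN) (sn_D sN) (fun i => (mAh i).2).
  exact: Xl.
have H n : exists l : seq V, (forall v, v \in l -> X v) /\ forall t, s n t \in l.
  have [k [A [h [mAh sE]]]] := simp n.
  have [l [Xl lP]] := simple_range A (sn_0 sN) (sn_D sN) (fun i => (mAh i).2).
  by exists l; split => // t; rewrite sE.
have [l lP] := choice H.
(* All values in all the lists [l n] are enumerated; the default is 0, which belongs to [X]. *)
pose c m := if unpickle m is Some (n, k) then nth 0 (l n) k else 0.
have Xc m : X (c m).
  rewrite /c; case: unpickle => [[n k]|]; last exact: sn_0 sN.
  have [kl|kl] := ltnP k (size (l n)); first by apply: (lP n).1; exact: mem_nth.
  by rewrite nth_default//; exact: sn_0 sN.
exists G, c; split => //.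
- by move=> t [].
- exists (N1 `|` N2); split.
  + exact: measurableU.
  + by rewrite measureU0.
  + move=> t /= /not_implyP[t0T nG]; apply: contrapT => nN; apply: nG; split => //.
- move=> f Xf; apply/(measurable_restrictT _ _).1 => //.
  apply: (@measurable_fun_cvg _ _ _ _ (fun n t => N (s n t - f))).
    move=> n; apply: measurable_funTS.
    have [k [A [h [mAh sE]]]] := simp n.
    rewrite (_ : (fun t => _) = (fun t => (fun v => N (v - f)) (\sum_i \1_(A i) t *: h i))).
      by apply: (simple_comp_measurable h (fun v => N (v - f))) => i; exact: (mAh i).1.
    by apply/funext => t; rewrite sE.
  move=> t Gt; apply/cvgrPdist_le => e e0.
  have /cvgrPdist_le/(_ e e0) := cG t Gt; apply: filterS => n.
  have Xut := XG t Gt.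
  rewrite sub0r normrN => h; rewrite distrC.
  apply: le_trans (sn_dist sN (sn_B sN (Xs n t) Xf) (sn_B sN Xut Xf)) _.
  rewrite opprB addrA subrK; apply: le_trans h; exact: ler_norm.
- move=> t e Gt e0; have /cvgrPdist_lt/(_ e e0) := cG t Gt.
  move=> [n _ /(_ n (leqnn n))]; rewrite /= sub0r normrN => h.
  exists (pickle (n, index (s n t) (l n))); rewrite /c pickleK nth_index; last exact: (lP n).2.
  have Xut := XG t Gt.
  by rewrite (sn_C sN Xut (Xs n t)); apply: le_lt_trans h; exact: ler_norm.
- apply: le_lt_trans fin; apply: ge0_subset_integral_nm; first by move=> t [].
  by move=> t; rewrite lee_fin sqr_ge0.
Qed.

Section good.
Context (X : set V) (N : V -> R) (T : R) (u : R -> V) (G : set R) (c : nat -> V).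
Hypotheses (sN : seminorm_on X N) (gG : good_times T X N u G c).

Lemma good_sqr_integrable : mu.-integrable setT (EFin \o ((fun t => N (u t) ^+ 2) \_ G)).
Proof.
have m0 := gt_fun gG (sn_0 sN).
have -> : (fun t => N (u t) ^+ 2) \_ G =
    (fun t => ((fun t => N (u t - 0)) \_ G) t ^+ 2).
  apply/funext => t; rewrite /= !patchE; case: ifPn => _; first by rewrite subr0.
  by rewrite expr0n.
apply/integrableP; split; first by apply/measurable_EFinP; exact: measurable_funX.
apply: le_lt_trans (gt_sqr gG); rewrite [leRHS]integral_mkcond.
apply: ge0_ae_le_integral => //.
  by move=> t _; rewrite patchE; case: ifPn => // _; rewrite lee_fin sqr_ge0.
apply: aeW => t _; rewrite /= !patchE; case: ifPn => _ /=.
  by rewrite subr0 lee_fin ger0_norm// sqr_ge0.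
by rewrite expr0n normr0.
Qed.

(** By the triangle inequality [N (u - f)] is at most [N u + k], and [N u] is at most [(N u)^2 + 1],
    on a set of finite measure. *)
Lemma good_integrable f : X f ->
  mu.-integrable setT (EFin \o ((fun t => N (u t - f)) \_ G)).
Proof.
move=> Xf; pose k := N (0 - f).
have k0 : 0 <= k by apply: (sn_ge0 sN); apply: (sn_B sN) => //; exact: (sn_0 sN).
have i1 : mu.-integrable setT (EFin \o (cst (1 + k) \_ G)).
  have i0 : mu.-integrable `[0, T] (EFin \o cst (1 + k)).
    by apply: within_integrable => t; exact: cvg_cst.
  rewrite -restrict_EFin; apply/integrable_restrict => //; first exact: (gt_measurable gG).
  rewrite setTI; apply: integrableS i0 => //; first exact: (gt_measurable gG).
  by apply: subset_trans (gt_sub gG) _; exact: subset_itv_oo_cc.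
apply: (le_integrable _ _ _ (integrableD _ good_sqr_integrable i1)) => //.
  by apply/measurable_EFinP; exact: (gt_fun gG).
move=> t _ /=; rewrite lee_fin !patchE; case: ifPn => [/set_mem Gt|_]; last first.
  by rewrite addr0 normr0.
have Xu := gt_X gG Gt.
have X0 := sn_0 sN.
have := sn_dist sN (sn_B sN Xu Xf) (sn_B sN Xu X0).
have -> : u t - f - (u t - 0) = 0 - f by rewrite subr0 addrAC subrr.
rewrite -/k subr0 => h.
have n0 := sn_ge0 sN Xu; have n1 := sn_ge0 sN (sn_B sN Xu Xf).
rewrite (ger0_norm n1) ger0_norm; last by rewrite addr_ge0 ?sqr_ge0// addr_ge0.
move: h; rewrite ler_norml => /andP[_]; rewrite /cst.
by have := sqr_ge0 (N (u t) - 1); have := sqr_ge0 (N (u t)); rewrite sqrrB1 mulr2n; lra.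
Qed.

(** Lebesgue differentiation for countably many real functions, with one exceptional set for all
    [k]. By density of the [c k], the remaining times of [G] are Lebesgue points of the
    vector-valued curve. *)
Lemma good_lebesgue_pt : {ae mu, forall t, 0 < t -> forall k,
  is_derive t 1 (fun x => \int[mu]_(s in `[0, x]) ((fun s => N (u s - c k)) \_ G) s)
    (((fun s => N (u s - c k)) \_ G) t)}.
Proof.
have H k : {ae mu, forall t, 0 < t ->
  is_derive t 1 (fun x => \int[mu]_(s in `[0, x]) ((fun s => N (u s - c k)) \_ G) s)
    (((fun s => N (u s - c k)) \_ G) t)}.
  have ik := good_integrable (gt_c gG k).
  have := @FTC1 _ ((fun s => N (u s - c k)) \_ G) (BLeft 0).
  move=> /(_ _ _)/wrap[||Hk].
  - by move=> y; apply: integrableS ik => //; exact: measurable_itv.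
  - by apply: open_integrable_locally => //; exact: openT.
  - apply: ae_imp Hk => t Ht t0; have [|d dE] := Ht; first by rewrite (@lte_fin R) ?ltW.
    exact: is_derive_derive1.
have := ae_foralln H.
by apply: ae_imp => t Ht t0 k; exact: Ht.
Qed.

End good.

End L2time_theory.

Lemma is_derive_increment {R : realType} (f : R -> R) (t df e : R) : is_derive t 1 f df ->
  0 < e -> exists2 r, 0 < r & forall h, 0 < h < r -> f (t + h) - f t <= (df + e) * h.
Proof.
move=> /is_derive1_caratheodory[k [fE kc <-]] e0.
have /cvgrPdist_lt/(_ e e0) := kc; move=> /nbhs_ballP[r /= r0 rP].
exists r => // h /andP[h0 hr]; rewrite fE (_ : t + h - t = h); last by ring.
rewrite ler_pM2r//; have := rP (t + h); rewrite /ball/= opprD addNKr normrN gtr0_norm// => /(_ hr).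
by rewrite ltr_norml; lra.
Qed.

Section energy0_ae.
Context {R : realType} {V : lmodType R}.
Context {X Y D : set V} {b g : V -> V -> R} {Lap : V -> V}.
Hypothesis F : energy_frame X Y D b g Lap.
Local Notation nb := (sdnorm b).
Local Notation ng := (sdnorm g).
Local Notation nh := (sdnorm (hdot b g)).
Local Notation H0 := (energy0 Y D b g).
Local Notation mu := (@lebesgue_measure R).

Lemma seminorm_sdnorm (X' : set V) b' : semi_dot X' b' -> seminorm_on X' (sdnorm b').
Proof.
move=> Xb; split.
- exact: (sd0 Xb).
- by move=> f h; exact: (sdXD Xb).
- by move=> f h; exact: (sdXB Xb).
- by move=> f _; exact: sdnorm_ge0.
- by move=> f h Xf Xh; exact: (sdnormBC Xb).
- by move=> f h Xf Xh; exact: (sdnorm_dist Xb).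
Qed.

(* At a Lebesgue point of [ut] the difference quotients of [u], which stay in
   the closed space H0, converge to [ut] in the norm of Y. *)
Lemma derivative_energy0_ae (T : R) (u ut : R -> V) : C1pair X D b T u ut ->
  (forall t, t \in `[0, T] -> H0 (u t)) -> L2time T Y nh ut ->
  {ae mu, forall t, t \in `]0, T[ -> H0 (ut t)}.
Proof.
move=> Hu uH0 ut2; have Xb := ef_X F; have Yg := ef_Y F; have Yh := semi_dot_hdot F.
have sN := seminorm_sdnorm Yh.
have [G [c gG]] := L2time_good sN ut2.
apply: ae_imp2 (gt_ae gG) (good_lebesgue_pt sN gG) => t Gt Lt t0T.
have {}Gt := Gt t0T; have Yt := gt_X gG Gt.
have [t0 tT] : 0 < t /\ t < T by move: t0T; rewrite in_itv/= => /andP.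
(* When tested, the error is at most three shares [e / 9]: two from [nh (ut t - c k)] and one from
   the derivative of [H]. Duality adds one share for each of the two seminorms [nb] and [ng], eight
   in all. *)
apply: (energy0_closed F Yt) => e e0; have e8 : 0 < e / 9 by rewrite divr_gt0.
have [k hk] := gt_dense gG Gt e8; have Yc := gt_c gG k.
pose f := (fun s => nh (ut s - c k)) \_ G.
pose H x := \int[mu]_(s in `[0, x]) f s.
have ft : f t = nh (ut t - c k) by rewrite /f patchE mem_set.
have [r1 r10 P1] := is_derive_increment (Lt t0 k) e8.
have [h [h0 hr hT]] : exists h, [/\ 0 < h, h < r1 & t + h < T].
  have m0 : 0 < Num.min r1 (T - t) by rewrite lt_min r10 subr_gt0.
  have : Num.min r1 (T - t) / 2 < Num.min r1 (T - t) by lra.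
  rewrite lt_min => /andP[m1 m2]; exists (Num.min r1 (T - t) / 2); split; lra.
have Hh : H (t + h) - H t <= (f t + e / 9) * h by apply: P1; rewrite h0.
exists (dq u h t).
  have tT' : t \in `[0, T] by rewrite in_itv/= !ltW.
  have thT : t + h \in `[0, T] by rewrite in_itv/=; lra.
  have H1 := uH0 _ tT'; have H2 := uH0 _ thT.
  have H00 : H0 0 by rewrite -(subrr (u t)) addrC -scaleN1r; exact: (energy0_lin F).
  rewrite /dq -[_ *: _]addr0; apply: (energy0_lin F) => //.
  by rewrite addrC -scaleN1r; exact: (energy0_lin F).
have tT' : t \in `[0, T] by rewrite in_itv/= !ltW.
have thT : t + h \in `[0, T] by rewrite in_itv/=; lra.
have Y1 := (uH0 _ tT').1; have Y2 := (uH0 _ thT).1.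
have X1 := ef_YX F Y1; have X2 := ef_YX F Y2; have Xt := ef_YX F Yt.
have Yq : Y (dq u h t) by apply: (sdXZ Yg); exact: (sdXB Yg).
have Xq := ef_YX F Yq.
(* the difference quotient is the average of [ut], tested against [psi] *)
have key psi : D psi -> (forall v, Y v -> `|b v psi| <= nh v) ->
    b (dq u h t - ut t) psi <= 3 * (e / 9).
  move=> Dpsi bpsi; have Xpsi := ef_YX F (ef_DY F Dpsi).
  have p := C1_weak Hu Dpsi.
  have th : t <= t + h by lra.
  have p1 := primitive_sub (ltW t0) (ltW hT) p.
  have p2 := primitiveD (primitiveZ (-1) p1) (primitiveZ (b (ut t) psi) (primitive_id t (t + h))).
  have cf : {within `[t, t + h], continuous (fun s => -1 * b (ut s) psi + b (ut t) psi * 1)}.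
    apply: withinD; last by move=> s; exact: cvg_cst.
    apply: withinM; first by move=> s; exact: cvg_cst.
    apply: continuous_subspaceW (Ctime_dot Xb (C1_zt Hu) Xpsi).
    by apply: subset_itv; rewrite bnd_simp; lra.
  have ik : mu.-integrable `[0, T] (EFin \o f).
    by apply: integrableS (good_integrable sN gG Yc) => //; exact: measurable_itv.
  have ik' : mu.-integrable `[t, t + h] (EFin \o f).
    by apply: integrableS ik => //; apply: subset_itv; rewrite bnd_simp; lra.
  have := primitive_ge_ae (A := - nh (ut t - c k)) th cf p2 ik'.
  rewrite -(Rintegral_itvcB ik (ltW t0) th (ltW hT)) -!/(H _) => /(_ _)/wrap[|].
    apply: ae_imp (gt_ae gG) => s Gs sth.
    have {}Gs : G s by apply: Gs; move: sth; rewrite !in_itv/=; lra.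
    have Ys := gt_X gG Gs.
    have fs : f s = nh (ut s - c k) by rewrite /f patchE mem_set.
    have := bpsi _ (sdXB Yg Ys Yt).
    rewrite (sdBl Xb (ef_YX F Ys) Xt Xpsi) ler_norml => /andP[_].
    have := sdnorm_tri Yh Ys Yc Yt; rewrite fs (sdnormBC Yh Yc Yt); lra.
  rewrite (sdBl Xb Xq Xt Xpsi) /dq (sdZl Xb _ (sdXB Xb X2 X1) Xpsi) (sdBl Xb X2 X1 Xpsi).
  move=> I; rewrite -(ler_pM2l h0) mulrBr mulVKf ?gt_eqF//.
  move: I Hh hk; rewrite ft => I Hh hk; nra.
have Yd := sdXB Yg Yq Yt; have Xd := ef_YX F Yd.
rewrite (sdnormBC Yh Yt Yq); apply: le_lt_trans (nh_le F Yd) _.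
have [psi [Dpsi h1 h2]] := ef_dualX F Xd e8.
have [psi' [Dpsi' h1' h2']] := ef_dualY F Yd e8.
have := key _ Dpsi (fun v Yv => le_trans (h2 v (ef_YX F Yv)) (nb_le_nh F Yv)).
have := key _ Dpsi' (fun v Yv => le_trans (h2' v Yv) (ng_le_nh F Yv)).
lra.
Qed.

End energy0_ae.

(** * Square-integrable functions and test functions *)

Section L2_theory.
Context {R : realType} {d : nat}.
Local Notation E := 'rV[R]_d.
Local Notation leb := (lebesgue_rV (R := R) d).
Context {Om : set E} (oOm : open Om).
Implicit Types (f g h : E -> R).

Let mOm : measurable Om. Proof. exact: open_measurable_rV. Qed.

Lemma L2P f : L2 Om f <-> measurable_fun Om f /\ leb.-integrable Om (EFin \o (fun x => f x ^+ 2)).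
Proof.
split.
  move=> fL; have := fL; rewrite /L2/= inE => /andP[+ _]; rewrite inE/= => mf.
  split; first by apply/(measurable_restrictT _ _).2.
  have := Lfun2_integrable_sqr fL.
  rewrite (_ : EFin \o _ = (EFin \o (fun x => f x ^+ 2)) \_ Om).
    by move/(integrable_restrict _ mOm measurableT _).2; rewrite setTI.
  by apply/funext => x; rewrite /= !patchE; case: ifPn => // _; rewrite expr0n.
move=> [mf fi]; rewrite /L2/= inE; apply/andP; split.
  by rewrite inE/=; apply/(measurable_restrictT _ _).1.
rewrite inE/= /finite_norm unlock/= poweR_lty//.
move/integrableP : fi => [_]; rewrite integral_mkcond.
apply: le_lt_trans; rewrite le_eqVlt; apply/orP; left; apply/eqP.
apply: eq_integral => x _; rewrite /= !patchE; case: ifPn => _ /=.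
  by rewrite powR_mulrn// normrX.
by rewrite normr0 powR0// mule1.
Qed.

Lemma L2_measurable f : L2 Om f -> measurable_fun Om f.
Proof. by move=> /L2P[]. Qed.

Lemma L2_sqr f : L2 Om f -> leb.-integrable Om (EFin \o (fun x => f x ^+ 2)).
Proof. by move=> /L2P[]. Qed.

Lemma integrable_EFinD (A : set E) f g : measurable A -> leb.-integrable A (EFin \o f) ->
  leb.-integrable A (EFin \o g) -> leb.-integrable A (EFin \o (fun x => f x + g x)).
Proof. by move=> mA fi gi; exact: (integrableD mA fi gi). Qed.

Lemma integrable_EFinZ (A : set E) a f : measurable A -> leb.-integrable A (EFin \o f) ->
  leb.-integrable A (EFin \o (fun x => a * f x)).
Proof. by move=> mA fi; exact: (integrableZl mA a fi). Qed.

Lemma L2_le f g : measurable_fun Om f -> leb.-integrable Om (EFin \o g) ->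
  (forall x, Om x -> f x ^+ 2 <= g x) -> L2 Om f.
Proof.
move=> mf gi fg; apply/L2P; split => //.
apply: (le_integrable mOm _ _ gi).
  by apply/measurable_EFinP; exact: measurable_funX.
move=> x Ox /=; rewrite lee_fin ger0_norm ?sqr_ge0//.
by apply: le_trans (fg x Ox) _; exact: ler_norm.
Qed.

Lemma L2_mul f g : L2 Om f -> L2 Om g -> leb.-integrable Om (EFin \o (fun x => f x * g x)).
Proof.
move=> fL gL; have mf := L2_measurable fL; have mg := L2_measurable gL.
apply: (le_integrable mOm _ _ (integrable_EFinD mOm (L2_sqr fL) (L2_sqr gL))).
  by apply/measurable_EFinP; exact: measurable_funM.
move=> x Ox /=; rewrite lee_fin [leRHS]ger0_norm ?addr_ge0 ?sqr_ge0//.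
rewrite ler_norml; have := sqr_ge0 (f x + g x); have := sqr_ge0 (f x - g x).
rewrite sqrrB sqrrD; have := sqr_ge0 (f x); have := sqr_ge0 (g x); rewrite !mulr2n; lra.
Qed.

Lemma L2_lin a f g : L2 Om f -> L2 Om g -> L2 Om (a *: f + g).
Proof.
move=> fL gL; have mf := L2_measurable fL; have mg := L2_measurable gL.
have i1 := integrable_EFinZ (2 * a ^+ 2) mOm (L2_sqr fL).
have i2 := integrable_EFinZ 2 mOm (L2_sqr gL).
apply: (L2_le _ (integrable_EFinD mOm i1 i2)).
  rewrite (_ : a *: f + g = fun x => a * f x + g x)//.
  by apply: measurable_funD => //; exact: measurable_funM.
move=> x Ox /=; rewrite -[(a *: f + g) x]/(a * f x + g x).
have := sqr_ge0 (a * f x - g x); rewrite sqrrB sqrrD exprMn !mulr2n; lra.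
Qed.

Lemma L2_0 : L2 Om 0.
Proof.
apply/L2P; split; first exact: measurable_cst.
rewrite (_ : EFin \o _ = cst 0%E); first exact: integrable0.
by apply/funext => x /=; rewrite expr0n.
Qed.

Lemma semi_dot_dot : semi_dot (L2 Om) (dot Om).
Proof.
split.
- exact: L2_0.
- by move=> a f g; exact: L2_lin.
- by move=> f g _ _; apply: eq_Rintegral => x _; rewrite mulrC.
- move=> a f g h fL gL hL; rewrite /dot.
  have i1 := L2_mul fL hL; have i2 := L2_mul gL hL.
  rewrite -RintegralZl// -RintegralD//; last exact: integrable_EFinZ.
  by apply: eq_Rintegral => x _; rewrite -[(a *: f + g) x]/(a * f x + g x) mulrDl mulrA.
- by move=> f fL; apply: Rintegral_ge0 => x _; rewrite -expr2 sqr_ge0.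
Qed.

Lemma dot_ae f g h : eq_ae Om f g -> dot Om f h = dot Om g h.
Proof. by move=> fg; apply: ae_eq_Rintegral; apply: ae_imp fg => x /[apply] ->. Qed.

Lemma L2_bounded (A : set E) f M : measurable A -> A `<=` Om -> (leb A < +oo)%E ->
  measurable_fun Om f -> (forall x, Om x -> `|f x| <= M) ->
  (forall x, ~ A x -> f x = 0) -> L2 Om f.
Proof.
move=> mA AOm Afin mf fM f0; apply: (@L2_le _ (fun x => M ^+ 2 * \1_A x)) => //.
  have : leb.-integrable Om (EFin \o \1_A).
    apply/integrableP; split; first by apply/measurable_EFinP; exact: measurable_funTS.
    apply: le_lt_trans Afin; rewrite (eq_integral (fun x => (\1_A x)%:E)).
      by rewrite integral_indic// (setIidl AOm).
    by move=> x _ /=; rewrite ger0_norm// indicE.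
  exact: integrable_EFinZ.
move=> x Ox; rewrite indicE; have [xA|xA] := pselect (A x).
  rewrite mem_set// mulr1 -real_normK ?num_real// ler_pXn2r ?nnegrE//.
    exact: fM.
  by apply: le_trans (fM x Ox).
by rewrite f0// expr0n memNset// mulr0.
Qed.

Lemma L2_dct (f_ : nat -> E -> R) f G : (forall n, L2 Om (f_ n)) -> L2 Om f ->
  L2 Om G -> (forall x, Om x -> f_ n x @[n --> \oo] --> f x) ->
  (forall n x, Om x -> `|f_ n x - f x| <= G x) ->
  norm2 Om (f_ n - f) @[n --> \oo] --> (0 : R).
Proof.
move=> fL_ fL GL cvf fG.
pose h n x := (f_ n x - f x) ^+ 2.
have mh n : measurable_fun Om (EFin \o h n).
  apply/measurable_EFinP; apply: measurable_funX; apply: measurable_funB; exact: L2_measurable.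
have hG : {ae leb, forall x n, Om x -> (`|(EFin \o h n) x| <= (EFin \o (fun x => (G x ^+ 2)%R)) x)%E}.
  apply: aeW => x n Ox /=; rewrite lee_fin ger0_norm ?sqr_ge0// /h.
  rewrite -real_normK ?num_real// ler_pXn2r ?nnegrE//; first exact: fG.
  exact: le_trans (fG n x Ox).
have ch : {ae leb, forall x, Om x -> (EFin \o h n) x @[n --> \oo] --> (0 : \bar R)%E}.
  apply: aeW => x Ox; apply: cvg_EFin; first by apply: nearW.
  have : (f_ n x - f x) * (f_ n x - f x) @[n --> \oo] --> ((f x - f x) * (f x - f x) : R).
    by apply: cvgM; (apply: cvgB; [exact: cvf|exact: cvg_cst]).
  by rewrite subrr mulr0.
have [_ _ H] := dominated_convergence mOm mh (measurable_cst 0%E) ch (L2_sqr GL) hG.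
have H2 : dot Om (f_ n - f) (f_ n - f) @[n --> \oo] --> (0 : R).
  rewrite integral0 in H; exact: fine_cvg H.
have H3 : Num.sqrt (dot Om (f_ n - f) (f_ n - f)) @[n --> \oo] --> (Num.sqrt 0 : R).
  by apply: continuous_cvg => //; exact: sqrt_continuous.
by move: H3; rewrite sqrtr0.
Qed.

End L2_theory.

(** * Test functions of several variables *)

Section test_functions.
Context {R : realType} {d : nat}.
Local Notation E := 'rV[R]_d.
Local Notation leb := (lebesgue_rV (R := R) d).
Implicit Types (f g phi psi : E -> R) (i : 'I_d) (x : E) (Om : set E).

(** The recursion over [k] is discharged once and for all: smoothness is then proved by exhibiting a
    class of continuous functions closed under [partial]. *)
Lemma Ck_class (S : set (E -> R)) :
  (forall f, S f -> continuous f /\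
    forall i, (forall x, derivable f x (delta_mx 0 i : E)) /\ S (partial i f)) ->
  forall k f, S f -> Ck k f.
Proof.
move=> SP; elim=> [|k IH] f /[dup] Sf /SP[cf df] /=; split => // i.
by have [dfi Si] := df i; split => //; exact: IH.
Qed.

Lemma Ck_continuous f : (forall k, Ck k f) -> continuous f.
Proof. by move=> /(_ 0%N)[]. Qed.

Lemma Ck_derivable f i x : (forall k, Ck k f) -> derivable f x (delta_mx 0 i : E).
Proof. by move=> /(_ 1%N)[_ /(_ i)[]]. Qed.

Lemma Ck_partial f i : (forall k, Ck k f) -> forall k, Ck k (partial i f).
Proof. by move=> cf k; have [_ /(_ i)[]] := cf k.+1. Qed.

Lemma Ck_is_derive f i x : (forall k, Ck k f) ->
  is_derive x (delta_mx 0 i : E) f (partial i f x).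
Proof. by move=> cf; apply: DeriveDef => //; exact: Ck_derivable. Qed.

Lemma partial_lin a f g i : (forall k, Ck k f) -> (forall k, Ck k g) ->
  partial i (a *: f + g) = a *: partial i f + partial i g.
Proof.
move=> cf cg; apply/funext => x; apply: derive_val.
have Df := Ck_is_derive i x cf; have Dg := Ck_is_derive i x cg.
exact: (is_deriveD (is_deriveZ a Df) Dg).
Qed.

Lemma Ck_lin a f g : (forall k, Ck k f) -> (forall k, Ck k g) ->
  forall k, Ck k (a *: f + g).
Proof.
move=> cf cg k.
pose S := [set h | exists f g, [/\ forall k, Ck k f, forall k, Ck k g & h = a *: f + g]].
apply: (@Ck_class S); last by exists f, g.
move=> _ [f' [g' [cf' cg' ->]]]; split.
  move=> x; have c1 := Ck_continuous cf' (x := x); have c2 := Ck_continuous cg' (x := x).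
  have c3 : {for x, continuous (fun y => a * f' y)} by exact: (continuousM (@cst_continuous _ _ a x) c1).
  exact: (continuousD c3 c2).
move=> i; split.
  move=> x; have Df := Ck_is_derive i x cf'; have Dg := Ck_is_derive i x cg'.
  by have [] := is_deriveD (is_deriveZ a Df) Dg.
exists (partial i f'), (partial i g'); split; [exact: Ck_partial|exact: Ck_partial|].
exact: partial_lin.
Qed.

Lemma test_fun_lin Om a phi psi : test_fun Om phi -> test_fun Om psi ->
  test_fun Om (a *: phi + psi).
Proof.
move=> [cf [kf sf]] [cg [kg sg]]; split; first exact: Ck_lin.
have sub : closure [set x | (a *: phi + psi) x != 0] `<=`
    closure [set x | phi x != 0] `|` closure [set x | psi x != 0].
  rewrite -closureU; apply: closure_subset => x /=.
  rewrite -[(a *: phi + psi) x]/(a * phi x + psi x) => h.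
  have [p0|] := eqVneq (phi x) 0; last by left.
  by right; move: h; rewrite p0 mulr0 add0r.
split.
  by apply: (subclosed_compact _ (compactU kf kg) sub); exact: closed_closure.
by move=> x /sub[/sf|/sg].
Qed.

Lemma partial_support Om phi i : test_fun Om phi ->
  [set x | partial i phi x != 0] `<=` closure [set x | phi x != 0].
Proof.
move=> [cphi _] x /= px; apply: contrapT => nx; move/eqP: px; apply.
have : nbhs x (~` closure [set x | phi x != 0]).
  by apply: open_nbhs_nbhs; split => //; exact: closed_openC (@closed_closure _ _).
move=> nb; apply: derive_val.
apply: (@near_eq_is_derive _ _ _ (fun=> 0)).
near=> y; apply/esym/eqP; apply: contrapT => /negP py.
have : ~ closure [set x | phi x != 0] y by near: y.
by apply; exact: subset_closure.
Unshelve. all: by end_near. Qed.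

Lemma test_fun_partial Om phi i : test_fun Om phi -> test_fun Om (partial i phi).
Proof.
move=> tphi; have [cphi [kphi sphi]] := tphi; split; first exact: Ck_partial.
have sub : closure [set x | partial i phi x != 0] `<=` closure [set x | phi x != 0].
  rewrite [X in _ `<=` X](_ : _ = closure (closure [set x | phi x != 0])).
    by apply: closure_subset; exact: partial_support tphi.
  by apply/closure_id; exact: closed_closure.
split; first by apply: (subclosed_compact _ kphi sub); exact: closed_closure.
exact: subset_trans sphi.
Qed.

Lemma test_fun0 Om : test_fun Om 0.
Proof.
have E0 : [set x : E | (0 : E -> R) x != 0] = set0.
  by apply/seteqP; split => x //=; rewrite eqxx.
split; last by rewrite E0 closure0; split => //; exact: compact0.
move=> k; apply: (@Ck_class [set 0]) => // _ ->.
have D (x : E) i : is_derive x (delta_mx 0 i : E) (0 : E -> R) 0 by exact: (is_derive_cst (0 : R)).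
split; first by move=> x; exact: (@cst_continuous _ _ 0).
move=> i; split; first by move=> x; have [] := D x i.
by apply/funext => x; rewrite /partial; have [_ ->] := D x i.
Qed.

Lemma test_fun_sum Om (I : finType) (phi : I -> E -> R) :
  (forall j, test_fun Om (phi j)) -> test_fun Om (\sum_j phi j).
Proof.
move=> tphi; elim/big_ind: _ => //; first exact: test_fun0.
by move=> f g tf tg; rewrite -[f]scale1r; exact: test_fun_lin.
Qed.

Definition lap phi : E -> R := \sum_i partial i (partial i phi).

Lemma test_fun_lap Om phi : test_fun Om phi -> test_fun Om (lap phi).
Proof. by move=> tphi; apply: test_fun_sum => i; do 2 apply: test_fun_partial. Qed.

Definition coord_prod (phi : 'I_d -> R -> R) : E -> R := fun x => \prod_j phi j (x 0 j).

(** Along the [i]-th axis all factors but one are constant, so differentiation replaces one factor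
    by its derivative. Products of smooth functions of one variable therefore form a class to which
    [Ck_class] applies. *)
Lemma coord_prod_is_derive (phi : 'I_d -> R -> R) i x : (forall j, smooth (phi j)) ->
  is_derive x (delta_mx 0 i : E) (coord_prod phi)
    (coord_prod (fun j => if j == i then derive1 (phi j) else phi j) x).
Proof.
move=> sphi.
pose C := \prod_(j | j != i) phi j (x 0 j).
have coordE (h : R) j : (h *: (delta_mx 0 i : E) + x) 0 j = h * (j == i)%:R + x 0 j.
  by rewrite !mxE eqxx /= eq_sym.
have PE (h : R) : coord_prod phi (h *: (delta_mx 0 i : E) + x) = phi i (h + x 0 i) * C.
  rewrite /coord_prod (bigD1 i)//= coordE eqxx mulr1; congr (_ * _).
  by apply: eq_bigr => j /negbTE ji; rewrite coordE ji mulr0 add0r.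
have P0 : coord_prod phi x = phi i (x 0 i) * C by rewrite /coord_prod (bigD1 i).
have DE : coord_prod (fun j => if j == i then derive1 (phi j) else phi j) x =
    derive1 (phi i) (x 0 i) * C.
  rewrite /coord_prod (bigD1 i)//= eqxx; congr (_ * _).
  by apply: eq_bigr => j /negbTE ->.
have cv : h^-1 *: ((coord_prod phi \o shift x) (h *: (delta_mx 0 i : E)) - coord_prod phi x)
    @[h --> (0 : R)^'] --> derive1 (phi i) (x 0 i) * C.
  rewrite (_ : (fun h => _) = fun h => h^-1 *: (phi i (h + x 0 i) - phi i (x 0 i)) * C).
    apply: cvgMr_tmp; have := @smooth_derivable _ _ (x 0 i) (sphi i).
    rewrite derive1E /derive /derivable.
    rewrite (_ : (fun h => h^-1 *: ((phi i \o shift (x 0 i)) (h *: 1) - phi i (x 0 i))) =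
      (fun h => h^-1 *: (phi i (h + x 0 i) - phi i (x 0 i))))//.
    by apply/funext => h /=; rewrite [h *: 1]mulr1.
  apply/funext => h /=; rewrite PE P0 -mulrBl.
  by rewrite [_ *: (_ * C)]mulrA.
apply: DeriveDef; first by apply/cvg_ex; eexists; exact: cv.
by rewrite DE; apply/cvg_lim.
Qed.

Lemma coord_prod_continuous (phi : 'I_d -> R -> R) : (forall j, smooth (phi j)) -> continuous (coord_prod phi).
Proof.
move=> sphi; apply: continuous_big; first exact: mul_continuous.
move=> j _ x; apply: (@continuous_comp _ _ _ (fun x : E => x 0 j) (phi j)).
  exact: coord_continuous.
exact: smooth_continuous.
Qed.

Lemma coord_prod_Ck (phi : 'I_d -> R -> R) : (forall j, smooth (phi j)) -> forall k, Ck k (coord_prod phi).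
Proof.
move=> sphi k.
pose S := [set f | exists2 phi, (forall j, smooth (phi j)) & f = coord_prod phi].
apply: (@Ck_class S); last by exists phi.
move=> _ [{}phi {}sphi ->]; split; first exact: coord_prod_continuous.
move=> i; split.
  by move=> x; have [] := coord_prod_is_derive i x sphi.
exists (fun j => if j == i then derive1 (phi j) else phi j).
  by move=> j; case: ifPn => // _; exact: smooth_derive1.
by apply/funext => x; have [_ <-] := coord_prod_is_derive i x sphi.
Qed.

Implicit Types (a b : 'I_d -> R).

Definition rbox a b : set E := [set x | forall j, x 0 j \in `]a j, b j[].
Definition cbox a b : set E := [set x | forall j, x 0 j \in `[a j, b j]].

Lemma rbox_cbox a b : rbox a b `<=` cbox a b.
Proof. by move=> x xab j; exact: subset_itv_oo_cc (xab j). Qed.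

Lemma cbox_compact a b : compact (cbox a b).
Proof. exact: (rV_compact (fun j => @segment_compact _ (a j) (b j))). Qed.

Lemma cbox_closed a b : closed (cbox a b).
Proof.
rewrite (_ : cbox a b = \bigcap_(j in setT) ((fun x : E => x 0 j) @^-1` `[a j, b j]%classic)).
  apply: closed_bigI => j _; apply: preimage_closed => [x _|]; first exact: coord_continuous.
  exact: interval_closed.
by apply/seteqP; split => x H j; [move=> _; exact: H|exact: H].
Qed.

Lemma cbox_bounded_measure a b : (leb (cbox a b) < +oo)%E.
Proof.
have [ab|/forallPn[j ab]] := boolP [forall j, a j <= b j]; last first.
  rewrite (_ : cbox a b = set0) ?measure0//.
  apply/seteqP; split => x //= /(_ j); rewrite in_itv/= => /andP[ax xb].
  by move: ab; rewrite (le_trans ax xb).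
rewrite (_ : cbox a b = [set v : E | forall i, v 0 i \in `[(\row_j a j) 0 i, (\row_j b j) 0 i]]).
  by rewrite lebesgue_rV_box ?ltry// => i; rewrite !mxE; exact: (forallP ab).
by apply/seteqP; split => x /= H i; have := H i; rewrite !mxE.
Qed.

Definition box_bump a b n : E -> R := coord_prod (fun j => sbump (a j) (b j) n).

Lemma box_bump_eq0 a b n x : ~ rbox a b x -> box_bump a b n x = 0.
Proof.
move=> /existsNP[j /negP]; rewrite in_itv/= => xj.
by rewrite /box_bump /coord_prod (bigD1 j)//= sbump_eq0 ?mul0r.
Qed.

Lemma box_bump_test Om a b n : cbox a b `<=` Om -> test_fun Om (box_bump a b n).
Proof.
move=> abOm; split; first by apply: coord_prod_Ck => j; exact: sbump_smooth.
have sub : closure [set x | box_bump a b n x != 0] `<=` cbox a b.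
  rewrite [X in _ `<=` X](_ : _ = closure (cbox a b)).
    apply: closure_subset => x /= h; apply: rbox_cbox; apply: contrapT => nx.
    by move/eqP: h; apply; exact: box_bump_eq0.
  by apply/closure_id; exact: cbox_closed.
split; last exact: subset_trans abOm.
by apply: (subclosed_compact _ (@cbox_compact a b) sub); exact: closed_closure.
Qed.

Lemma box_bump_ge0 a b n x : 0 <= box_bump a b n x.
Proof. by apply: prodr_ge0 => j _; exact: sbump_ge0. Qed.

Lemma box_bump_le1 a b n x : box_bump a b n x <= 1.
Proof.
apply: (@le_trans _ _ (\prod_(j < d) 1)); last by rewrite big1_eq.
by apply: ler_prod => j _; rewrite sbump_ge0 sbump_le1.
Qed.

Lemma box_bump_cvg a b x : box_bump a b n x @[n --> \oo] --> (\1_(rbox a b) x : R).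
Proof.
have -> : \1_(rbox a b) x = \prod_j \1_(`]a j, b j[%classic) (x 0 j) :> R.
  rewrite indicE; have [xab|] := pselect (rbox a b x).
    by rewrite mem_set// big1// => j _; rewrite indicE mem_set//; exact: xab.
  move=> nx; rewrite memNset//; move/existsNP: nx => [j xj].
  by rewrite (bigD1 j)//= indicE memNset ?mul0r.
by apply: cvg_big; [exact: mul_continuous|move=> j _; exact: sbump_cvg].
Qed.

Lemma rbox_measurable a b : measurable (rbox a b).
Proof.
rewrite (_ : rbox a b = \bigcap_(i in [set: 'I_d])
    ((fun v : E => v 0 i) @^-1` `]a i, b i[%classic)).
  apply: fin_bigcap_measurable => // i _.
  rewrite -[X in measurable X]setTI.
  by apply: continuous_measurable_rV => //; exact: coord_continuous.
by apply/seteqP; split => v vab i; [move=> _; exact: vab|exact: vab].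
Qed.

Lemma cbox_measurable a b : measurable (cbox a b).
Proof.
rewrite (_ : cbox a b = \bigcap_(i in [set: 'I_d])
    ((fun v : E => v 0 i) @^-1` `[a i, b i]%classic)).
  apply: fin_bigcap_measurable => // i _.
  rewrite -[X in measurable X]setTI.
  by apply: continuous_measurable_rV => //; exact: coord_continuous.
by apply/seteqP; split => v vab i; [move=> _; exact: vab|exact: vab].
Qed.

Lemma compact_cbox (A : set E) : compact A -> exists M : R, A `<=` cbox (fun=> - M) (fun=> M).
Proof.
move=> cA; have H (j : 'I_d) : exists M : R, forall x, A x -> `|x 0 j| <= M.
  have : compact ((fun x : E => x 0 j) @` A).
    by apply: continuous_compact => //; apply: continuous_subspaceT; exact: coord_continuous.
  move/compact_bounded => [M [_ HM]]; exists (M + 1) => x Ax.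
  by apply: (HM (M + 1)); [rewrite ltrDl|exists x].
have [M HM] := choice H; exists (\sum_j `|M j|) => x Ax j.
rewrite in_itv/= -ler_norml; apply: le_trans (HM j x Ax) _.
by rewrite (bigD1 j)//= ler_wpDr ?sumr_ge0// ler_norm.
Qed.

End test_functions.

(** * Integration by parts for test functions *)

Section integration_by_parts.
Context {R : realType}.
Local Notation mu := (@lebesgue_measure R).

(** A directional derivative sees only the restriction to a line, so it can be transported between
    spaces when one coordinate is split off. *)
Lemma is_derive_line (U U' : normedModType R) (f : U -> R) (F : U' -> R) x v x' v' df :
  (forall h : R, f (h *: v + x) = F (h *: v' + x')) ->
  is_derive x' v' F df -> is_derive x v f df.
Proof.
move=> fF [dF <-].
have E : (fun h : R => h^-1 *: ((f \o shift x) (h *: v) - f x)) =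
    (fun h : R => h^-1 *: ((F \o shift x') (h *: v') - F x')).
  apply/funext => h /=; rewrite fF; congr (_ *: (_ - _)).
  by have := fF 0; rewrite !scale0r !add0r.
by apply: DeriveDef; rewrite /derivable /derive E.
Qed.

Lemma cons_rV_continuous1 n (w : 'rV[R]_n) : continuous (fun x : R => cons_rV (x, w)).
Proof.
move=> x A [P PA sPA].
have := PA 0 0; rewrite cons_rV0 /= => P0.
have : \forall y \near x, P 0 0 y by exact: P0.
apply: filterS => y Py; apply: sPA => i j; rewrite (ord1 i).
case: (unliftP ord0 j) => [k|] ->; last by rewrite cons_rV0.
rewrite cons_rVS /=; have := PA 0 (lift ord0 k); rewrite cons_rVS /=.
exact: nbhs_singleton.
Qed.

Lemma cons_rV_continuous2 n (x : R) : continuous (fun w : 'rV[R]_n => cons_rV (x, w)).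
Proof.
move=> w A [P PA sPA].
exists (fun _ j => P 0 (lift ord0 j)).
  by move=> i j; have := PA 0 (lift ord0 j); rewrite cons_rVS /= (ord1 i).
move=> v /= vP; apply: sPA => i j; rewrite (ord1 i).
case: (unliftP ord0 j) => [k|] ->; first by rewrite cons_rVS; exact: vP.
rewrite cons_rV0 /=; have := PA 0 0; rewrite cons_rV0 /=.
exact: nbhs_singleton.
Qed.

Lemma scale_delta_rV n (h : R) (j k : 'I_n) :
  (h *: delta_mx 0 j : 'rV[R]_n) 0 k = h * (k == j)%:R.
Proof. by rewrite !mxE eqxx. Qed.

Lemma cons_rV_lift n (h x : R) (w : 'rV[R]_n) j :
  cons_rV (x, h *: delta_mx 0 j + w) = h *: delta_mx 0 (lift ord0 j) + cons_rV (x, w).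
Proof.
apply/rowP => k; rewrite [RHS]mxE scale_delta_rV.
case: (unliftP ord0 k) => [l|] ->.
  by rewrite !cons_rVS /= mxE scale_delta_rV (inj_eq lift_inj).
by rewrite !cons_rV0 /= mulr0 add0r.
Qed.

Lemma cons_rV_0 n (h x : R) (w : 'rV[R]_n) :
  cons_rV (h + x, w) = h *: delta_mx 0 ord0 + cons_rV (x, w).
Proof.
apply/rowP => k; rewrite [RHS]mxE scale_delta_rV.
case: (unliftP ord0 k) => [l|] ->; first by rewrite !cons_rVS /= mulr0 add0r.
by rewrite !cons_rV0 /= mulr1.
Qed.

Lemma continuous_bounded_integrable n (G : 'rV[R]_n -> R) M C : continuous G ->
  (forall x, `|G x| <= C) -> (forall x, ~ cbox (fun=> - M) (fun=> M) x -> G x = 0) ->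
  (lebesgue_rV n).-integrable setT (EFin \o G).
Proof.
move=> cG GC G0; pose A : set 'rV[R]_n := cbox (fun=> - M) (fun=> M).
have mA : measurable A by exact: cbox_measurable.
have i1 : (lebesgue_rV n).-integrable setT (EFin \o (fun x => C * \1_A x)).
  apply: (integrable_EFinZ C measurableT).
  apply/integrableP; split; first by apply/measurable_EFinP; exact: measurable_indic.
  apply: le_lt_trans (@cbox_bounded_measure R n (fun=> - M) (fun=> M)).
  rewrite (eq_integral (fun x => (\1_A x)%:E)); first by rewrite integral_indic// setIT.
  by move=> x _ /=; rewrite ger0_norm// indicE.
apply: (le_integrable measurableT _ _ i1).
  by apply/measurable_EFinP; exact: continuous_measurable_rV.
move=> x _ /=; rewrite lee_fin indicE; have [xA|xA] := pselect (A x).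
  by rewrite mem_set// mulr1 (le_trans (GC x))// ler_norm.
by rewrite memNset// mulr0 normr0 (G0 x xA) normr0.
Qed.

(** Fubini with the first coordinate split off. If [i] is another coordinate, the inner integral
    vanishes by induction; if it is the first one, the inner integral is an increment of [F] between
    two points outside the box. *)
Lemma integral_partial0 n (i : 'I_n) (F G : 'rV[R]_n -> R) (M C : R) :
  (forall x, is_derive x (delta_mx 0 i : 'rV[R]_n) F (G x)) -> continuous G ->
  (forall x, `|G x| <= C) ->
  (forall x, ~ cbox (fun=> - M) (fun=> M) x -> F x = 0 /\ G x = 0) ->
  (\int[lebesgue_rV n]_x (G x)%:E = 0)%E.
Proof.
elim: n i F G => [[]//|n IH] i F G dF cG GC FG0.
have Gi := continuous_bounded_integrable cG GC (fun x nx => (FG0 x nx).2).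
have mcons := @measurable_cons_rV R n.
have mG : measurable_fun setT (EFin \o G).
  by apply/measurable_EFinP; exact: continuous_measurable_rV.
have Gi' : ((lebesgue_measure \x lebesgue_rV n)%E).-integrable setT
    ((EFin \o G) \o @cons_rV R n).
  apply/integrableP; split; first exact: measurableT_comp.
  move/integrableP: Gi => [_]; apply: le_lt_trans.
  rewrite (_ : (\int[lebesgue_rV n.+1]_x `|(EFin \o G) x|)%E =
      (\int[(lebesgue_measure \x lebesgue_rV n)]_p (abse \o (EFin \o G)) (cons_rV p))%E)//.
  apply: (ge0_integral_pushforward mcons (lebesgue_measure \x lebesgue_rV n)%E (D := setT)) => //.
  exact: measurableT_comp.
have -> : (\int[lebesgue_rV n.+1]_x (G x)%:E =
    \int[(lebesgue_measure \x lebesgue_rV n)]_p ((EFin \o G) \o @cons_rV R n) p)%E.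
  exact: (integral_pushforward mcons (D := setT) mG Gi').
case: (unliftP ord0 i) => [j ij|i0].
  rewrite -(integral12_prod_meas1 Gi'); apply: integral0_eq => x _.
  rewrite /fubini_F; apply: (IH j (fun w => F (cons_rV (x, w))) (fun w => G (cons_rV (x, w)))).
  - move=> w; apply: is_derive_line (dF (cons_rV (x, w))) => h.
    by rewrite ij cons_rV_lift.
  - move=> w; apply: continuous_comp; last exact: cG.
    exact: cons_rV_continuous2.
  - by move=> w; exact: GC.
  - move=> w nw; apply: FG0 => H; apply: nw => k.
    by have := H (lift ord0 k); rewrite cons_rVS.
rewrite -(integral21_prod_meas1 Gi'); apply: integral0_eq => w _.
rewrite /fubini_G /=.
(* [M] may be negative; [M'] is positive and exceeds [M], so the endpoints of [[- M', M']] fall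
   outside the box. *)
pose M' := `|M| + 1.
have M0 : - M' < M' by rewrite gtrN// ltr_pwDr.
have MM : M < M' by rewrite /M' (le_lt_trans (ler_norm _))// ltrDl.
have out (x : R) : ~ `[- M', M']%classic x -> ~ cbox (fun=> - M) (fun=> M) (cons_rV (x, w)).
  move=> nx /(_ 0); rewrite cons_rV0 /= in_itv/= => /andP[h1 h2]; apply: nx.
  by rewrite /= in_itv/=; lra.
have cGw : {within `[- M', M'], continuous (fun x => G (cons_rV (x, w)))}.
  apply: continuous_subspaceT => x; apply: continuous_comp; last exact: cG.
  exact: cons_rV_continuous1.
have dFw (x : R) : is_derive x 1 (fun x => F (cons_rV (x, w))) (G (cons_rV (x, w))).
  apply: is_derive_line (dF (cons_rV (x, w))) => h.
  by rewrite i0 [h *: 1]mulr1 cons_rV_0.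
have pFw : primitive (- M') M' (fun x => F (cons_rV (x, w))) (fun x => G (cons_rV (x, w))).
  split; last by move=> x _; exact: dFw.
  by apply: derivable_within_continuous => x _; have [] := dFw x.
pose I : set R := `[- M', M']%classic.
transitivity (\int[mu]_(x in I) (G (cons_rV (x, w)))%:E)%E.
  rewrite [RHS]integral_mkcond; apply: eq_integral => x _; rewrite patchE.
  by case: ifPn => // /negP nx; rewrite (FG0 _ (out x _)).2// => xM; apply: nx; exact/mem_set.
have := primitive_integral (ltW M0) cGw pFw.
rewrite /Rintegral => H.
rewrite -[LHS]fineK ?H; last exact: integrable_fin_num (within_integrable cGw).
have edge (x : R) : M < `|x| -> F (cons_rV (x, w)) = 0.
  move=> Mx; apply: (FG0 _ _).1 => /(_ 0); rewrite cons_rV0 /= in_itv/= -ler_norml.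
  by rewrite leNgt Mx.
rewrite !edge ?subrr// ?normrN ger0_norm//; rewrite /M' addr_ge0//.
Qed.

Lemma test_fun_bounded n (Om : set 'rV[R]_n) phi : test_fun Om phi ->
  exists C, forall x, `|phi x| <= C.
Proof.
move=> [cphi [kphi _]].
have : compact (phi @` closure [set x | phi x != 0]).
  apply: continuous_compact => //; apply: continuous_subspaceT; exact: Ck_continuous.
move/compact_bounded => [C [_ HC]]; exists (`|C| + 1) => x.
have [->|px] := eqVneq (phi x) 0; first by rewrite normr0 addr_ge0.
apply: (HC (`|C| + 1)); first by rewrite (le_lt_trans (ler_norm _))// ltrDl.
by exists x => //; exact: subset_closure.
Qed.

Lemma test_fun_support n (Om : set 'rV[R]_n) phi : test_fun Om phi ->
  exists M : R, closure [set x | phi x != 0] `<=` cbox (fun=> - M) (fun=> M).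
Proof. by move=> [_ [kphi _]]; exact: compact_cbox. Qed.

Lemma test_fun_out n (A : set 'rV[R]_n) (phi : 'rV[R]_n -> R) x : closure [set x | phi x != 0] `<=` A ->
  ~ A x -> phi x = 0.
Proof.
move=> sA nA; apply/eqP; apply: contrapT => /negP px; apply: nA; apply: sA.
exact: subset_closure.
Qed.

Lemma test_fun_L2 n (Om : set 'rV[R]_n) phi : open Om -> test_fun Om phi -> L2 Om phi.
Proof.
move=> oOm tphi; have [C HC] := test_fun_bounded tphi.
have [M HM] := test_fun_support tphi; have [cphi [kphi sphi]] := tphi.
set A := closure [set x | phi x != 0].
have mA : measurable A.
  rewrite -[A]setCK; apply: measurableC; apply: open_measurable_rV.
  by apply: closed_openC; exact: closed_closure.
apply: (L2_bounded oOm (A := A) (M := C)) => //.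
- apply: le_lt_trans (@cbox_bounded_measure R n (fun=> - M) (fun=> M)).
  by apply: le_measure; rewrite ?inE//; exact: cbox_measurable.
- apply: measurable_funTS; apply: continuous_measurable_rV; exact: Ck_continuous.
- by move=> x; exact: test_fun_out.
Qed.

(** The derivative of the compactly supported product [phi psi] has integral zero over the whole
    space, and outside [Om] both terms of that derivative vanish. *)
Lemma test_fun_ibp n (Om : set 'rV[R]_n) phi psi i : open Om ->
  test_fun Om phi -> test_fun Om psi ->
  dot Om phi (partial i psi) = - dot Om (partial i phi) psi.
Proof.
move=> oOm tphi tpsi; have tphi' := test_fun_partial i tphi.
have tpsi' := test_fun_partial i tpsi.
have [cphi _] := tphi; have [cpsi _] := tpsi.
have mOm : measurable Om by exact: open_measurable_rV.
have i1 := L2_mul oOm (test_fun_L2 oOm tphi) (test_fun_L2 oOm tpsi').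
have i2 := L2_mul oOm (test_fun_L2 oOm tphi') (test_fun_L2 oOm tpsi).
apply/eqP; rewrite -addr_eq0 /dot -RintegralD//; apply/eqP.
rewrite /Rintegral integral_mkcond.
pose G x := phi x * partial i psi x + partial i phi x * psi x.
have -> : ((fun x => (phi x * partial i psi x + partial i phi x * psi x)%:E) \_ Om) = EFin \o G.
  apply/funext => x; rewrite patchE /= /G; case: ifPn => // /negP nx.
  have nOm : ~ Om x by move=> Ox; apply: nx; exact/mem_set.
  by rewrite (test_fun_out tphi.2.2 nOm) (test_fun_out tpsi.2.2 nOm) mul0r mulr0 addr0.
have [C1 H1] := test_fun_bounded tphi; have [C2 H2] := test_fun_bounded tpsi'.
have [C3 H3] := test_fun_bounded tphi'; have [C4 H4] := test_fun_bounded tpsi.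
have [M HM] := test_fun_support tphi.
have [M' HM'] := test_fun_support tphi'.
suff -> : (\int[lebesgue_rV n]_x (EFin \o G) x = 0)%E by [].
have le M1 : M1 <= Num.max M M' -> forall x : 'rV[R]_n, cbox (fun=> - M1) (fun=> M1) x ->
    cbox (fun=> - Num.max M M') (fun=> Num.max M M') x.
  move=> h x xM j; have := xM j; rewrite !in_itv/= => /andP[h1 h2].
  by rewrite (le_trans _ h1) ?lerN2// (le_trans h2).
apply: (@integral_partial0 n i (fun x => phi x * psi x) G (Num.max M M') (C1 * C2 + C3 * C4)).
- move=> x; have D1 := Ck_is_derive i x cphi; have D2 := Ck_is_derive i x cpsi.
  by apply: (is_derive_eq (is_deriveM D1 D2)); rewrite /G /GRing.scale/= [psi x * _]mulrC.
- move=> x; exact: (continuousD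
    (continuousM (Ck_continuous cphi (x := x)) (Ck_continuous tpsi'.1 (x := x)))
    (continuousM (Ck_continuous tphi'.1 (x := x)) (Ck_continuous cpsi (x := x)))).
- move=> x; apply: le_trans (ler_normD _ _) _; rewrite !normrM lerD// ler_pM//.
- move=> x nx.
  have p0 : phi x = 0 by apply: (test_fun_out HM) => h; apply: nx; apply: le h; rewrite le_max lexx.
  have p1 : partial i phi x = 0.
    by apply: (test_fun_out HM') => h; apply: nx; apply: le h; rewrite le_max lexx orbT.
  by rewrite /G p0 p1 !mul0r addr0.
Qed.

End integration_by_parts.

(** * Density of the test functions *)

Section density.
Context {R : realType} {d : nat}.
Local Notation E := 'rV[R]_d.
Local Notation leb := (lebesgue_rV (R := R) d).
Context {Om : set E} (oOm : open Om).
Implicit Types (f g h : E -> R) (a b : 'I_d -> R) (A B : set E).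

Let mOm : measurable Om. Proof. exact: open_measurable_rV. Qed.
Let Xb := semi_dot_dot oOm.

Definition approximable f : Prop := L2 Om f /\
  forall e, 0 < e -> exists2 phi, test_fun Om phi & norm2 Om (f - phi) < e.

Lemma approximable_lin (a : R) f g : approximable f -> approximable g ->
  approximable (a *: f + g).
Proof.
move=> [fL Hf] [gL Hg]; split; first exact: L2_lin.
move=> e e0; have [|phi tphi h] := Hf (e / 2 / (`|a| + 1)); first by rewrite !divr_gt0// ltr_pwDr.
have [|psi tpsi h'] := Hg (e / 2); first by rewrite divr_gt0.
exists (a *: phi + psi); first exact: test_fun_lin.
have -> : a *: f + g - (a *: phi + psi) = a *: (f - phi) + (g - psi).
  by rewrite scalerBr opprD addrACA.
have pL := test_fun_L2 oOm tphi; have qL := test_fun_L2 oOm tpsi.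
have d1 := sdXB Xb fL pL; have d2 := sdXB Xb gL qL.
apply: le_lt_trans (sdnormD Xb (sdXZ Xb a d1) d2) _.
rewrite (sdnormZ Xb)// (splitr e) ler_ltD//.
apply: (@le_trans _ _ ((`|a| + 1) * norm2 Om (f - phi))).
  by rewrite ler_wpM2r ?sqrtr_ge0// lerDl.
by rewrite mulrC -ler_pdivlMr ?ltr_pwDr// ltW.
Qed.

Lemma approximable0 : approximable 0.
Proof.
split; first exact: L2_0; move=> e e0; exists 0; first exact: test_fun0.
by rewrite subrr (sdnorm0 Xb : norm2 Om 0 = 0).
Qed.

Lemma approximable_sum n (c : 'I_n -> R) (f : 'I_n -> E -> R) :
  (forall i, approximable (f i)) -> approximable (\sum_i c i *: f i).
Proof.
move=> H; elim/big_ind : _ => [|g h Hg Hh|i _]; first exact: approximable0.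
  by rewrite -[g]scale1r; exact: approximable_lin.
by rewrite -[_ *: _]addr0; apply: approximable_lin => //; exact: approximable0.
Qed.

Lemma approximable_cvg (f_ : nat -> E -> R) f : (forall n, approximable (f_ n)) ->
  L2 Om f -> norm2 Om (f_ n - f) @[n --> \oo] --> (0 : R) -> approximable f.
Proof.
move=> Hn fL H; split => // e e0; have e2 : 0 < e / 2 by rewrite divr_gt0.
have /cvgrPdist_lt/(_ _ e2) := H => -[n _ /(_ n (leqnn n))] /=.
rewrite sub0r normrN ger0_norm ?sqrtr_ge0// => h.
have [fnL /(_ _ e2)[phi tphi h']] := Hn n; exists phi => //.
apply: le_lt_trans (sdnorm_tri Xb fL fnL (test_fun_L2 oOm tphi)) _.
by rewrite (splitr e) ltrD// (sdnormBC Xb fL fnL).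
Qed.

Lemma L2_indic A a b : cbox a b `<=` Om -> measurable A -> A `<=` cbox a b ->
  L2 Om (\1_A : E -> R).
Proof.
move=> abOm mA Aab; apply: (L2_bounded oOm (A := A) (M := 1)) => //.
- exact: subset_trans abOm.
- apply: le_lt_trans (cbox_bounded_measure a b).
  by apply: le_measure; rewrite ?inE//; exact: cbox_measurable.
- by move=> x _; rewrite indicE; case: (x \in A); rewrite ?normr1 ?normr0.
- by move=> x nA; rewrite indicE memNset.
Qed.

Lemma approximable_rbox a b : cbox a b `<=` Om -> approximable (\1_(rbox a b)).
Proof.
move=> abOm; have bL : L2 Om (\1_(rbox a b) : E -> R).
  by apply: L2_indic abOm (@rbox_measurable _ _ a b) _; exact: rbox_cbox.
apply: (@approximable_cvg (box_bump a b)) => //.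
  move=> n; have tb := box_bump_test n abOm; split; first exact: (test_fun_L2 oOm tb).
  by move=> e e0; exists (box_bump a b n) => //; rewrite subrr (sdnorm0 Xb : norm2 Om 0 = 0).
apply: (L2_dct oOm _ bL bL) => //.
- by move=> n; apply: (test_fun_L2 oOm); exact: box_bump_test.
- by move=> x _; exact: box_bump_cvg.
- move=> n x _; rewrite indicE; have [xab|xab] := pselect (rbox a b x).
    rewrite mem_set//= distrC ger0_norm ?subr_ge0 ?box_bump_le1//.
    by rewrite gerBl box_bump_ge0.
  by rewrite memNset//= box_bump_eq0// subrr normr0.
Qed.

Let rboxes : set (set E) := [set A | exists a b, A = rbox a b].

Lemma measurable_rboxes : @measurable _ E = <<s rboxes >>.
Proof.
rewrite measurable_rVE; apply/seteqP; split; last first.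
  apply: smallest_sub => [|_ [a [b ->]]]; first exact: smallest_sigma_algebra.
  exact: (@rbox_measurable _ _ a b).
apply: smallest_sub => [|U oU]; first exact: smallest_sigma_algebra.
rewrite (open_bigcup_box oU) bigcup_mkcond.
apply: (@countable_bigcupT_measurable _ (g_sigma_algebraType rboxes)) => // q.
case: ifPn => _; last exact: measurable0.
by apply: sub_sigma_algebra; exists (fun i => ratr (q i).1), (fun i => ratr (q i).2).
Qed.

Lemma rboxI a b a' b' : rbox a b `&` rbox a' b' =
  rbox (fun j => Num.max (a j) (a' j)) (fun j => Num.min (b j) (b' j)).
Proof.
apply/seteqP; split => [x [h h'] j|x h]; last (split => j).
- have := h j; have := h' j; rewrite !in_itv/= gt_max lt_min => /andP[-> ->] /andP[-> ->].
  by [].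
- by have := h j; rewrite !in_itv/= gt_max lt_min => /andP[/andP[-> _] /andP[]].
- by have := h j; rewrite !in_itv/= gt_max lt_min => /andP[/andP[_ ->] /andP[]].
Qed.

Lemma indic_bigcup_cvg (F : nat -> set E) B x :
  (\1_((\bigcup_(k in `I_n) F k) `&` B) x : R) @[n --> \oo] --> (\1_((\bigcup_k F k) `&` B) x : R).
Proof.
have [[[k _ Fk] Bx]|nx] := pselect (((\bigcup_k F k) `&` B) x).
  apply: cvg_near_cst; exists k.+1 => // n /= kn; rewrite !indicE !mem_set//.
    by split => //; exists k.
  by split => //; exists k.
apply: cvg_near_cst; exists 0%N => // n _; rewrite !indicE !memNset// => -[[k _ Fk] Bx].
by apply: nx; split => //; exists k.
Qed.

Lemma indic_bigcup_recr (F : nat -> set E) B n : trivIset setT F ->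
  \1_((\bigcup_(k in `I_n.+1) F k) `&` B) =
  1 *: \1_((\bigcup_(k in `I_n) F k) `&` B) + \1_(F n `&` B) :> (E -> R).
Proof.
move=> tF; apply/funext => x.
rewrite scale1r -[RHS]/(\1_((\bigcup_(k in `I_n) F k) `&` B) x + \1_(F n `&` B) x) !indicE.
have [[[k /= kn Fk] Bx]|nx] := pselect (((\bigcup_(k in `I_n) F k) `&` B) x).
  rewrite [x \in F n `&` B]memNset; last first.
    move=> [Fn _]; have nk := tF n k Logic.I Logic.I (ex_intro _ x (conj Fn Fk)).
    by rewrite nk ltnn in kn.
  rewrite addr0 !mem_set//; first by split => //; exists k.
  by split => //; exists k => //=; exact: ltnW.
rewrite [in RHS](memNset nx) add0r; congr ((_ : bool)%:R).
apply/idP/idP; rewrite !inE.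
  move=> [[k /= + Fk] Bx]; rewrite ltnS leq_eqVlt => /predU1P[kn|kn]; first by rewrite -kn.
  by exfalso; apply: nx; split => //; exists k.
by move=> [Fn Bx]; split => //; exists n => /=.
Qed.

Lemma approximable_bigcup (F : nat -> set E) B : trivIset setT F ->
  (forall k, approximable (\1_(F k `&` B))) ->
  forall n, approximable (\1_((\bigcup_(k in `I_n) F k) `&` B)).
Proof.
move=> tF HF; elim=> [|n IH].
  rewrite II0 bigcup_set0 set0I indic0; exact: approximable0.
by rewrite indic_bigcup_recr//; exact: approximable_lin.
Qed.

(** Dynkin's pi-lambda argument starting from open boxes, everything being intersected with one box
    whose closure lies in [Om]: complements are differences from that box, and disjoint unions
    follow by dominated convergence. *)
Lemma approximable_indic A a b : cbox a b `<=` Om -> measurable A ->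
  approximable (\1_(A `&` rbox a b)).
Proof.
move=> abOm; have Lab := (approximable_rbox abOm).1.
rewrite measurable_rboxes; move: A.
apply: (dynkin_induction (P := fun A => approximable (\1_(A `&` rbox a b))) measurable_rboxes).
- by move=> _ _ [a1 [b1 ->]] [a2 [b2 ->]]; rewrite rboxI; eexists; eexists.
- by rewrite setTI; exact: approximable_rbox.
- move=> _ [a1 [b1 ->]]; rewrite rboxI; apply: approximable_rbox.
  apply: subset_trans abOm => x h j; have := h j.
  by rewrite !in_itv/= ge_max le_min => /andP[/andP[_ ->] /andP[]].
- move=> S mS aS.
  have -> : \1_(~` S `&` rbox a b) = (-1) *: \1_(S `&` rbox a b) + \1_(rbox a b) :> (E -> R).
    apply/funext => x; rewrite scaleN1r.
    rewrite -[RHS]/(- \1_(S `&` rbox a b) x + \1_(rbox a b) x) !indicE !in_setI in_setC.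
    by case: (x \in S) => /=; rewrite ?oppr0 ?add0r ?addNr//; case: (x \in _) => /=; rewrite ?subrr ?oppr0 ?addr0.
  by apply: approximable_lin => //; exact: approximable_rbox.
- move=> F mF tF HF.
  have mU : measurable (\bigcup_k F k) by exact: bigcupT_measurable.
  apply: (approximable_cvg (approximable_bigcup tF HF)).
    apply: L2_indic abOm (measurableI _ _ mU (@rbox_measurable _ _ a b)) _.
    by move=> x [_ /rbox_cbox].
  apply: (L2_dct oOm _ _ Lab).
  + by move=> n; exact: (approximable_bigcup tF HF n).1.
  + apply: L2_indic abOm (measurableI _ _ mU (@rbox_measurable _ _ a b)) _.
    by move=> x [_ /rbox_cbox].
  + by move=> x _; exact: indic_bigcup_cvg.
  + move=> n x _; rewrite !indicE !in_setI; case: (x \in rbox a b); rewrite ?andbF ?subrr ?normr0// !andbT.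
    case: (x \in \bigcup_(k in `I_n) F k) / boolP => h1; case: (x \in \bigcup_k F k) / boolP => h2;
      by rewrite ?subrr ?subr0 ?sub0r ?normrN ?normr0 ?normr1.
Qed.

Lemma open_rational_cbox x : Om x -> exists q : {ffun 'I_d -> rat * rat},
  cbox (fun i => ratr (q i).1) (fun i => ratr (q i).2) `<=` Om /\ box q x.
Proof.
rewrite [in Om x](open_bigcup_box oOm) => -[q0 q0O q0x].
have P i : exists q : rat * rat, ((ratr (q0 i).1 : R) < ratr q.1 < x 0 i) /\
    (x 0 i < ratr q.2 < (ratr (q0 i).2 : R)).
  have /andP[/rat_in_itvoo[p pe] /rat_in_itvoo[q qe]] := q0x i.
  by exists (p, q); move: pe qe; rewrite !in_itv/= => -> ->.
have [f fP] := choice P; exists [ffun i => f i]; split => [y yf|i].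
  apply: q0O => i; have := yf i; rewrite !ffunE !in_itv/= => /andP[h1 h2].
  have [/andP[l _] /andP[_ r]] := fP i.
  by rewrite (lt_le_trans l h1) (le_lt_trans h2 r).
by rewrite ffunE in_itv/=; have [/andP[_ ->] /andP[-> _]] := fP i.
Qed.

Import HBNNSimple.

(** Simple functions increase to [f], but their level sets may reach the boundary of [Om]. They are
    therefore cut to the first [n] pieces of a countable cover by rational boxes with closure in
    [Om], made disjoint by [seqDU]; the products stay between 0 and [f], which dominates the
    convergence. *)
Lemma approximable_ge0 f : L2 Om f -> (forall x, Om x -> 0 <= f x) -> approximable f.
Proof.
move=> fL f0; have mf := L2_measurable oOm fL.
have mEf : measurable_fun Om (EFin \o f) by exact/measurable_EFinP.
pose g := nnsfun_approx mOm mEf.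
pose F k : set E := if @unpickle {ffun 'I_d -> rat * rat} k is Some q then
  (if `[< cbox (fun i => ratr (q i).1) (fun i => ratr (q i).2) `<=` Om >] then box q else set0)
  else set0.
have mF k : measurable (F k).
  rewrite /F; case: unpickle => [q|]; last exact: measurable0.
  by case: ifP => _; [apply: open_measurable_rV; exact: open_box|exact: measurable0].
have FE : \bigcup_k F k = Om.
  apply/seteqP; split => [x [k _]|x Ox].
    rewrite /F; case: unpickle => [q|//]; case: asboolP => // qO qx.
    by apply: qO => i; exact: subset_itv_oo_cc (qx i).
  have [q [qO qx]] : exists q : {ffun 'I_d -> rat * rat},
      cbox (fun i => ratr (q i).1) (fun i => ratr (q i).2) `<=` Om /\ box q x.
    exact: open_rational_cbox.
  by exists (pickle q) => //; rewrite /F pickleK; case: asboolP.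
have aA A k : measurable A -> approximable (\1_(seqDU F k `&` A)).
  move=> mA; have [[a [b [abO Fab]]]|F0] : (exists a b, cbox a b `<=` Om /\ F k = rbox a b) \/ F k = set0.
    rewrite /F; case: unpickle => [q|]; last by right.
    by case: asboolP => qO; [left; eexists; eexists; split; first exact: qO|right].
    rewrite (_ : _ `&` _ = (seqDU F k `&` A) `&` rbox a b).
      apply: approximable_indic => //; apply: measurableI => //.
      by apply: measurableD => //; exact: bigsetU_measurable.
    by rewrite -Fab; apply/esym/setIidl => x [+ _]; exact: subset_seqDU.
  rewrite (_ : _ `&` _ = set0) ?indic0; first exact: approximable0.
  by apply/seteqP; split => // x [sx _]; have := subset_seqDU sx; rewrite F0.
pose V n := \bigcup_(k in `I_n) seqDU F k.
pose h n : E -> R := fun x => g n x * \1_(V n `&` setT) x.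
have ah n : approximable (h n).
  have [m [c [A [mA gE]]]] : exists m (c : 'I_m -> R) (A : 'I_m -> set E),
      (forall i, measurable (A i)) /\ forall x, g n x = \sum_i c i * \1_(A i) x.
    do 3 eexists; split; last by move=> x; exact: fimfunEord.
    by move=> i; exact: measurable_sfunP.
  have -> : h n = \sum_i c i *: (\1_(V n `&` A i) : E -> R).
    apply/funext => x; rewrite /h gE mulr_suml fct_sumE; apply: eq_bigr => i _.
    rewrite -[RHS]/(_ * _) -mulrA; congr (_ * _).
    by rewrite !indicE !in_setI in_setT andbT -natrM mulnb andbC.
  apply: approximable_sum => i; apply: approximable_bigcup; first exact: trivIset_seqDU.
  by move=> k; exact: aA.
have gf n x : Om x -> g n x <= f x.
  move=> Ox; rewrite -lee_fin nnsfun_approxE.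
  exact: (@le_approx _ _ _ Om (EFin \o f)).
apply: (approximable_cvg ah fL); apply: (L2_dct oOm _ fL fL).
- by move=> n; exact: (ah n).1.
- move=> x Ox; rewrite -[f x]mulr1; apply: cvgM.
    by apply: (@fine_cvg _ _ _ _ (fun n => (g n x)%:E) (f x)); exact: (cvg_nnsfun_approx mOm mEf).
  rewrite -(_ : \1_((\bigcup_k seqDU F k) `&` setT) x = 1 :> R); first exact: indic_bigcup_cvg.
  by rewrite -seqDU_bigcup_eq FE indicE setIT mem_set.
- move=> n x Ox; rewrite distrC ger0_norm /h indicE; case: (_ \in _); rewrite ?mulr1 ?mulr0 ?subr0 ?subr_ge0 ?gf ?f0//.
  by rewrite gerBl.
Qed.

Lemma L2_approximable f : L2 Om f -> approximable f.
Proof.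
move=> fL; have mf := L2_measurable oOm fL.
pose fp x := Num.max (f x) 0; pose fn x := Num.max (- f x) 0.
have pL : L2 Om fp.
  apply: (L2_le oOm _ (L2_sqr oOm fL)); first by apply: measurable_maxr.
  by move=> x _; rewrite /fp; case: (leP (f x) 0) => // _; rewrite expr0n sqr_ge0.
have nL : L2 Om fn.
  apply: (L2_le oOm _ (L2_sqr oOm fL)).
    by apply: measurable_maxr => //; exact: measurableT_comp.
  by move=> x _; rewrite /fn; case: (leP (- f x) 0) => // _; rewrite ?sqrrN// expr0n sqr_ge0.
have -> : f = (-1) *: fn + fp.
  apply/funext => x; rewrite scaleN1r -[RHS]/(- fn x + fp x) /fn /fp.
  by have := lexx (f x); case: (leP (f x) 0) => h1; case: (leP (- f x) 0) => h2 _; lra.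
by apply: approximable_lin; apply: approximable_ge0 => // x _; rewrite le_max lexx orbT.
Qed.

End density.

(** * The Dirichlet form *)

Section duality.
Context {R : realType} {V : lmodType R}.
Context {X D : set V} {b : V -> V -> R} (Xb : semi_dot X b).
Hypothesis DX : D `<=` X.
Hypothesis D0 : D 0.
Hypothesis DZ : forall a psi, D psi -> D (a *: psi).
Hypothesis dense_D : forall f e, X f -> 0 < e -> exists2 phi, D phi & sdnorm b (f - phi) < e.

Lemma sd_sumr (I : finType) (h : I -> V) f : X f -> (forall i, X (h i)) ->
  b f (\sum_i h i) = \sum_i b f (h i).
Proof.
move=> Xf Xh; suff [] : X (\sum_i h i) /\ b f (\sum_i h i) = \sum_i b f (h i) by [].
elim/big_ind2 : _ => [|f1 c1 f2 c2 [X1 E1] [X2 E2]|i _]; last by [].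
  by split; [exact: (sd0 Xb)|exact: (sd0r Xb)].
by split; [exact: (sdXD Xb)|rewrite (sdDr Xb) ?E1 ?E2].
Qed.

(** [psi] is the normalization of an element of [D] close to [f], or 0 when that element has norm
    zero. *)
Lemma dense_dual f e : X f -> 0 < e -> exists psi, [/\ D psi,
  sdnorm b f <= b f psi + e & forall h, X h -> `|b h psi| <= sdnorm b h].
Proof.
move=> Xf e0; have e2 : 0 < e / 2 by rewrite divr_gt0.
have [phi Dphi hphi] := dense_D Xf e2; have Xphi := DX Dphi.
have Xd := sdXB Xb Xf Xphi.
have fphi : sdnorm b f <= sdnorm b phi + e / 2.
  by rewrite -lerBlDl; apply: le_trans (ltW hphi); exact: le_trans (ler_norm _) (sdnorm_dist Xb Xf Xphi).
have [n0|n0] := eqVneq (sdnorm b phi) 0.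
  exists 0; split => // [|h Xh].
    by rewrite (sd0r Xb)// add0r (le_trans fphi)// n0 add0r ler_pdivrMr// ler_peMr ?ler1n// ltW.
  by rewrite (sd0r Xb)// normr0 sdnorm_ge0.
have np : 0 < sdnorm b phi by rewrite lt_def n0 sdnorm_ge0.
have Dpsi := DZ (sdnorm b phi)^-1 Dphi; set psi := _ *: phi in Dpsi.
have n1 : sdnorm b psi = 1 by rewrite (sdnormZ Xb)// normfV gtr0_norm// mulVf.
have CS h : X h -> `|b h psi| <= sdnorm b h.
  by move=> Xh; have := sd_CS Xb Xh (DX Dpsi); rewrite n1 mulr1.
exists psi; split => //; apply: le_trans fphi _.
have -> : b f psi = sdnorm b phi + b (f - phi) psi.
  rewrite (sdBl Xb Xf Xphi (DX Dpsi)) addrC -[LHS](subrK (b phi psi)); congr (_ + _).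
  by rewrite (sdZr Xb)// -(sdnorm_sqr Xb)// expr2 mulKf.
have := le_trans (CS _ Xd) (ltW hphi); rewrite ler_norml => /andP[h _]; lra.
Qed.

Lemma dense_sep f : X f -> (forall psi, D psi -> b f psi = 0) -> forall h, X h -> b f h = 0.
Proof.
move=> Xf H h Xh; have n0 : sdnorm b f = 0.
  apply/eqP; rewrite eq_le sdnorm_ge0 andbT; apply/ler_addgt0Pl => e e0.
  by have [psi [Dpsi + _]] := dense_dual Xf e0; rewrite H// add0r addr0.
by apply/eqP; rewrite -normr_le0; have := sd_CS Xb Xf Xh; rewrite n0 mul0r.
Qed.

End duality.

Section dirichlet_frame.
Context {R : realType} {d : nat}.
Local Notation E := 'rV[R]_d.
Context {Om : set E} (oOm : open Om).
Implicit Types (f g h phi psi : E -> R) (i : 'I_d).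

Let Xb := semi_dot_dot oOm.

Lemma test_fun_dense f e : L2 Om f -> 0 < e -> exists2 phi, test_fun Om phi & norm2 Om (f - phi) < e.
Proof. by move=> /(L2_approximable oOm)[_ H] /H. Qed.

Lemma test_funZ a phi : test_fun Om phi -> test_fun Om (a *: phi).
Proof. by move=> tp; rewrite -[_ *: _]addr0; apply: test_fun_lin => //; exact: test_fun0. Qed.

Let tL phi : test_fun Om phi -> L2 Om phi := fun tp => test_fun_L2 oOm tp.

Lemma dot_test_eq f g h : L2 Om f -> L2 Om g -> L2 Om h ->
  (forall phi, test_fun Om phi -> dot Om f phi = dot Om g phi) -> dot Om f h = dot Om g h.
Proof.
move=> fL gL hL H; apply/eqP; rewrite -subr_eq0 -(sdBl Xb fL gL hL); apply/eqP.
apply: (dense_sep Xb tL (test_fun0 Om) test_funZ test_fun_dense (sdXB Xb fL gL)) => // phi tphi.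
by rewrite (sdBl Xb fL gL (tL tphi)) H// subrr.
Qed.

Lemma wgradP f i : H1 Om f -> weak_partial Om i f (wgrad Om f i).
Proof. by move=> [_ /(_ i) Hi]; exact: (getPex Hi). Qed.

Lemma wgrad_L2 f i : H1 Om f -> L2 Om (wgrad Om f i).
Proof. by move=> /(@wgradP _ i)[]. Qed.

Lemma weak_partial_lin a f g f' g' i : L2 Om f -> L2 Om g ->
  weak_partial Om i f f' -> weak_partial Om i g g' ->
  weak_partial Om i (a *: f + g) (a *: f' + g').
Proof.
move=> fL gL [f'L Hf] [g'L Hg]; split; first exact: L2_lin.
move=> phi tphi; have pL := tL (test_fun_partial i tphi).
by rewrite (sdL Xb)// (sdL Xb a f'L g'L (tL tphi)) Hf// Hg// mulrN -opprD.
Qed.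

Lemma weak_partial_test phi i : test_fun Om phi -> weak_partial Om i phi (partial i phi).
Proof.
move=> tp; split; first exact: (tL (test_fun_partial i tp)).
by move=> psi tpsi; exact: test_fun_ibp.
Qed.

Lemma H1_lin a f g : H1 Om f -> H1 Om g -> H1 Om (a *: f + g).
Proof.
move=> fH gH; have [fL _] := fH; have [gL _] := gH; split; first exact: L2_lin.
by move=> i; eexists; apply: weak_partial_lin => //; exact: wgradP.
Qed.

Lemma H1_test phi : test_fun Om phi -> H1 Om phi.
Proof.
by move=> tp; split; [exact: tL|move=> i; eexists; exact: weak_partial_test].
Qed.

(** [wgrad] picks a representative with [get], so weak derivatives can be compared only through
    their pairings, which are determined by test functions thanks to density. *)
Lemma wgrad_eq f f' h i : H1 Om f -> weak_partial Om i f f' -> L2 Om h ->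
  dot Om (wgrad Om f i) h = dot Om f' h.
Proof.
move=> fH [f'L Hf'] hL; have [gL Hg] := wgradP i fH; apply: dot_test_eq => // phi tphi.
by apply: oppr_inj; rewrite -Hf'// -Hg.
Qed.

Lemma wgrad_lin a f g h i : H1 Om f -> H1 Om g -> L2 Om h ->
  dot Om (wgrad Om (a *: f + g) i) h = a * dot Om (wgrad Om f i) h + dot Om (wgrad Om g i) h.
Proof.
move=> fH gH hL; have [fL _] := fH; have [gL _] := gH.
rewrite (wgrad_eq (H1_lin a fH gH) (weak_partial_lin a fL gL (wgradP i fH) (wgradP i gH)) hL).
by rewrite (sdL Xb)//; exact: wgrad_L2.
Qed.

Definition gdot f g := dotv Om (wgrad Om f) (wgrad Om g).

Lemma dotv_sum_lin a f g (H : 'I_d -> E -> R) : H1 Om f -> H1 Om g -> (forall i, L2 Om (H i)) ->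
  dotv Om (wgrad Om (a *: f + g)) H = a * dotv Om (wgrad Om f) H + dotv Om (wgrad Om g) H.
Proof.
move=> fH gH HL; rewrite /dotv mulr_sumr -big_split/=.
by apply: eq_bigr => i _; rewrite wgrad_lin.
Qed.

Definition L2v : set ('I_d -> E -> R) := [set F | forall i, L2 Om (F i)].

Lemma semi_dot_dotv : semi_dot L2v (dotv Om).
Proof.
split.
- by move=> i; exact: L2_0.
- by move=> a F G FL GL i; exact: L2_lin.
- by move=> F G FL GL; apply: eq_bigr => i _; exact: (sdC Xb).
- move=> a F G H FL GL HL; rewrite /dotv mulr_sumr -big_split/=.
  by apply: eq_bigr => i _; exact: (sdL Xb).
- by move=> F FL; apply: sumr_ge0 => i _; exact: (sd_ge0 Xb).
Qed.

Lemma semi_dot_gdot : semi_dot (H1 Om) gdot.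
Proof.
have Xv := semi_dot_dotv.
split.
- exact/H1_test/test_fun0.
- exact: H1_lin.
- by move=> f g fH gH; apply: (sdC Xv) => i; exact: wgrad_L2.
- by move=> a f g h fH gH hH; apply: dotv_sum_lin => // i; exact: wgrad_L2.
- by move=> f fH; apply: (sd_ge0 Xv) => i; exact: wgrad_L2.
Qed.

Lemma dot_lap f psi : H1 Om f -> test_fun Om psi -> dot Om f (lap psi) = - gdot f psi.
Proof.
move=> fH tpsi; have [fL _] := fH; rewrite /lap (sd_sumr Xb)//; last first.
  by move=> i; apply: tL; do 2 apply: test_fun_partial.
rewrite /gdot /dotv -sumrN; apply: eq_bigr => i _.
have tp := test_fun_partial i tpsi; have [gL /(_ _ tp) ->] := wgradP i fH.
have wL := wgrad_L2 i (H1_test tpsi).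
by rewrite (sdC Xb gL (tL tp)) (sdC Xb gL wL) (wgrad_eq (H1_test tpsi) (weak_partial_test i tpsi) gL).
Qed.

Lemma test_vector_dense (F : 'I_d -> E -> R) e : L2v F -> 0 < e ->
  exists2 Phi : 'I_d -> E -> R, (forall i, test_fun Om (Phi i)) & sdnorm (dotv Om) (F - Phi) < e.
Proof.
move=> FL e0.
have e1 : 0 < e / (d%:R + 1) by rewrite divr_gt0// ltr_wpDl.
have H i : exists phi, test_fun Om phi /\ norm2 Om (F i - phi) < e / (d%:R + 1).
  by have [phi tp h] := test_fun_dense (FL i) e1; exists phi.
have [Phi HPhi] := choice H; exists Phi => [i|]; first by have [] := HPhi i.
rewrite /sdnorm -[ltRHS]gtr0_norm// -[ltRHS]sqrtr_sqr ltr_sqrt; last by rewrite exprn_gt0.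
apply: (@le_lt_trans _ _ (\sum_(i < d) (e / (d%:R + 1)) ^+ 2)).
  apply: ler_sum => i _; have [tp h] := HPhi i.
  have dL := sdXB Xb (FL i) (tL tp).
  rewrite -[leLHS](sdnorm_sqr Xb dL) ler_sqr ?nnegrE ?sdnorm_ge0//; exact: ltW.
rewrite sumr_const card_ord -[X in X < _]mulr_natl expr_div_n mulrA ltr_pdivrMr; last by rewrite exprn_gt0// ltr_wpDl.
rewrite mulrC ltr_pM2l ?exprn_gt0// sqrrD1.
have := ler0n R d; have := sqr_ge0 (d%:R : R); lra.
Qed.

Lemma dirichlet_frame : energy_frame (L2 Om) (H1 Om) (test_fun Om) (dot Om) gdot lap.
Proof.
apply: EnergyFrame.
- exact: Xb.
- exact: semi_dot_gdot.
- by move=> f [].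
- exact: H1_test.
- by move=> a psi phi; exact: test_fun_lin.
- by move=> psi /test_fun_lap /tL.
- exact: dot_lap.
- move=> f e; exact: (dense_dual Xb tL (test_fun0 Om) test_funZ test_fun_dense).
- move=> f e fH e0.
  have FL : L2v (wgrad Om f) by move=> i; exact: wgrad_L2.
  have [Phi [tPhi h1 h2]] := dense_dual semi_dot_dotv
    (D := [set Phi | forall i, test_fun Om (Phi i)]) (fun Phi tP i => tL (tP i))
    (fun=> test_fun0 Om) (fun a Phi tP i => test_funZ a (tP i)) test_vector_dense FL e0.
  (* The dual element is minus the divergence of a field [Phi] of test functions that nearly norms
     the gradient of [f]; integrating by parts, its pairing with [h] is that of [Phi] with the
     gradient of [h]. *)
  have tD i : test_fun Om (- partial i (Phi i)).
    by rewrite -scaleN1r; apply: test_funZ; exact: test_fun_partial.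
  have E h : H1 Om h -> dot Om h (\sum_i - partial i (Phi i)) = dotv Om (wgrad Om h) Phi.
    move=> hH; have [hL _] := hH; rewrite (sd_sumr Xb)// => [|i]; last exact: tL.
    apply: eq_bigr => i _; have [gL Hg] := wgradP i hH.
    rewrite -scaleN1r (sdZr Xb)// ?Hg ?mulN1r ?opprK//.
    by apply: tL; exact: test_fun_partial.
  exists (\sum_i - partial i (Phi i)); split.
  + exact: test_fun_sum.
  + by rewrite E.
  + by move=> h hH; rewrite E//; apply: h2 => i; exact: wgrad_L2.
Qed.

Lemma normH1E : normH1 Om = sdnorm (hdot (dot Om) gdot).
Proof.
have dot_ge0 f : 0 <= dot Om f f by apply: Rintegral_ge0 => x _; rewrite -expr2 sqr_ge0.
apply/funext => f; rewrite /normH1 sqr_sqrtr// sqr_sqrtr//.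
by apply: sumr_ge0 => i _; exact: dot_ge0.
Qed.

Lemma H10E : H10 Om = energy0 (H1 Om) (test_fun Om) (dot Om) gdot.
Proof. by rewrite /H10 normH1E. Qed.

(** The gradient of [f - g] and the difference of the gradients may be distinct representatives;
    they have the same pairings, and this is used once in each argument of the form. *)
Lemma normv2_wgradB f g : H1 Om f -> H1 Om g ->
  normv2 Om (wgrad Om f - wgrad Om g) = sdnorm gdot (f - g).
Proof.
move=> fH gH; have Xv := semi_dot_dotv.
have fL : L2v (wgrad Om f) by move=> i; exact: wgrad_L2.
have gL : L2v (wgrad Om g) by move=> i; exact: wgrad_L2.
have dH : H1 Om (f - g) by exact: (sdXB semi_dot_gdot).
have dL : L2v (wgrad Om (f - g)) by move=> i; exact: wgrad_L2.
have fgL := sdXB Xv fL gL.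
have lin H : L2v H -> dotv Om (wgrad Om (f - g)) H = dotv Om (wgrad Om f - wgrad Om g) H.
  move=> HL; rewrite (sdBl Xv)// addrC -scaleN1r dotv_sum_lin// mulN1r addrC //.
congr Num.sqrt; rewrite -lin// /gdot (sdC Xv)// lin//.
Qed.

End dirichlet_frame.

Arguments gdot {R d} Om f g.

(** * Exponential weights in time *)

Section primitive_exponential.
Context {R : realType}.
Implicit Types (F G f g A : R -> R) (T c : R).

Lemma primitive_congr T F G f g : (forall t, t \in `[0, T] -> F t = G t) ->
  (forall t, t \in `]0, T[ -> f t = g t) -> primitive 0 T F f -> primitive 0 T G g.
Proof.
move=> FG fg [cF dF]; split; first exact: within_eq cF.
move=> t tT; rewrite -fg//; apply: near_eq_is_derive (dF t tT).
have [r r0 rP] := itv_ball tT; apply/nbhs_ballP; exists r => // s.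
by rewrite /ball/= distrC => sr; rewrite FG//; exact: rP.
Qed.

Lemma primitive_uniq T F f g : primitive 0 T F f -> primitive 0 T F g ->
  forall t, t \in `]0, T[ -> f t = g t.
Proof. by move=> [_ dF] [_ dG] t tT; have [_ <-] := dF t tT; have [_ <-] := dG t tT. Qed.

Lemma is_derive_expM c T (t : R) : is_derive t 1 (fun s => expR (c * (s - T))) (c * expR (c * (t - T))).
Proof.
have D1 : is_derive t 1 (fun s : R => c * (s - T)) c.
  have D := is_deriveZ c (is_deriveB (is_derive_id t 1) (is_derive_cst T t 1)).
  by apply: (is_derive_eq D); rewrite subr0 /GRing.scale/= mulr1.
have D2 : is_derive (c * (t - T)) 1 expR (expR (c * (t - T))) by exact: is_derive_expR.
have D := @is_derive1_comp _ expR (fun s => c * (s - T)) t _ _ D2 D1.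
by apply: (is_derive_eq D); rewrite mulrC.
Qed.

Lemma within_expM c T : {within `[0, T], continuous (fun s => expR (c * (s - T)))}.
Proof.
apply: continuous_subspaceT => t; apply: differentiable_continuous.
by apply/derivable1_diffP; have [] := is_derive_expM c T t.
Qed.

Lemma primitive_expM c T A f : primitive 0 T A f ->
  primitive 0 T (fun t => expR (c * (t - T)) * A t) (fun t => expR (c * (t - T)) * (f t + c * A t)).
Proof.
move=> [cA dA]; split; first by apply: withinM => //; exact: within_expM.
move=> t /dA D; have D' := is_deriveM (is_derive_expM c T t) D.
by apply: (is_derive_eq D'); rewrite /GRing.scale/=; ring.
Qed.

End primitive_exponential.

(** * Equations with a damping parameter *)

Section damped_equation.
Context {R : realType} {V : lmodType R}.
Context {X Y D : set V} {b g : V -> V -> R} {Lap : V -> V}.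
Hypothesis F : energy_frame X Y D b g Lap.
Local Notation nb := (sdnorm b).
Local Notation ng := (sdnorm g).
Local Notation nh := (sdnorm (hdot b g)).
Local Notation H0 := (energy0 Y D b g).
Local Notation mu := (@lebesgue_measure R).
Let Xb := ef_X F.
Let Yg := ef_Y F.
Let YX := ef_YX F.
Let DX : D `<=` X. Proof. by move=> f /(ef_DY F) /YX. Qed.
Implicit Types (z zt : R -> V) (r : V -> R -> R) (c s t T : R).

(** Inside the interval both pairings are the derivative of the same function. Continuity carries
    the equality to the endpoints, where the final estimates are claimed too. *)
Lemma C1_uniq T z zt zt' : 0 < T -> C1pair X D b T z zt -> C1pair X D b T z zt' ->
  forall t f, t \in `[0, T] -> X f -> b (zt t) f = b (zt' t) f.
Proof.
move=> T0 H H' t f tT Xf.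
have c1 := Ctime_dot Xb (C1_zt H) Xf; have c2 := Ctime_dot Xb (C1_zt H') Xf.
have E s : s \in `]0, T[ -> b (zt s) f = b (zt' s) f.
  exact: (primitive_uniq (C1_dot F H Xf) (C1_dot F H' Xf)).
apply/eqP; rewrite -subr_eq0 -normr_le0; apply/ler_addgt0Pl => e e0; rewrite addr0.
have e2 : 0 < e / 2 by rewrite divr_gt0.
have [r1 r10 P1] := (within_eps _ _ _).1 c1 t tT _ e2.
have [r2 r20 P2] := (within_eps _ _ _).1 c2 t tT _ e2.
have [s [sT st1 st2]] : exists s, [/\ s \in `]0, T[, `|s - t| < r1 & `|s - t| < r2].
  have := tT; rewrite in_itv/= => /andP[t0 tT'].
  have m0 : 0 < Num.min (Num.min r1 r2) T by rewrite !lt_min r10 r20.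
  have [mr1 mr2 mT] : [/\ Num.min (Num.min r1 r2) T <= r1, Num.min (Num.min r1 r2) T <= r2 &
      Num.min (Num.min r1 r2) T <= T] by rewrite !ge_min !lexx !orbT.
  move: (Num.min _ T) m0 mr1 mr2 mT => m m0 mr1 mr2 mT.
  have [h|h] := leP t (T / 2).
    by exists (t + m / 3); rewrite in_itv/= [t + _]addrC addrK ger0_norm; [split|]; lra.
  by exists (t - m / 3); rewrite in_itv/= [t - _]addrC addrK normrN ger0_norm; [split|]; lra.
have -> : b (zt t) f - b (zt' t) f = (b (zt' s) f - b (zt' t) f) - (b (zt s) f - b (zt t) f).
  by rewrite (E s sT); ring.
apply: le_trans (ler_normB _ _) _.
have sT' : s \in `[0, T] by exact: subset_itv_oo_cc sT.
by have := P1 s sT' st1; have := P2 s sT' st2; lra.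
Qed.

Lemma C1_exp c T z zt : C1pair X D b T z zt ->
  C1pair X D b T (fun t => expR (c * (t - T)) *: z t) (fun t => expR (c * (t - T)) *: (zt t + c *: z t)).
Proof.
move=> [cz czt wz]; have cc := @within_expM R c T.
have cst : {within `[0, T], continuous (fun=> c)} by move=> t; exact: cvg_cst.
have c0 : Ctime T X nb (fun=> 0) by exact: Ctime0.
have E (w : R -> V) (k : R -> R) :
  (fun t => k t *: w t) = (fun t => k t *: w t + 0) by apply/funext => t; rewrite addr0.
have czz : Ctime T X nb (fun t => zt t + c *: z t).
  by under [X in Ctime _ _ _ X]eq_fun do rewrite addrC; exact: (Ctime_lin Xb cz czt cst).
split; [by rewrite E; exact: (Ctime_lin Xb cz c0 cc)|by rewrite E; exact: (Ctime_lin Xb czz c0 cc)|].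
move=> psi Dpsi; have Xpsi := DX Dpsi.
apply: primitive_congr (primitive_expM c (wz psi Dpsi)) => t tT.
  by rewrite (sdZl Xb)//; exact: (Ctime_in cz tT).
have tT' : t \in `[0, T] by exact: subset_itv_oo_cc tT.
have X1 := Ctime_in cz tT'; have X2 := Ctime_in czt tT'.
by rewrite (sdZl Xb _ (Ctime_in czz tT') Xpsi) (sdDl Xb X2 (sdXZ Xb _ X1) Xpsi) (sdZl Xb).
Qed.

Context (P : V -> V).
Hypothesis PX : forall f, X f -> X (P f).
Hypothesis PL : forall a f f' psi, X f -> X f' -> X psi ->
  b (P (a *: f + f')) psi = a * b (P f) psi + b (P f') psi.

Let PZ a f psi : X f -> X psi -> b (P (a *: f)) psi = a * b (P f) psi.
Proof.
move=> Xf Xpsi; have X0 := sd0 Xb; have P0 := PL 1 X0 X0 Xpsi.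
rewrite scaler0 addr0 in P0.
by rewrite -[_ *: _]addr0 PL//; lra.
Qed.

(* [z = e^(c (t - T)) u] solves this equation when [u_tt + u_t + Lap u + Lap u_t]
   equals [P u + P u_t + e^(- c (t - T)) r]. *)
Definition damped_eqn c T z zt r : Prop := forall psi, D psi ->
  primitive 0 T (fun t => b (zt t) psi)
  (fun t => (2 * c - 1) * b (zt t) psi - (c ^+ 2 - c) * b (z t) psi
    + (c - 1) * b (z t) (Lap psi) - b (zt t) (Lap psi)
    + (1 - c) * b (P (z t)) psi + b (P (zt t)) psi + r psi t).

(** The shift of the parameter absorbs exactly the terms produced by differentiating the weight.
    With [s = - rho] it undoes the weight of the weak formulation, and with [s = L] it introduces
    the one of the energy estimate. *)
Lemma damped_eqn_exp c s T z zt r : C1pair X D b T z zt -> damped_eqn c T z zt r ->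
  damped_eqn (c + s) T (fun t => expR (s * (t - T)) *: z t)
    (fun t => expR (s * (t - T)) *: (zt t + s *: z t)) (fun psi t => expR (s * (t - T)) * r psi t).
Proof.
move=> Hz eqn psi Dpsi; have Xpsi := DX Dpsi; have XL := ef_Lap F Dpsi.
have [cz czt wz] := Hz.
have := primitive_expM s (primitiveD (eqn psi Dpsi) (primitiveZ s (wz psi Dpsi))).
have E t f : t \in `[0, T] -> X f -> b (expR (s * (t - T)) *: (zt t + s *: z t)) f =
    expR (s * (t - T)) * (b (zt t) f + s * b (z t) f).
  move=> tT Xf; have X1 := Ctime_in cz tT; have X2 := Ctime_in czt tT.
  have X3 := sdXZ Xb s X1.
  by rewrite (sdZl Xb _ (sdXD Xb X2 X3) Xf) (sdDl Xb X2 X3 Xf) (sdZl Xb s X1 Xf).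
apply: primitive_congr => t tT; first by rewrite E.
have tT' : t \in `[0, T] by exact: subset_itv_oo_cc tT.
have X1 := Ctime_in cz tT'; have X2 := Ctime_in czt tT'.
rewrite !E// !(sdZl Xb _ X1)//.
rewrite (PZ _ X1 Xpsi) (PZ _ (sdXD Xb X2 (sdXZ Xb s X1)) Xpsi) addrC [in b (P (_ + _)) _]addrC PL//; ring.
Qed.

Lemma damped_eqnB c T z1 zt1 r1 z2 zt2 r2 :
  Ctime T X nb z1 -> Ctime T X nb zt1 -> Ctime T X nb z2 -> Ctime T X nb zt2 ->
  damped_eqn c T z1 zt1 r1 -> damped_eqn c T z2 zt2 r2 ->
  damped_eqn c T (fun t => z1 t - z2 t) (fun t => zt1 t - zt2 t) (fun psi t => r1 psi t - r2 psi t).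
Proof.
move=> c1 ct1 c2 ct2 e1 e2 psi Dpsi; have Xpsi := DX Dpsi; have XL := ef_Lap F Dpsi.
have := primitiveD (e1 psi Dpsi) (primitiveZ (-1) (e2 psi Dpsi)).
have PB f f' : X f -> X f' -> b (P (f - f')) psi = b (P f) psi - b (P f') psi.
  by move=> Xf Xf'; rewrite addrC -scaleN1r PL//; ring.
apply: primitive_congr => t tT.
  by rewrite (sdBl Xb (Ctime_in ct1 tT) (Ctime_in ct2 tT))//; ring.
have tT' : t \in `[0, T] by exact: subset_itv_oo_cc tT.
have X1 := Ctime_in c1 tT'; have Xt1 := Ctime_in ct1 tT'.
have X2 := Ctime_in c2 tT'; have Xt2 := Ctime_in ct2 tT'.
rewrite !PB// (sdBl Xb X1 X2 Xpsi) (sdBl Xb Xt1 Xt2 Xpsi) (sdBl Xb X1 X2 XL) (sdBl Xb Xt1 Xt2 XL).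
ring.
Qed.

End damped_equation.

Arguments damped_eqn {R V} D b Lap P c T z zt r.

(** [c B + k2 / c] is at least twice the geometric mean of [B] and [k2], and the weight [e] lies
    between 0 and 1. *)
Lemma young_pairing {R : realFieldType} (e x k2 B c : R) : 0 <= e <= 1 -> 0 < c -> 0 <= k2 -> 0 <= B ->
  x ^+ 2 <= k2 * B -> - (c * B + k2 / c) <= 2 * (e * x).
Proof.
move=> /andP[e0 e1] c0 k0 B0 h; set y := k2 / c; have kE : k2 = y * c by rewrite /y divfK ?gt_eqF.
have y0 : 0 <= y by rewrite /y divr_ge0// ltW.
have S0 : 0 <= c * B + y by rewrite addr_ge0// mulr_ge0// ltW.
have hx : `|2 * x| <= c * B + y.
  rewrite -(ger0_norm S0) -ler_sqr ?nnegrE// !real_normK ?num_real//.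
  rewrite exprMn; have := sqr_ge0 (c * B - y); rewrite kE in h; nra.
rewrite lerNl (le_trans _ hx)// (le_trans (ler_norm _))// normrN mulrCA normrM ler_piMl//.
by rewrite ger0_norm.
Qed.

Lemma sd_sqrB {R : realType} {V : lmodType R} (X : set V) b (Xb : semi_dot X b) f h :
  X f -> X h -> sdnorm b (f - h) ^+ 2 <= 2 * sdnorm b f ^+ 2 + 2 * sdnorm b h ^+ 2.
Proof.
move=> Xf Xh; have XB := sdXB Xb Xf Xh; have XD := sdXD Xb Xf Xh.
rewrite !(sdnorm_sqr Xb)//; have := sd_ge0 Xb XD.
rewrite (sdBl Xb Xf Xh XB) (sdDl Xb Xf Xh XD) !(sdBr Xb Xf Xh)// !(sdDr Xb Xf Xh)//; lra.
Qed.

(** The gradient of [wt] is [E] times that of [zt - L z]. As the energy bound gives [L G <= 2 E A],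
    the quantity [L^2 G] costs a single factor [L], which integrating the exponential in time
    removes afterwards. *)
Lemma dissipation_pieces {R : realFieldType} (L E E2 A N Z G n B : R) : 2 <= L -> 0 <= E ->
  0 <= N -> 0 <= Z -> 0 <= G -> 0 <= n ->
  N + ((L ^+ 2 - L) * Z + (L - 1) * G) <= E * A -> B <= 2 * n + 2 * (L ^+ 2 * G) ->
  E ^+ 2 <= E2 -> E ^+ 2 * B <= 2 * E2 * n + 4 * A * (L * (E ^+ 2 * E)).
Proof.
move=> L2 E0 N0 Z0 G0 n0 h hB hE; have e0 := sqr_ge0 E.
have h1 : L * G <= 2 * (E * A).
  have Z1 : 0 <= (L ^+ 2 - L) * Z by rewrite mulr_ge0//; nra.
  have G1 : 0 <= (L - 2) * G by rewrite mulr_ge0//; lra.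
  by lra.
apply: le_trans (ler_wpM2l e0 hB) _; rewrite mulrDr; apply: lerD.
  by rewrite mulrCA -mulrA ler_wpM2l// ler_wpM2r.
rewrite [X in X <= _](_ : _ = E ^+ 2 * L * 2 * (L * G)); last by ring.
rewrite [X in _ <= X](_ : _ = E ^+ 2 * L * 2 * (2 * (E * A))); last by ring.
by rewrite ler_wpM2l// !mulr_ge0//; lra.
Qed.

(** * Estimates for the difference after removal of the weight *)

Section weighted_estimates.
Context {R : realType} {V : lmodType R}.
Context {X Y D : set V} {b g : V -> V -> R} {Lap : V -> V}.
Hypothesis F : energy_frame X Y D b g Lap.
Local Notation nb := (sdnorm b).
Local Notation ng := (sdnorm g).
Local Notation nh := (sdnorm (hdot b g)).
Local Notation H0 := (energy0 Y D b g).
Local Notation mu := (@lebesgue_measure R).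
Let Xb := ef_X F.
Let Yg := ef_Y F.
Let YX := ef_YX F.
Let Yh := semi_dot_hdot F.

Context (T L : R) (P : V -> V) (q0 : V -> R -> R) (k2 : R -> R) (w wt : R -> V).
Hypothesis (T0 : 0 < T) (L_ge2 : 2 <= L).
Hypothesis PX : forall f, X f -> X (P f).
Hypothesis PL : forall a f f' psi, X f -> X f' -> X psi ->
  b (P (a *: f + f')) psi = a * b (P f) psi + b (P f') psi.
Hypothesis Pb : forall f, X f -> nb (P f) <= L * nb f.
Hypothesis Hw : C1pair X D b T w wt.
Hypothesis wH0 : forall t, t \in `[0, T] -> H0 (w t).
Hypothesis cw : Ctime T Y nh w.
Hypothesis wtY : {ae mu, forall t, t \in `]0, T[ -> Y (wt t)}.
Hypothesis qc : forall psi, D psi -> {within `[0, T], continuous (q0 psi)}.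
Hypothesis k2i : mu.-integrable `[0, T] (EFin \o k2).
Hypothesis k2ge0 : forall t, 0 <= k2 t.
Hypothesis qk : forall psi, D psi ->
  {ae mu, forall t, t \in `]0, T[ -> q0 psi t ^+ 2 <= k2 t * b psi psi}.
Hypothesis eqn : damped_eqn D b Lap P 0 T w wt q0.

Let z t := expR (L * (t - T)) *: w t.
Let zt t := expR (L * (t - T)) *: (wt t + L *: w t).
Let A := b (wt T + L *: w T) (wt T + L *: w T) +
  ((L ^+ 2 - L) * b (w T) (w T) + (L - 1) * g (w T) (w T)) +
  2 / (L - 1) * \int[mu]_(t in `[0, T]) k2 t.
Let Hz : C1pair X D b T z zt. Proof. exact: (C1_exp F). Qed.

Let wY t : t \in `[0, T] -> Y (w t). Proof. by move=> /wH0[]. Qed.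

Let zH0 t : t \in `[0, T] -> H0 (z t).
Proof.
move=> /wH0 h; rewrite /z -[_ *: _]addr0; apply: (energy0_lin F) => //.
have D0 := ef_DY F; split; first exact: (sd0 Yg).
move=> e e0; have [psi Dpsi _] := h.2 _ e0; exists (0 *: psi + 0 *: psi).
  by rewrite scale0r addr0 -[0](subrr psi) -scaleN1r addrC; exact: (ef_D F).
by rewrite scale0r addr0 subrr (sdnorm0 Yh).
Qed.

Let cz : Ctime T Y nh z.
Proof.
have c0 : Ctime T Y nh (fun=> 0) by exact: Ctime0.
have -> : z = fun t => expR (L * (t - T)) *: w t + 0 by apply/funext => t; rewrite addr0.
apply: (Ctime_lin Yh cw c0 (f := fun t => expR (L * (t - T)))). exact: within_expM.
Qed.

Let exp_le1 t : t \in `]0, T[ -> 0 <= expR (L * (t - T)) <= 1.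
Proof.
have L_ge2' := L_ge2; rewrite in_itv/= => /andP[_ tT]; rewrite expR_ge0/= -expR0 ler_expR.
by rewrite mulr_ge0_le0//; lra.
Qed.

Let ztY : {ae mu, forall t, t \in `]0, T[ -> Y (zt t)}.
Proof.
apply: ae_imp wtY => t h tT; apply: (sdXZ Yg); apply: (sdXD Yg); first exact: h.
by apply: (sdXZ Yg); apply: wY; exact: subset_itv_oo_cc tT.
Qed.

Let qz psi t := expR (L * (t - T)) * q0 psi t.

Let qzc psi : D psi -> {within `[0, T], continuous (qz psi)}.
Proof. by move=> Dpsi; apply: withinM; [exact: within_expM|exact: qc]. Qed.

Let qzk psi c : D psi -> 0 < c ->
  {ae mu, forall t, t \in `]0, T[ -> - (c * b psi psi + k2 t / c) <= 2 * qz psi t}.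
Proof.
move=> Dpsi c0; apply: ae_imp (qk Dpsi) => t h tT.
apply: young_pairing => //; [exact: exp_le1| |exact: h].
by apply: (sd_ge0 Xb); apply: YX; exact: (ef_DY F).
Qed.

Let eqnz psi : D psi -> primitive 0 T (fun t => b (zt t) psi)
  (fun t => (2 * L - 1) * b (zt t) psi - (L ^+ 2 - L) * b (z t) psi
    + (L - 1) * b (z t) (Lap psi) - b (zt t) (Lap psi)
    + (1 - L) * b (P (z t)) psi + b (P (zt t)) psi + qz psi t).
Proof. by move=> Dpsi; have := damped_eqn_exp F PL L Hw eqn Dpsi; rewrite add0r. Qed.

Let expT (f : V) : expR (L * (T - T)) *: f = f.
Proof. by rewrite subrr mulr0 expR0 scale1r. Qed.

Let bound t : t \in `[0, T] ->
  b (zt t) (zt t) + ((L ^+ 2 - L) * b (z t) (z t) + (L - 1) * g (z t) (z t)) <=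
  expR (L * (T - t)) * A.
Proof.
rewrite in_itv/= => tT; have := energy_bound F T0 L_ge2 PX PL Pb Hz zH0 cz qzc k2i k2ge0 qzk eqnz (a := t).
by rewrite /zt /z !expT; exact.
Qed.

Let A0 : 0 <= A.
Proof.
have L_ge2' := L_ge2; have TT : T \in `[0, T] by rewrite in_itv/= lexx ltW.
have X1 := Ctime_in (C1_zt Hw) TT; have Y1 := wY TT; have X2 := YX Y1.
rewrite /A !addr_ge0// ?mulr_ge0//.
- by apply: (sd_ge0 Xb); apply: (sdXD Xb) => //; exact: (sdXZ Xb).
- by nra.
- exact: (sd_ge0 Xb).
- by lra.
- exact: (sd_ge0 Yg).
- by rewrite invr_ge0; lra.
- by apply: ae_ge0_Rintegral; exact: aeW.
Qed.

Let wE t : w t = expR (L * (T - t)) *: z t.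
Proof. by rewrite /z scalerA -expRD -mulrDr subrKA subrr mulr0 expR0 scale1r. Qed.

Let wtE t : wt t = expR (L * (T - t)) *: (zt t - L *: z t).
Proof.
rewrite /zt /z [L *: (_ *: _)]scalerA [L * expR _]mulrC -scalerA -scalerBr addrK scalerA -expRD.
by rewrite -mulrDr subrKA subrr mulr0 expR0 scale1r.
Qed.

Let exp3 t : expR (3 * L * (T - t)) = expR (L * (T - t)) ^+ 2 * expR (L * (T - t)).
Proof. by rewrite -exprSr -expRM_natl; congr expR; ring. Qed.

Let pieces t : t \in `[0, T] -> [/\ 0 <= b (zt t) (zt t), 0 <= b (z t) (z t) & 0 <= g (z t) (z t)].
Proof.
move=> tT; have Xz := Ctime_in (C1_z Hz) tT; have Xzt := Ctime_in (C1_zt Hz) tT.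
by split; [exact: (sd_ge0 Xb)|exact: (sd_ge0 Xb)|apply: (sd_ge0 Yg); case: (zH0 tT)].
Qed.

(** As [L >= 2], [L^2 <= 2 (L^2 - L)], so the energy of [z] controls the norm. Removing the weight
    gives the square of [e^(L (T - t))], and Gronwall supplies the third factor. *)
Lemma weighted_bound_norm t : t \in `[0, T] ->
  L ^+ 2 * nb (w t) ^+ 2 <= 2 * (expR (3 * L * (T - t)) * A).
Proof.
move=> tT; have Xz := Ctime_in (C1_z Hz) tT; have [N0 Z0 G0] := pieces tT.
rewrite wE (sdnormZ Xb)// ger0_norm ?expR_ge0// exprMn (sdnorm_sqr Xb)// exp3.
have := bound tT; set e := expR _; set Z := b (z t) (z t) in Z0 *; set G := g _ _ in G0 *.
set N := b (zt t) _ in N0 * => h; have e0 : 0 <= e ^+ 2 by exact: sqr_ge0.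
rewrite mulrCA -[X in _ <= 2 * X]mulrA [leRHS]mulrCA ler_wpM2l//.
have L_ge2' := L_ge2; have G1 : 0 <= (L - 1) * G by rewrite mulr_ge0//; lra.
by have Z1 : 0 <= (L ^+ 2 - 2 * L) * Z; [rewrite mulr_ge0//; nra|lra].
Qed.

Lemma weighted_bound_grad t : t \in `[0, T] ->
  L * ng (w t) ^+ 2 <= 2 * (expR (3 * L * (T - t)) * A).
Proof.
move=> tT; have Yz : Y (z t) by case: (zH0 tT).
have [N0 Z0 G0] := pieces tT.
rewrite wE (sdnormZ Yg)// ger0_norm ?expR_ge0// exprMn (sdnorm_sqr Yg)// exp3.
have := bound tT; set e := expR _; set Z := b (z t) (z t) in Z0 *; set G := g _ _ in G0 *.
set N := b (zt t) _ in N0 * => h; have e0 : 0 <= e ^+ 2 by exact: sqr_ge0.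
rewrite mulrCA -[X in _ <= 2 * X]mulrA [leRHS]mulrCA ler_wpM2l//.
have L_ge2' := L_ge2; have G1 : 0 <= (L - 2) * G by rewrite mulr_ge0//; lra.
by have Z1 : 0 <= (L ^+ 2 - L) * Z; [rewrite mulr_ge0//; nra|lra].
Qed.

(** Up to the weight [wt] is [zt - L z], and [2 L^2 Z <= 4 (L^2 - L) Z] because [L >= 2]. *)
Lemma weighted_bound_dt t : t \in `[0, T] ->
  nb (wt t) ^+ 2 <= 4 * (expR (3 * L * (T - t)) * A).
Proof.
move=> tT; have Xz := Ctime_in (C1_z Hz) tT; have Xzt := Ctime_in (C1_zt Hz) tT.
have [N0 Z0 G0] := pieces tT; have XL := sdXZ Xb L Xz.
rewrite wtE (sdnormZ Xb); last exact: (sdXB Xb).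
rewrite ger0_norm ?expR_ge0// exprMn exp3.
have := sd_sqrB Xb Xzt XL; rewrite (sdnormZ Xb)// exprMn real_normK ?num_real// (sdnorm_sqr Xb Xz) (sdnorm_sqr Xb Xzt).
move: (nb _ ^+ 2) => B hB.
have := bound tT; set e := expR _; set Z := b (z t) (z t) in Z0 hB *; set G := g _ _ in G0 *.
set N := b (zt t) _ in N0 hB * => h; have e0 : 0 <= e ^+ 2 by exact: sqr_ge0.
rewrite -[X in _ <= 4 * X]mulrA [leRHS]mulrCA ler_wpM2l//.
have L_ge2' := L_ge2; have G1 : 0 <= (L - 1) * G by rewrite mulr_ge0//; lra.
by have Z1 : 0 <= (L ^+ 2 - 2 * L) * Z; [rewrite mulr_ge0//; nra|lra].
Qed.

(** The rate of the exponential divides out the factor [L] in front of it, so integration in time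
    loses no power of [L]. *)
Let expT_primitive : primitive 0 T (fun s => - expR (- (3 * L) * (s - T)) / 3)
  (fun s => L * expR (- (3 * L) * (s - T))).
Proof.
have := primitiveZ (- 3^-1) (primitive_expM (- (3 * L)) (primitive_cst 0 T 1)).
by apply: primitive_congr => s _; field.
Qed.

(** The part in [zt] contributes the coefficient 2, its weight being bounded by the value at [t];
    the part in [L z] contributes [4 / 3] by [expT_primitive]. Their sum is below 4. *)
Lemma weighted_bound_grad_dt t : t \in `[0, T] ->
  (\int[mu]_(s in `[t, T]) (ng (wt s) ^+ 2)%:E <= (4 * (expR (3 * L * (T - t)) * A))%:E)%E.
Proof.
rewrite in_itv/= => /andP[t0 tT]; have A0' := A0.
have E0 : 0 <= expR (3 * L * (T - t)) * A by rewrite mulr_ge0 ?expR_ge0.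
have L_ge2' := L_ge2; have [tT'|Tt] := ltP t T; last first.
  rewrite (@integral_Sset1 _ _ _ T); first by rewrite lee_fin mulr_ge0.
  by move=> s /=; rewrite in_itv/= => /andP[ts sT]; apply/eqP; rewrite eq_le sT (le_trans Tt ts).
apply/lee_addgt0Pr => e e0.
pose E2 := expR (L * (T - t)) ^+ 2.
have E20 : 0 < E2 by rewrite exprn_gt0// expR_gt0.
have E4 : 0 < 2 * E2 by rewrite mulr_gt0.
have := energy_dissipation F T0 L_ge2 PX PL Pb Hz zH0 cz qzc k2i k2ge0 qzk eqnz ztY
  (a := t) (e := e / (2 * E2)).
rewrite t0 tT' divr_gt0// => /(_ isT isT)[f [mf f0 zf If]].
pose k s := 4 * A * (L * expR (- (3 * L) * (s - T))).
have [cP dP] := expT_primitive.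
have ck : {within `[t, T], continuous k}.
  apply: continuous_subspaceT => s; apply: (continuousM (@cst_continuous _ _ (4 * A) s)).
  apply: (continuousM (@cst_continuous _ _ L s)).
  by apply: differentiable_continuous; apply/derivable1_diffP; have [] := is_derive_expM (- (3 * L)) T s.
have Ik : (\int[mu]_(s in `[t, T]) (k s)%:E <= (4 / 3 * (expR (3 * L * (T - t)) * A))%:E)%E.
  have pk : primitive t T (fun s => 4 * A * (- expR (- (3 * L) * (s - T)) / 3)) k.
    exact: primitiveZ (primitive_sub t0 (lexx T) expT_primitive).
  have := primitive_integral tT ck pk; rewrite /Rintegral => Ek.
  rewrite -[X in (X <= _)%E]fineK ?Ek; last first.
    exact: integrable_fin_num (within_integrable ck).
  rewrite lee_fin subrr mulr0 expR0.
  rewrite (_ : - (3 * L) * (t - T) = 3 * L * (T - t)); last by ring.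
  by lra.
have mk : measurable_fun `[t, T] (EFin \o k) by exact: measurable_int (within_integrable ck).
have k0 s : 0 <= k s by rewrite /k !mulr_ge0 ?expR_ge0//; lra.
have E2f0 s : (0 <= (2 * E2)%:E * f s)%E by rewrite mule_ge0// lee_fin ltW.
apply: (@le_trans _ _ (\int[mu]_(s in `[t, T]) ((2 * E2)%:E * f s + (k s)%:E))%E).
  apply: ge0_ae_le_integral.
  - by move=> s _; rewrite lee_fin sqr_ge0.
  - by move=> s _; rewrite adde_ge0// lee_fin.
  have oo := ae_itv_oo t T.
  have zY : {ae mu, forall s, `[t, T]%classic s -> Y (zt s)}.
    apply: ae_imp2 oo ztY => s h1 h2 /h1; rewrite in_itv/= => /andP[h3 h4].
    by apply: h2; rewrite in_itv/= h4 (le_lt_trans t0 h3).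
  apply: ae_imp2 zf zY => s hf hY ts; have {}hf := hf ts; have Yzt := hY ts.
  move: ts; rewrite /= in_itv/= => /andP[ts sT].
  have sT' : s \in `[0, T] by rewrite in_itv/= sT (le_trans t0).
  have Yz : Y (z s) by case: (zH0 sT').
  have [N0 Z0 G0] := pieces sT'; have YL := sdXZ Yg L Yz.
  have Es : expR (L * (T - s)) ^+ 2 <= E2.
    by rewrite ler_pXn2r ?nnegrE ?expR_ge0// ler_expR ler_wpM2l//; lra.
  apply: (@le_trans _ _ ((2 * E2 * ng (zt s) ^+ 2 + k s)%:E)); last first.
    by rewrite EFinD leeD2r// EFinM lee_pmul2l// lte_fin.
  rewrite lee_fin wtE (sdnormZ Yg); last exact: (sdXB Yg).
  rewrite ger0_norm ?expR_ge0// exprMn.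
  have := sd_sqrB Yg Yzt YL; rewrite (sdnormZ Yg)// exprMn real_normK ?num_real//.
  have n0 := sqr_ge0 (ng (zt s)); have b0 := sqr_ge0 (ng (zt s - L *: z s)).
  rewrite (sdnorm_sqr Yg Yz) /k (_ : - (3 * L) * (s - T) = 3 * L * (T - s)) ?exp3; last by ring.
  have := bound sT'; move: (ng (zt s) ^+ 2) n0 (ng _ ^+ 2) b0 => n n0 B b0 hb hB.
  exact: dissipation_pieces L_ge2 _ N0 Z0 G0 n0 hb hB Es.
rewrite ge0_integralD//; last 2 first.
- exact: measurable_funeM.
- by move=> s _; rewrite lee_fin.
rewrite ge0_integralZl_EFin//; last exact: ltW.
apply: (@le_trans _ _ ((2 * E2)%:E * (expR (L * (T - t)) * A + e / (2 * E2))%:E +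
   (4 / 3 * (expR (3 * L * (T - t)) * A))%:E)%E).
  rewrite /zt /z !expT in If.
  by apply: leeD => //; rewrite lee_pmul2l// lte_fin.
rewrite -EFinM -!EFinD lee_fin exp3 -/E2 mulrDr [2 * E2 * (e / _)]mulrC divfK ?gt_eqF//.
by rewrite exp3 -/E2 in E0; lra.
Qed.

End weighted_estimates.

(** A short interval on the side of [t] that has room inside [[0, T]] has positive length and so is
    not negligible. *)
Lemma ae_dense {R : realType} (T : R) (P : R -> Prop) (t r : R) :
  {ae @lebesgue_measure R, forall s, s \in `]0, T[ -> P s} -> 0 < T -> t \in `[0, T] -> 0 < r ->
  exists s, [/\ s \in `]0, T[, `|s - t| < r & P s].
Proof.
move=> aeP T0 tT r0; apply: contrapT => nP.
have [c [d [cd cdT cdr]]] : exists c d : R, [/\ c < d, `]c, d[%classic `<=` `]0, T[%classic &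
    forall s, s \in `]c, d[ -> `|s - t| < r].
  move: tT; rewrite in_itv/= => /andP[t0 tT].
  have m0 : 0 < Num.min r T by rewrite lt_min r0.
  have [mr mT] : Num.min r T <= r /\ Num.min r T <= T by rewrite !ge_min !lexx orbT.
  move: (Num.min _ T) m0 mr mT => m m0 mr mT.
  have [h|h] := leP t (T / 2).
    exists t, (t + m / 3); split; first by lra.
    - by move=> s /=; rewrite !in_itv/= => /andP[]; lra.
    - by move=> s; rewrite in_itv/= => /andP[h1 h2]; rewrite ltr_norml; lra.
  exists (t - m / 3), t; split; first by lra.
  - by move=> s /=; rewrite !in_itv/= => /andP[]; lra.
  - by move=> s; rewrite in_itv/= => /andP[h1 h2]; rewrite ltr_norml; lra.
have ng : (@lebesgue_measure R).-negligible `]c, d[%classic.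
  apply: negligibleS aeP => s /= scd /= h; apply: nP; exists s.
  by have sT := cdT s scd; split => //; [exact: cdr|exact: h].
have := (negligibleP (@lebesgue_measure R) (measurable_itv `]c, d[)).1 ng.
rewrite [X in X = _](lebesgue_measure_itv `]c, d[)/= lte_fin cd => /eqP.
by rewrite -EFinB eqe subr_eq0 gt_eqF.
Qed.

Lemma regularized_algebra {R : realFieldType} (r x a c G G' p p' : R) :
  x + (1 - 2 * r) * a + (r ^+ 2 - r) * c + (r - 1) * G - G' = (1 - r) * p + p' ->
  x = (2 * r - 1) * a - (r ^+ 2 - r) * c + (r - 1) * - G - - G' + (1 - r) * p + p' + 0.
Proof.
move=> /eqP; rewrite -subr_eq0 => /eqP h; apply/eqP; rewrite -subr_eq0; apply/eqP.
by rewrite -[RHS]h; ring.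
Qed.

(** * The two evolution problems *)

Section evolutions.
Context {R : realType} {d : nat} {Om : set 'rV[R]_d} (oOm : open Om) {T : R} (T0 : 0 < T).
Local Notation E := 'rV[R]_d.
Local Notation mu := (@lebesgue_measure R).
Local Notation nh := (sdnorm (hdot (dot Om) (gdot Om))).
Local Notation H0 := (energy0 (H1 Om) (test_fun Om) (dot Om) (gdot Om)).
Implicit Types (v vt : R -> E -> R) (vtt : R -> (E -> R) -> R) (psi : E -> R).
Let F := dirichlet_frame oOm.
Let Xb := semi_dot_dot oOm.
Let Yg := semi_dot_gdot oOm.
Let Yh := semi_dot_hdot F.

Lemma test_fun_H10 psi : test_fun Om psi -> H10 Om psi.
Proof.
move=> tpsi; rewrite H10E; split; first exact: H1_test.
by move=> e e0; exists psi => //; rewrite subrr (sdnorm0 Yh).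
Qed.

Lemma weak_dt_C1pair v vt : Ctime T (L2 Om) (norm2 Om) v -> Ctime T (L2 Om) (norm2 Om) vt ->
  weak_dt Om T (fun t => dot Om (v t)) (fun t => dot Om (vt t)) ->
  C1pair (L2 Om) (test_fun Om) (dot Om) T v vt.
Proof.
move=> cv cvt H; split => // psi tpsi; have pL := test_fun_L2 oOm tpsi.
apply: (du_bois_reymond T0 (Ctime_dot Xb cv pL) (Ctime_dot Xb cvt pL)) => eta teta.
by apply: H => //; exact: test_fun_H10.
Qed.

Lemma Ctime_H1_L2 v : Ctime T (H1 Om) nh v -> Ctime T (L2 Om) (norm2 Om) v.
Proof.
apply: Ctime_sub; [exact: sdnorm_ge0|exact: sdnorm_ge0| | |exact: (nb_le_nh F)].
  by move=> f g; exact: (sdXB Yg).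
by move=> f [].
Qed.

Lemma evolution_C1pair v vt vtt : evolution Om T v vt vtt ->
  C1pair (L2 Om) (test_fun Om) (dot Om) T v vt.
Proof.
move=> [_ _ _ dv _ cv cvt]; apply: weak_dt_C1pair => //.
by apply: Ctime_H1_L2; rewrite -normH1E.
Qed.

(** The definition places [v t] in [H10] only for almost every [t]; such times are dense, [v] is
    continuous in the [H1] norm, and [H10] is closed. *)
Lemma evolution_H10 v vt vtt : evolution Om T v vt vtt ->
  forall t, t \in `[0, T] -> H0 (v t).
Proof.
move=> [[aeH _ _] _ _ _ _ cv _] t tT; rewrite normH1E in cv.
have Yt := Ctime_in cv tT; apply: (energy0_closed F) => // e e0.
have [_ /(_ _ e0)[r r0 rP]] := (CtimeP _ _ _ (sdnorm_ge0 (b := hdot (dot Om) (gdot Om)))).1 cv t tT.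
have [s [sT st Hs]] := ae_dense aeH T0 tT r0; rewrite H10E in Hs; exists (v s) => //.
have sT' : s \in `[0, T] by exact: subset_itv_oo_cc sT.
by rewrite (sdnormBC Yh)//; [exact: rP|exact: Ctime_in cv sT'].
Qed.

(** The equation replaces the functional [vtt t] at [psi] by a continuous function for almost every
    [t], which changes no integral; the du Bois-Reymond lemma then applies. *)
Lemma evolution_primitive v vt vtt psi (f : R -> R) : evolution Om T v vt vtt ->
  test_fun Om psi -> {within `[0, T], continuous f} ->
  {ae mu, forall t, t \in `]0, T[ -> vtt t psi = f t} ->
  primitive 0 T (fun t => dot Om (vt t) psi) f.
Proof.
move=> [_ _ _ _ dvt _ cvt] tpsi cf H; have pL := test_fun_L2 oOm tpsi.
apply: (du_bois_reymond T0 (Ctime_dot Xb cvt pL) cf) => eta teta.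
rewrite (dvt _ _ (test_fun_H10 tpsi) teta); congr (- _); apply: ae_eq_Rintegral.
by apply: ae_imp H => t h tT; rewrite h.
Qed.

Context (P : (E -> R) -> E -> R) (L : R).
Hypothesis PX : forall f, L2 Om f -> L2 Om (P f).
Hypothesis PL : forall a f f' psi, L2 Om f -> L2 Om f' -> L2 Om psi ->
  dot Om (P (a *: f + f')) psi = a * dot Om (P f) psi + dot Om (P f') psi.
Hypothesis Pb : forall f, L2 Om f -> norm2 Om (P f) <= L * norm2 Om f.

Lemma operator_dot_continuous z psi : Ctime T (L2 Om) (norm2 Om) z -> L2 Om psi ->
  {within `[0, T], continuous (fun t => dot Om (P (z t)) psi)}.
Proof.
move=> cz pL; apply: (Ctime_linear (l := fun f => dot Om (P f) psi) (C := L * norm2 Om psi) Xb cz).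
move=> f f' fL fL'; have dL := sdXB Xb fL fL'.
have -> : dot Om (P f) psi - dot Om (P f') psi = dot Om (P (f - f')) psi.
  by rewrite addrC -[in RHS]scaleN1r [in RHS]addrC PL//; ring.
apply: le_trans (sd_CS Xb (PX dL) pL) _; rewrite mulrAC ler_wpM2r ?sdnorm_ge0//.
exact: Pb.
Qed.

Lemma original_primitive f0 f1 u ut psi : original_solution Om T f0 f1 u ut -> test_fun Om psi ->
  primitive 0 T (fun t => dot Om (ut t) psi)
    (fun t => - dot Om (ut t) psi + dot Om (u t) (lap psi) + dot Om (ut t) (lap psi)).
Proof.
move=> [utt [ev eq _ _]] tpsi; have [cu cut _] := evolution_C1pair ev.
have pL := test_fun_L2 oOm tpsi; have lL := test_fun_L2 oOm (test_fun_lap tpsi).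
apply: (evolution_primitive ev tpsi).
  apply: withinD (Ctime_dot Xb cut lL); apply: withinD (Ctime_dot Xb cu lL) => t.
  by apply: cvgN; exact: (Ctime_dot Xb cut pL).
apply: ae_imp2 (eq _ (test_fun_H10 tpsi)) (let: And3 h _ _ := evolution_vt ev in h) => t h hY tT.
have uY : H1 Om (u t) by case: (evolution_H10 ev (subset_itv_oo_cc tT)).
have := h tT; rewrite !(dot_lap oOm)//; last exact: hY.
by rewrite /gdot => /eqP; rewrite -!addrA addr_eq0 => /eqP ->; rewrite !opprD !addrA.
Qed.

(** At parameter 0 the original equation and [damped_eqn] differ by [2 Lap - P] applied to [u] and
    [ut]; in tested form this is the source. *)
Lemma original_damped f0 f1 u ut : original_solution Om T f0 f1 u ut ->
  damped_eqn (test_fun Om) (dot Om) lap P 0 T u ut (fun psi t =>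
    2 * (dot Om (u t) (lap psi) + dot Om (ut t) (lap psi)) -
    (dot Om (P (u t)) psi + dot Om (P (ut t)) psi)).
Proof.
move=> H psi tpsi; apply: primitive_congr (original_primitive H tpsi) => // t _.
by ring.
Qed.

Lemma regularized_damped rho v vt vtt : evolution Om T v vt vtt ->
  (forall phi, H10 Om phi -> {ae mu, forall t, t \in `]0, T[ ->
    vtt t phi + (1 - 2 * rho) * dot Om (vt t) phi + (rho ^+ 2 - rho) * dot Om (v t) phi
    + (rho - 1) * dotv Om (wgrad Om (v t)) (wgrad Om phi)
    - dotv Om (wgrad Om (vt t)) (wgrad Om phi)
    = (1 - rho) * dot Om (P (v t)) phi + dot Om (P (vt t)) phi}) ->
  damped_eqn (test_fun Om) (dot Om) lap P rho T v vt (fun=> fun=> 0).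
Proof.
move=> ev eq psi tpsi; have [cu cut _] := evolution_C1pair ev.
have pL := test_fun_L2 oOm tpsi; have lL := test_fun_L2 oOm (test_fun_lap tpsi).
have wc (c : R) f : {within `[0, T], continuous f} -> {within `[0, T], continuous (fun t => c * f t)}.
  by move=> cf; apply: withinM => // t; exact: cvg_cst.
apply: (evolution_primitive ev tpsi).
  apply: withinD; last by move=> t; exact: cvg_cst.
  apply: withinD (operator_dot_continuous cut pL).
  apply: withinD (wc _ _ (operator_dot_continuous cu pL)).
  apply: withinB (Ctime_dot Xb cut lL).
  apply: withinD (wc _ _ (Ctime_dot Xb cu lL)).
  exact: withinB (wc _ _ (Ctime_dot Xb cut pL)) (wc _ _ (Ctime_dot Xb cu pL)).
apply: ae_imp2 (eq _ (test_fun_H10 tpsi)) (let: And3 h _ _ := evolution_vt ev in h) => t h hY tT.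
have uY : H1 Om (v t) by case: (evolution_H10 ev (subset_itv_oo_cc tT)).
have := h tT; rewrite !(dot_lap oOm)//; last exact: hY.
exact: regularized_algebra.
Qed.

Lemma evolution_dt_H10 v vt vtt : evolution Om T v vt vtt ->
  {ae mu, forall t, t \in `]0, T[ -> H0 (vt t)}.
Proof.
move=> ev; apply: (derivative_energy0_ae F (evolution_C1pair ev)); first exact: evolution_H10 ev.
by rewrite -normH1E; exact: evolution_vt ev.
Qed.

End evolutions.

(** * The source term and its integrable majorant *)

Lemma source_algebra {R : realFieldType} (T S I M : R) : 0 <= T -> 0 <= S -> 0 <= I -> S + I <= M ->
  T * S + I <= (T + 1) * M.
Proof. by move=> T0 S0 I0 h; nra. Qed.

Section source.
Context {R : realType} {d : nat} {Om : set 'rV[R]_d} (oOm : open Om).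
Local Notation E := 'rV[R]_d.
Local Notation mu := (@lebesgue_measure R).
Context {W : set (E -> R)} {nW : (E -> R) -> R} (HW : function_space Om W nW).
Implicit Types (u ut : R -> E -> R) (f g h psi : E -> R).

Lemma fspaceB f g : W f -> W g -> W (f - g).
Proof. by move=> Wf Wg; rewrite addrC -scaleN1r; exact: (fspace_linear HW). Qed.

Lemma fspace_normBC f g : W f -> W g -> nW (f - g) = nW (g - f).
Proof.
move=> Wf Wg; rewrite -[f - g]opprB -scaleN1r (fspace_normZ HW) ?normrN1 ?mul1r//.
exact: fspaceB.
Qed.

Lemma fspace_seminorm : seminorm_on W nW.
Proof.
have D f g : W f -> W g -> W (f + g).
  by move=> Wf Wg; rewrite -[f]scale1r; exact: (fspace_linear HW).
have W0 := fspace_0 HW.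
have n0 : nW 0 = 0 by rewrite -(scale0r (0 : E -> R)) (fspace_normZ HW)// normr0 mul0r.
have tri f g : W f -> W g -> nW f - nW g <= nW (f - g).
  move=> Wf Wg; rewrite lerBlDr -[f in leLHS](subrK g).
  by apply: (fspace_normD HW) => //; exact: fspaceB.
split => //.
- exact: fspaceB.
- move=> f Wf; have := fspace_normD HW Wf (fspaceB W0 Wf).
  by rewrite addrC subrK n0 (fspace_normBC W0 Wf) subr0; lra.
- exact: fspace_normBC.
- move=> f g Wf Wg; rewrite ler_norml tri// andbT lerNl opprB.
  by rewrite (fspace_normBC Wf Wg) tri.
Qed.

(** [sup] is an upper bound only of a bounded set; here continuity provides a maximum. *)
Lemma Ctime_bounded T u : 0 < T -> Ctime T W nW u -> forall t, t \in `[0, T] ->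
  nW (u t) <= sup [set nW (u t) | t in `[0, T]].
Proof.
move=> T0 cu t tT; have sn := fspace_seminorm.
have cn : {within `[0, T], continuous (fun t => nW (u t))}.
  apply/within_itvP => s sT; have [Ws cs] := cu s sT.
  apply/cvgrPdist_lt => e e0; move/cvgrPdist_lt : cs => /(_ e e0).
  have I : \forall r \near within `[0, T] (nbhs s), `[0, T]%classic r by exact: withinT.
  apply: filterS2 I => r rT; rewrite sub0r normrN; apply: le_lt_trans.
  have [Wr _] := cu r rT; rewrite distrC; apply: le_trans (sn_dist sn Wr Ws) _.
  exact: ler_norm.
have [c cT Hc] := EVT_max (ltW T0) cn.
apply: ub_le_sup; last by exists t.
by exists (nW (u c)) => _ [s sT <-]; exact: Hc.
Qed.

(** The square of [nW (ut t)], set to zero off the good times, is measurable, and the supremum of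
    [nW (u t)] is used as a constant. Integrating the latter costs the factor [T], whence
    [T + 1]. *)
Lemma source_majorant T M u ut : 0 < T -> Ctime T W nW u -> L2time T W nW ut ->
  ((sup [set nW (u t) | t in `[0, T]] ^+ 2)%:E
    + \int[mu]_(t in `]0%R, T[) (nW (ut t) ^+ 2)%:E <= M%:E)%E ->
  exists h : R -> R, [/\ mu.-integrable `[0, T] (EFin \o h), forall t, 0 <= h t,
    {ae mu, forall t, t \in `]0, T[ -> W (ut t) /\ nW (u t) ^+ 2 + nW (ut t) ^+ 2 <= h t} &
    \int[mu]_(t in `[0, T]) h t <= (T + 1) * M].
Proof.
move=> T0 cu Lut HM; have sn := fspace_seminorm.
have [G [c Gc]] := L2time_good sn Lut; have mG := gt_measurable Gc.
set S := sup _ in HM *; pose k t := ((fun t => nW (ut t) ^+ 2) \_ G) t.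
have ki : mu.-integrable `[0, T] (EFin \o k).
  exact: integrableS (good_sqr_integrable sn Gc).
have ci : mu.-integrable `[0, T] (EFin \o (cst (S ^+ 2) : R -> R)).
  by apply: within_integrable => t; exact: cvg_cst.
have k0 t : 0 <= k t by rewrite /k patchE; case: ifP => // _; exact: sqr_ge0.
have Ik : ((\int[mu]_(t in `[0, T]) k t)%:E <= \int[mu]_(t in `]0%R, T[) (nW (ut t) ^+ 2)%:E)%E.
  rewrite fineK; last exact: integrable_fin_num.
  have -> : (\int[mu]_(t in `[0%R, T]) (EFin \o k) t = \int[mu]_(t in G) (nW (ut t) ^+ 2)%:E)%E.
    rewrite [RHS]integral_mkcond [LHS]integral_mkcond; apply: eq_integral => t _.
    rewrite !patchE /k /= patchE; case: (boolP (t \in G)) => [tG|_]; last by case: ifP.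
    have : t \in `[0, T] by apply: subset_itv_oo_cc; apply: (gt_sub Gc); exact: set_mem.
    by move=> tT; rewrite mem_set.
  apply: ge0_subset_integral_nm => [t|t]; first exact: (gt_sub Gc).
  by rewrite lee_fin sqr_ge0.
have S2 : S ^+ 2 + \int[mu]_(t in `[0, T]) k t <= M.
  by rewrite -lee_fin EFinD; apply: le_trans HM; rewrite leeD2l.
exists (fun t => S ^+ 2 + k t); split.
- by apply: (integrableD _ ci ki); exact: measurable_itv.
- by move=> t; rewrite addr_ge0 ?sqr_ge0.
- apply: ae_imp (gt_ae Gc) => t h tT; have tG := h tT; split; first exact: (gt_X Gc tG).
  rewrite /k patchE mem_set// lerD2r; have tT' := subset_itv_oo_cc tT.
  have := Ctime_bounded T0 cu tT'; have := sn_ge0 sn (cu t tT').1.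
  by rewrite -/S => h0 h1; rewrite ler_pXn2r ?nnegrE// (le_trans h0).
- rewrite RintegralD//; have -> : \int[mu]_(t in `[0, T]) S ^+ 2 = T * S ^+ 2.
    rewrite Rintegral_cst//; rewrite mulrC; congr (_ * _).
    by rewrite [X in fine X](lebesgue_measure_itv `[0, T])/= lte_fin T0/= oppr0 addr0.
  have I0 : 0 <= \int[mu]_(t in `[0, T]) k t by apply: ae_ge0_Rintegral; exact: aeW.
  exact: (source_algebra (ltW T0) (sqr_ge0 S) I0 S2).
Qed.

Lemma laplacian_defect (P Q : (E -> R) -> E -> R) h psi : twice_laplacian_plus Om W P Q ->
  linear_L2 Om Q -> H10 Om h -> W h -> test_fun Om psi ->
  dot Om (P h) psi - 2 * dot Om h (lap psi) = dot Om (Q h) psi.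
Proof.
move=> HP HQ h0 Wh tpsi; have Xb := semi_dot_dot oOm; have pL := test_fun_L2 oOm tpsi.
have [|g [gL Hg] PE] := HP h h0; first by left.
rewrite (dot_ae _ PE) (sdL Xb)//; last by apply: (linear_L2_stable HQ); exact: (fspace_L2 HW).
by rewrite (Hg _ tpsi); ring.
Qed.

End source.

(** * Independence of representatives *)

Section almost_everywhere_classes.
Context {R : realType} {d : nat} {Om : set 'rV[R]_d}.
Local Notation E := 'rV[R]_d.
Implicit Types (f g : E -> R).

(** [weak_partial] sees [f] only through its pairings with test functions, so [get] chooses from the
    same set for [f] and [g] and returns the same function. *)
Lemma wgrad_congr f g : (forall psi, test_fun Om psi -> dot Om f psi = dot Om g psi) ->
  wgrad Om f = wgrad Om g.
Proof.
move=> H; apply/funext => i; congr get; apply/funext => h; apply/propext.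
by split=> -[hL Hh]; split => // phi tphi; rewrite -Hh// H//; exact: test_fun_partial.
Qed.

Lemma norm2_ae f g : eq_ae Om f g -> norm2 Om f = norm2 Om g.
Proof.
by move=> fg; congr Num.sqrt; apply: ae_eq_Rintegral; apply: ae_imp fg => x /[apply] ->.
Qed.

Lemma normH1_ae f g : eq_ae Om f g -> normH1 Om f = normH1 Om g.
Proof.
move=> fg; rewrite /normH1 (norm2_ae fg) (@wgrad_congr f g)// => psi _.
exact: dot_ae.
Qed.

End almost_everywhere_classes.

(** * Comparison of the two solutions *)

Lemma energy0Z {R : realType} {V : lmodType R} {X Y D : set V} {b g : V -> V -> R} {Lap : V -> V}
    (F : energy_frame X Y D b g Lap) a f : energy0 Y D b g f -> energy0 Y D b g (a *: f).
Proof.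
by move=> h; rewrite -[_ *: f](subrK f) -[X in _ - X]scale1r -scalerBl; exact: (energy0_lin F).
Qed.

(** At [T] the weight is 1 and [zt = wt + L w], of norm at most [L e]. The rest of the energy is at
    most [L^2] times the squared [H1] norm of [w T]; each half contributes [L^2 e^2]. *)
Lemma terminal_algebra {R : realFieldType} (L e N n2 nH n1 b g : R) : 2 <= L ->
  0 <= N -> 0 <= n2 -> 0 <= n1 -> N <= n1 + L * n2 -> n2 <= nH -> nH + n1 <= e ->
  0 <= b -> 0 <= g -> b + g = nH ^+ 2 ->
  N ^+ 2 + ((L ^+ 2 - L) * b + (L - 1) * g) <= 2 * L ^+ 2 * e ^+ 2.
Proof.
move=> L2 N0 n20 n10 hN h2 he b0 g0 hbg.
have L0 : 0 <= L by lra.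
have NLe : N <= L * e.
  apply: le_trans hN _; apply: le_trans (ler_wpM2l L0 he); rewrite mulrDr addrC.
  by rewrite lerD ?ler_wpM2l// ler_peMl//; lra.
have h1 : N ^+ 2 <= L ^+ 2 * e ^+ 2 by rewrite -exprMn ler_pXn2r ?nnegrE// (le_trans N0).
have h3 : b + g <= e ^+ 2 by rewrite hbg ler_pXn2r ?nnegrE//; lra.
have h4 : (L ^+ 2 - L) * b + (L - 1) * g <= L ^+ 2 * (b + g).
  by rewrite mulrDr lerD// ler_wpM2r//; nra.
have h5 : L ^+ 2 * (b + g) <= L ^+ 2 * e ^+ 2 by rewrite ler_wpM2l ?sqr_ge0.
lra.
Qed.

Lemma weight_algebra {R : realFieldType} (L : R) : 2 <= L -> 2 / (L - 1) <= 4 / L.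
Proof.
move=> L2; have L1 : 0 < L - 1 by lra.
have L0 : 0 < L by lra.
by rewrite ler_pdivrMr// mulrAC ler_pdivlMr//; lra.
Qed.

Section comparison.
Context {R : realType} {d : nat} {Om : set 'rV[R]_d} (oOm : open Om) {T : R} (T0 : 0 < T).
Local Notation E := 'rV[R]_d.
Local Notation mu := (@lebesgue_measure R).
Local Notation nh := (sdnorm (hdot (dot Om) (gdot Om))).
Local Notation H0 := (energy0 (H1 Om) (test_fun Om) (dot Om) (gdot Om)).
Let F := dirichlet_frame oOm.
Let Xb := semi_dot_dot oOm.
Let Yg := semi_dot_gdot oOm.
Let Yh := semi_dot_hdot F.
Context (P : (E -> R) -> E -> R) (L : R).
Hypothesis L_ge2 : 2 <= L.
Hypothesis PX : forall f, L2 Om f -> L2 Om (P f).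
Hypothesis PL : forall a f f' psi, L2 Om f -> L2 Om f' -> L2 Om psi ->
  dot Om (P (a *: f + f')) psi = a * dot Om (P f) psi + dot Om (P f') psi.
Hypothesis Pb : forall f, L2 Om f -> norm2 Om (P f) <= L * norm2 Om f.
Context (f0 f1 f0e f1e : E -> R) (u ut ue uet : R -> E -> R) (rho e : R) (k2 : R -> R).
Hypothesis f0H : H1 Om f0.
Hypothesis f1L : L2 Om f1.
Hypothesis f0eH : H1 Om f0e.
Hypothesis f1eL : L2 Om f1e.
Hypothesis fe : normH1 Om (f0e - f0) + norm2 Om (f1e - f1) <= e.
Hypothesis Hu : original_solution Om T f0 f1 u ut.
Hypothesis Hue : regularized_solution Om T P rho f0e f1e ue uet.
Hypothesis k2i : mu.-integrable `[0, T] (EFin \o k2).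
Hypothesis k2ge0 : forall t, 0 <= k2 t.
Hypothesis defect : forall psi, test_fun Om psi -> {ae mu, forall t, t \in `]0, T[ ->
  ((dot Om (P (u t)) psi - 2 * dot Om (u t) (lap psi)) +
   (dot Om (P (ut t)) psi - 2 * dot Om (ut t) (lap psi))) ^+ 2 <= k2 t * dot Om psi psi}.

Lemma comparison t : t \in `[0, T] ->
  let B := expR (3 * L * (T - t)) *
    (2 * L ^+ 2 * e ^+ 2 + 4 / L * \int[mu]_(t in `[0, T]) k2 t) in
  [/\ L ^+ 2 * norm2 Om (ue t - u t) ^+ 2 <= 2 * B,
      L * normv2 Om (wgrad Om (ue t) - wgrad Om (u t)) ^+ 2 <= 2 * B &
      ((norm2 Om (uet t - ut t) ^+ 2)%:E + \int[mu]_(s in `[t, T])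
        (normv2 Om (wgrad Om (uet s) - wgrad Om (ut s)) ^+ 2)%:E <= (8 * B)%:E)%E].
Proof.
move=> tT B.
have L0 : 0 <= L by exact: le_trans L_ge2.
have TT : T \in `[0, T] by rewrite in_itv/= lexx ltW.
have [utt [ev _ u0 ut0]] := Hu.
have [wd cuet [vt [vtt [ev' eq' v0 vt0]]]] := Hue.
set v := (fun t => expR (rho * (t - T)) *: ue t) in ev' eq' v0.
have Cu := evolution_C1pair oOm T0 ev; have Cv := evolution_C1pair oOm T0 ev'.
(* The velocity computed from [v] and [vt] by removing the weight. The given [uet] is only a
   continuous weak derivative; [C1_uniq] identifies the two through their pairings. *)
pose uet' t := expR (- rho * (t - T)) *: (vt t + - rho *: v t).
have ueE : (fun t => expR (- rho * (t - T)) *: v t) = ue.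
  by apply/funext => s; rewrite /v scalerA -expRD mulNr addNr expR0 scale1r.
have Cue : C1pair (L2 Om) (test_fun Om) (dot Om) T ue uet'.
  by have := C1_exp F (- rho) Cv; rewrite ueE.
have Cue' := weak_dt_C1pair oOm T0 (C1_z Cue) cuet wd.
have uetE s f : s \in `[0, T] -> L2 Om f -> dot Om (uet s) f = dot Om (uet' s) f.
  exact: (C1_uniq F T0 Cue' Cue).
have uH s := evolution_H10 oOm T0 ev (t := s).
have vH s := evolution_H10 oOm T0 ev' (t := s).
have ueH s : s \in `[0, T] -> H0 (ue s).
  by move=> /vH h; rewrite -ueE; exact: (energy0Z F).
pose w s := ue s - u s; pose wt s := uet' s - ut s.
have lin (z1 z2 : R -> E -> R) : (fun s => z1 s - z2 s) = fun s => (-1) *: z2 s + z1 s.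
  by apply/funext => s; rewrite scaleN1r addrC.
have Cw : C1pair (L2 Om) (test_fun Om) (dot Om) T w wt.
  by rewrite /w /wt !lin; exact: (C1_lin F).
have wH0 s : s \in `[0, T] -> H0 (w s).
  by move=> sT; rewrite /w addrC -scaleN1r; apply: (energy0_lin F); [exact: uH|exact: ueH].
have cst c : {within `[0, T], continuous (fun=> c : R)} by move=> s; exact: cvg_cst.
have cu : Ctime T (H1 Om) nh u by rewrite -normH1E; exact: evolution_cv ev.
have cue : Ctime T (H1 Om) nh ue.
  have cv : Ctime T (H1 Om) nh v by rewrite -normH1E; exact: evolution_cv ev'.
  have c0 : Ctime T (H1 Om) nh (fun=> 0) by exact: Ctime0.
  rewrite -ueE (_ : (fun s => _) = fun s => expR (- rho * (s - T)) *: v s + 0).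
    by apply: (Ctime_lin Yh cv c0 (f := fun s => expR (- rho * (s - T)))); exact: within_expM.
  by apply/funext => s; rewrite addr0.
have cw : Ctime T (H1 Om) nh w.
  by rewrite /w lin; exact: (Ctime_lin Yh cu cue (cst (-1))).
have aut : {ae mu, forall s, s \in `]0, T[ -> H1 Om (ut s)} by case: (evolution_vt ev).
have avt : {ae mu, forall s, s \in `]0, T[ -> H1 Om (vt s)} by case: (evolution_vt ev').
have auet : {ae mu, forall s, s \in `]0, T[ -> H1 Om (uet' s)}.
  apply: ae_imp avt => s h sT; apply: (sdXZ Yg); apply: (sdXD Yg); first exact: h.
  by apply: (sdXZ Yg); case: (vH s (subset_itv_oo_cc sT)).
have awt : {ae mu, forall s, s \in `]0, T[ -> H1 Om (wt s)}.
  by apply: ae_imp2 aut auet => s h h' sT; apply: (sdXB Yg); [exact: h'|exact: h].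
(* The weight [e^(- rho (t - T))] takes the parameter from [rho] to 0, where the original problem
   can be subtracted. *)
have De : damped_eqn (test_fun Om) (dot Om) lap P 0 T ue uet'
    (fun psi s => expR (- rho * (s - T)) * 0).
  have := damped_eqn_exp F PL (- rho) Cv (regularized_damped oOm T0 PX PL Pb ev' eq').
  by rewrite subrr ueE.
have Du := original_damped oOm T0 P Hu.
have Dw := damped_eqnB F PL (C1_z Cue) (C1_zt Cue) (C1_z Cu) (C1_zt Cu) De Du.
set q0 := (X in damped_eqn _ _ _ _ _ _ _ _ X) in Dw.
have qc psi : test_fun Om psi -> {within `[0, T], continuous (q0 psi)}.
  move=> tpsi; have pL := test_fun_L2 oOm tpsi; have lL := test_fun_L2 oOm (test_fun_lap tpsi).
  have cu2 := C1_z Cu; have cut2 := C1_zt Cu.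
  apply: withinB; first by apply: withinM; [exact: within_expM|exact: cst].
  apply: withinB; last first.
    exact: withinD (operator_dot_continuous oOm PX PL Pb cu2 pL) (operator_dot_continuous oOm PX PL Pb cut2 pL).
  by apply: withinM; [exact: cst|exact: withinD (Ctime_dot Xb cu2 lL) (Ctime_dot Xb cut2 lL)].
have qk psi : test_fun Om psi ->
    {ae mu, forall s, s \in `]0, T[ -> q0 psi s ^+ 2 <= k2 s * dot Om psi psi}.
  move=> tpsi; apply: ae_imp (defect tpsi) => s h sT; apply: le_trans (h sT).
  set a := (X in _ <= X ^+ 2); have -> // : q0 psi s = a by rewrite /q0 /a; ring.
have w2 := weighted_bound_norm F T0 L_ge2 PX PL Pb Cw wH0 cw qc k2i k2ge0 qk Dw tT.
have w3 := weighted_bound_grad F T0 L_ge2 PX PL Pb Cw wH0 cw qc k2i k2ge0 qk Dw tT.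
have w4 := weighted_bound_dt F T0 L_ge2 PX PL Pb Cw wH0 cw qc k2i k2ge0 qk Dw tT.
have w5 := weighted_bound_grad_dt F T0 L_ge2 PX PL Pb Cw wH0 cw awt qc k2i k2ge0 qk Dw tT.
set A := (_ + _ + _ : R) in w2 w3 w4 w5.
(* The terminal energy is measured by the noise, since at [T] the solutions agree almost everywhere
   with their data. *)
have LB : expR (3 * L * (T - t)) * A <= B.
  have I0 : 0 <= \int[mu]_(t in `[0, T]) k2 t by apply: ae_ge0_Rintegral; exact: aeW.
  rewrite ler_wpM2l ?expR_ge0//; apply: lerD; last first.
    by apply: ler_wpM2r => //; exact: weight_algebra.
  have ueT : ue T = v T by rewrite /v subrr mulr0 expR0 scale1r.
  have uetT : uet' T = vt T + - rho *: v T by rewrite /uet' subrr mulr0 expR0 scale1r.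
  have {}v0 : eq_ae Om (v T) f0e by [].
  have wT : eq_ae Om (w T) (f0e - f0).
    apply: ae_imp2 v0 u0 => x h h' Ox; have hv : v T x = f0e x by exact: h.
    by rewrite /w ueT -[LHS]/(v T x - u T x) hv h'.
  have wtT : eq_ae Om (wt T) (f1e - f1).
    have vt1 : eq_ae Om (uet' T) f1e.
      apply: ae_imp2 v0 vt0 => x h h' Ox; have hv : v T x = f0e x by exact: h.
      rewrite uetT -[LHS]/(vt T x + - rho * v T x) hv h'//.
      by rewrite -[(_ + _) x]/(rho * f0e x + f1e x); ring.
    by apply: ae_imp2 vt1 ut0 => x h h' Ox; rewrite /wt -[LHS]/(uet' T x - ut T x) h// h'.
  have wT' : eq_ae Om (wt T + L *: w T) ((f1e - f1) + L *: (f0e - f0)).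
    apply: ae_imp2 wT wtT => x h h' Ox; rewrite -[LHS]/(wt T x + L * w T x) h// h'//.
  have d0H : H1 Om (f0e - f0) by exact: (sdXB Yg).
  have d1L : L2 Om (f1e - f1) by exact: (sdXB Xb).
  have d0L : L2 Om (f0e - f0) by case: d0H.
  have wTH : H1 Om (w T) by case: (wH0 T TT).
  have n0 : normH1 Om (w T) = normH1 Om (f0e - f0) by exact: normH1_ae.
  have n1 : norm2 Om (wt T + L *: w T) <= norm2 Om (f1e - f1) + L * norm2 Om (f0e - f0).
    rewrite (norm2_ae wT'); apply: le_trans (sdnormD Xb d1L (sdXZ Xb L d0L)) _.
    by rewrite (sdnormZ Xb L d0L) (ger0_norm L0); exact: lexx.
  have n2 : norm2 Om (f0e - f0) <= normH1 Om (f0e - f0).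
    by rewrite normH1E; exact: (nb_le_nh F d0H).
  have XT : L2 Om (wt T + L *: w T).
    by apply: (sdXD Xb); [exact: Ctime_in (C1_zt Cw) TT|apply: (sdXZ Xb); case: wTH].
  have e1 := sdnorm_sqr Xb XT; have e2 := sdnorm_sqr Yh wTH.
  rewrite -normH1E n0 in e2; rewrite -e1.
  have b0 := sd_ge0 Xb (wTH.1 : L2 Om (w T)); have g0 := sd_ge0 Yg wTH.
  exact: (terminal_algebra L_ge2 (sdnorm_ge0 _) (sdnorm_ge0 _) (sqrtr_ge0 _) n1 n2 fe b0 g0 (esym e2)).
(* [uet s] and [uet' s] have the same pairings, hence literally the same [wgrad]; for almost every
   [s] the latter is in [H1] and the gradient of the difference can be formed. *)
have ae_w5 : (\int[mu]_(s in `[t, T]) (normv2 Om (wgrad Om (uet s) - wgrad Om (ut s)) ^+ 2)%:E =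
    \int[mu]_(s in `[t, T]) (sdnorm (gdot Om) (wt s) ^+ 2)%:E)%E.
  apply: ge0_ae_eq_integral_nm => [s _|s _|]; rewrite ?lee_fin ?sqr_ge0//.
  apply: ae_imp2 (ae_itv_oo t T) (ae_imp2 (fun s h h' sT => conj (h sT) (h' sT)) aut auet) => s oo h ts.
  have := tT; rewrite in_itv/= => /andP[t0 _].
  have sT : s \in `]0, T[ by have := oo ts; rewrite !in_itv/= => /andP[h1 ->]; rewrite (le_lt_trans t0 h1).
  have [utH uetH] := h sT; rewrite -(normv2_wgradB oOm uetH utH).
  rewrite (@wgrad_congr _ _ Om (uet s) (uet' s))// => psi tpsi.
  by apply: uetE; [exact: subset_itv_oo_cc sT|exact: test_fun_L2].
split.
- by apply: le_trans w2 _; rewrite ler_wpM2l.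
- rewrite (normv2_wgradB oOm (energy0_Y (ueH t tT)) (energy0_Y (uH t tT))).
  by apply: le_trans w3 _; rewrite ler_wpM2l.
- rewrite ae_w5 (_ : norm2 Om (uet t - ut t) = sdnorm (dot Om) (wt t)).
    apply: (@le_trans _ _ ((4 * B)%:E + (4 * B)%:E)%E); last by rewrite -EFinD -mulrDl -natrD.
    apply: leeD; first by rewrite lee_fin; apply: le_trans w4 _; exact: ler_wpM2l.
    by apply: le_trans w5 _; rewrite lee_fin ler_wpM2l.
  have uX := Ctime_in (C1_zt Cu) tT; have uetX := Ctime_in cuet tT.
  have uetX' := Ctime_in (C1_zt Cue) tT.
  have xL := sdXB Xb uetX uX; have yL := sdXB Xb uetX' uX.
  (* Equal pairings with all of L^2 give equal norms, one argument of the form being replaced at a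
     time. *)
  have E1 f : L2 Om f -> dot Om (uet t - ut t) f = dot Om (wt t) f.
    by move=> fL; rewrite /wt (sdBl Xb uetX uX fL) (sdBl Xb uetX' uX fL) uetE.
  by congr Num.sqrt; rewrite (E1 _ xL) (sdC Xb yL xL) (E1 _ yL).
Qed.

End comparison.

(** * Constants and rates *)

Lemma defect_algebra {R : realFieldType} (a a' c x y n h : R) : 0 <= n ->
  `|a| <= c * x * n -> `|a'| <= c * y * n -> x ^+ 2 + y ^+ 2 <= h ->
  (a + a') ^+ 2 <= 2 * c ^+ 2 * h * n ^+ 2.
Proof.
move=> n0 ha ha' hh.
have sq (z w : R) : `|z| <= w -> z ^+ 2 <= w ^+ 2.
  by move=> zw; rewrite -(real_normK (num_real z)) ler_pXn2r ?nnegrE// (le_trans _ zw).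
apply: (@le_trans _ _ (2 * c ^+ 2 * (x ^+ 2 + y ^+ 2) * n ^+ 2)); last first.
  by rewrite ler_wpM2r ?sqr_ge0// ler_wpM2l// mulr_ge0// sqr_ge0.
rewrite [leRHS](_ : _ = 2 * (c * x * n) ^+ 2 + 2 * (c * y * n) ^+ 2); last by ring.
by have := sq _ _ ha; have := sq _ _ ha'; have := sqr_ge0 (a - a'); nra.
Qed.

(** The amplification is [E = G g2] with [g2] the square of [gamma]: [g2] turns one factor [e] of
    the noise into the constant [K], and it cancels the [1 / g2] of the source, so that only the
    rate [G] survives there. *)
Lemma amplification_algebra {R : realFieldType} (L K e E G g2 c I B0 : R) : 0 < L -> 0 < e ->
  0 <= G <= 1 -> 0 < g2 -> E = G * g2 -> g2 * e <= K -> 4 * (c * I) <= B0 ->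
  E * (2 * L ^+ 2 * e ^+ 2 + 4 / L * (c / g2 * I)) <= 2 * L ^+ 2 * K * e + B0 * G / L.
Proof.
move=> L0 e0 /andP[G0 G1] g0 -> h1 h2; rewrite mulrDr; apply: lerD.
  rewrite [leLHS](_ : _ = 2 * L ^+ 2 * e * (G * (g2 * e))); last by ring.
  rewrite [leRHS](_ : _ = 2 * L ^+ 2 * e * (1 * K)); last by ring.
  apply: ler_wpM2l; first by rewrite mulr_ge0 ?(ltW e0)// mulr_ge0// sqr_ge0.
  by apply: ler_pM => //; rewrite mulr_ge0 ?(ltW g0) ?(ltW e0).
rewrite [leLHS](_ : _ = 4 * (c * I) * (G / L)); last by field; rewrite !gt_eqF.
by rewrite -[leRHS]mulrA ler_wpM2r// divr_ge0// ltW.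
Qed.

(** The three estimates come from division by [L^2], [L] and 1, with [L = C1 l]. Each needs two
    constants, one for the noise and one for [G], and [C] dominates the sum of the six. The powers
    of [L] multiplying [G] are adjusted by [2 / L^2 <= 1 / 2] and [8 / L <= 2 L], both consequences
    of [L >= 2]. *)
Lemma rate_algebra {R : realFieldType} (C1 l L K e G B0 B C : R) : 0 < C1 -> L = C1 * l -> 2 <= L ->
  0 <= K -> 0 < e -> 0 <= G -> 0 <= B0 -> B <= 2 * L ^+ 2 * K * e + B0 * G / L ->
  C = 4 * K + B0 / (2 * C1) + 4 * C1 * K + B0 / 2 + 16 * C1 ^+ 2 * K + 2 * B0 * C1 + 1 ->
  [/\ forall X, L ^+ 2 * X <= 2 * B -> X <= C * (e + l^-1 * G),
      forall X, L * X <= 2 * B -> X <= C * (l * e + G) &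
      8 * B <= C * (l ^+ 2 * e + l * G)].
Proof.
move=> C10 LE L2 K0 e0 G0 B00 hB CE; have L0 : 0 < L by lra.
have l0 : 0 < l by rewrite LE pmulr_rgt0 in L0.
have c1 : 0 <= 4 * K by rewrite mulr_ge0.
have c2 : 0 <= B0 / (2 * C1) by rewrite divr_ge0// mulr_ge0// ltW.
have c3 : 0 <= 4 * C1 * K by rewrite !mulr_ge0// ltW.
have c4 : 0 <= B0 / 2 by rewrite divr_ge0.
have c5 : 0 <= 16 * C1 ^+ 2 * K by rewrite mulr_ge0// mulr_ge0// sqr_ge0.
have c6 : 0 <= 2 * B0 * C1 by rewrite !mulr_ge0// ltW.
have C4 : 4 * K <= C /\ B0 / (2 * C1) <= C by lra.
have C5 : 4 * C1 * K <= C /\ B0 / 2 <= C by lra.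
have C6 : 16 * C1 ^+ 2 * K <= C /\ 2 * B0 * C1 <= C by lra.
have BG : 0 <= B0 * G by rewrite mulr_ge0.
have step (c x y : R) : 0 <= x -> c <= C -> y = c * x -> y <= C * x.
  by move=> x0 cC ->; rewrite ler_wpM2r.
split.
- move=> X hX; have {}hX : X <= 2 * (2 * L ^+ 2 * K * e + B0 * G / L) / L ^+ 2.
    by rewrite ler_pdivlMr ?exprn_gt0// mulrC (le_trans hX)// ler_wpM2l.
  apply: le_trans hX _; rewrite [leRHS]mulrDr.
  have -> : 2 * (2 * L ^+ 2 * K * e + B0 * G / L) / L ^+ 2 =
      4 * K * e + B0 * G / L * (2 / L ^+ 2) by field; rewrite gt_eqF.
  apply: lerD; first by rewrite ler_wpM2r ?(ltW e0)//; case: C4.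
  have h : 2 / L ^+ 2 <= 1 / 2 by rewrite ler_pdivrMr ?exprn_gt0//; nra.
  apply: (@le_trans _ _ (B0 * G / L * (1 / 2))); first by rewrite ler_wpM2l// divr_ge0// ltW.
  apply: (step (B0 / (2 * C1))); first by rewrite mulr_ge0// invr_ge0 ltW.
    by case: C4.
  by rewrite LE; field; rewrite !gt_eqF.
- move=> X hX; have {}hX : X <= 2 * (2 * L ^+ 2 * K * e + B0 * G / L) / L.
    by rewrite ler_pdivlMr// mulrC (le_trans hX)// ler_wpM2l.
  apply: le_trans hX _; rewrite [leRHS]mulrDr.
  have -> : 2 * (2 * L ^+ 2 * K * e + B0 * G / L) / L =
      4 * L * K * e + B0 * G * (2 / L ^+ 2) by field; rewrite gt_eqF.
  apply: lerD.
    apply: (step (4 * C1 * K)); first by rewrite mulr_ge0// ltW.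
      by case: C5.
    by rewrite LE; ring.
  have h : 2 / L ^+ 2 <= 1 / 2 by rewrite ler_pdivrMr ?exprn_gt0//; nra.
  apply: (@le_trans _ _ (B0 * G * (1 / 2))); first by rewrite ler_wpM2l.
  by apply: (step (B0 / 2)) => //; [case: C5|field].
- apply: (@le_trans _ _ (8 * (2 * L ^+ 2 * K * e + B0 * G / L))); first by rewrite ler_wpM2l.
  rewrite !mulrDr; apply: lerD.
    apply: (step (16 * C1 ^+ 2 * K)); first by rewrite mulr_ge0 ?sqr_ge0// ltW.
      by case: C6.
    by rewrite LE; ring.
  have h : 8 / L <= 2 * L by rewrite ler_pdivrMr//; nra.
  rewrite (_ : 8 * (B0 * G / L) = B0 * G * (8 / L)); last by field; rewrite gt_eqF.
  apply: (@le_trans _ _ (B0 * G * (2 * L))); first by rewrite ler_wpM2l.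
  apply: (step (2 * B0 * C1)); first by rewrite mulr_ge0// ltW.
    by case: C6.
  by rewrite LE; ring.
Qed.
Theorem theorem4p1 (R : realType) (K M C0 C1 : R) (M_gt0 : 0 < M) :
  exists2 C : R, 0 < C &
  forall (d : nat) (Om : set 'rV[R]_d) (T : R) (gamma : R -> R)
    (W : set ('rV[R]_d -> R)) (nW : ('rV[R]_d -> R) -> R)
    (P Q : R -> ('rV[R]_d -> R) -> 'rV[R]_d -> R)
    (f0 f1 : 'rV[R]_d -> R) (f0e f1e : R -> 'rV[R]_d -> R)
    (u ut : R -> 'rV[R]_d -> R),
  (1 <= d <= 3)%N -> regular_domain Om -> 0 < T ->
  (forall eps, 0 < eps < 1 -> 1 <= gamma eps) ->
  gamma eps @[eps --> 0^'+] --> +oo ->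
  perturbing Om W nW gamma C0 Q ->
  stabilized Om gamma C1 P ->
  (forall eps, 0 < eps < 1 -> twice_laplacian_plus Om W (P eps) (Q eps)) ->
  H1 Om f0 -> L2 Om f1 ->
  (forall eps, 0 < eps < 1 -> H1 Om (f0e eps) /\ L2 Om (f1e eps)) ->
  (forall eps, 0 < eps < 1 ->
    normH1 Om (f0e eps - f0) + norm2 Om (f1e eps - f1) <= eps) ->
  3 * C1 * T < 2 ->
  (exists2 l : R, gamma eps ^+ 2 * eps @[eps --> 0^'+] --> l & l <= K) ->
  original_solution Om T f0 f1 u ut ->
  Ctime T W nW u -> L2time T W nW ut ->
  (forall u' ut', original_solution Om T f0 f1 u' ut' ->
    Ctime T W nW u' -> L2time T W nW ut' ->
    forall t, t \in `[0, T] -> eq_ae Om (u' t) (u t)) ->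
  ((sup [set nW (u t) | t in `[0, T]] ^+ 2)%:E
    + \int[lebesgue_measure]_(t in `]0%R, T[) (nW (ut t) ^+ 2)%:E <= M%:E)%E ->
  exists2 eps0 : R, 0 < eps0 < 1 &
  forall eps : R, 0 < eps < eps0 -> expR (2 / C1) <= gamma eps ->
  forall (rho : R) (ue uet : R -> 'rV[R]_d -> R), 1 < rho ->
  regularized_solution Om T (P eps) rho (f0e eps) (f1e eps) ue uet ->
  forall t : R, t \in `[0, T] ->
  [/\ norm2 Om (ue t - u t) ^+ 2 <=
        C * (eps + (ln (gamma eps))^-1
                     * gamma eps `^ (3 * C1 * (T - t) - 2)),
      normv2 Om (wgrad Om (ue t) - wgrad Om (u t)) ^+ 2 <=
        C * (ln (gamma eps) * eps + gamma eps `^ (3 * C1 * (T - t) - 2)) &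
      ((norm2 Om (uet t - ut t) ^+ 2)%:E
        + \int[lebesgue_measure]_(s in `[t, T])
            (normv2 Om (wgrad Om (uet s) - wgrad Om (ut s)) ^+ 2)%:E <=
        (C * (ln (gamma eps) ^+ 2 * eps
              + ln (gamma eps) * gamma eps `^ (3 * C1 * (T - t) - 2)))%:E)%E].
Proof.
(* The constant is chosen before the operators are introduced, so the sign of [C1] is not known yet;
   for [C1 <= 0] there is no stabilized operator. *)
have [C10|C10] := leP C1 0.
  by exists 1 => // *; exfalso; match goal with H : stabilized _ _ _ _ |- _ => move: H => [] end; rewrite ltNge C10.
(* [K'] lies strictly above the limit of [gamma^2 eps]. In [B0] the factor [2 / (3 C1)] stands for
   [T], on which the constant may not depend, and 8 is the 4 of [4 / L] times the 2 of
   [(a + a')^2 <= 2 a^2 + 2 a'^2]. *)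
pose K' := `|K| + 1; pose B0 := 8 * C0 ^+ 2 * (2 / (3 * C1) + 1) * M.
have K'0 : 0 < K' by rewrite ltr_pwDr.
have B00 : 0 <= B0.
  apply: mulr_ge0 (ltW M_gt0); apply: mulr_ge0; first by rewrite mulr_ge0// sqr_ge0.
  by rewrite addr_ge0// divr_ge0// mulr_ge0// ltW.
pose C := 4 * K' + B0 / (2 * C1) + 4 * C1 * K' + B0 / 2 + 16 * C1 ^+ 2 * K' + 2 * B0 * C1 + 1.
have Cpos : 0 < C.
  have K'1 := ltW K'0; have C11 := ltW C10.
  rewrite ltr_pwDr// !addr_ge0 ?divr_ge0//; try by rewrite !mulr_ge0.
  by apply: mulr_ge0 => //; rewrite mulr_ge0// sqr_ge0.
exists C => // d Om T gamma W nW P Q f0 f1 f0e f1e u ut _ dom T0 g1 _ HQ HP PQ f0H f1L feH fe CT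
  [l gl lK] Hu cu Lut _ HM.
have oOm := domain_open dom; have [C00 HW HQ2] := HQ; have [_ HP2] := HP.
have Xb := semi_dot_dot oOm.
have [h [hi h0 hae hI]] := source_majorant HW T0 cu Lut HM.
have [r r0 rP] : exists2 r : R, 0 < r & forall eps, 0 < eps < r -> gamma eps ^+ 2 * eps <= K'.
  have lK' : l < K' by rewrite (le_lt_trans lK)// (le_lt_trans (ler_norm K))// ltrDl.
  have /= [r /= r0 H] := cvgr_lt _ gl _ lK'.
  exists r => // eps /andP[e0 er]; apply/ltW/H => //=.
  by rewrite sub0r normrN gtr0_norm.
exists (Num.min r (1 / 2)); first by rewrite lt_min r0 gt_min /= !divr_gt0//= orbC ltr_pdivrMr// mul1r ltr1n.
move=> eps /andP[e0]; rewrite lt_min => /andP[er e12] ge rho ue uet rho1 Hue t tT.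
have e1 : 0 < eps < 1 by rewrite e0 (lt_trans e12)// ltr_pdivrMr// mul1r ltr1n.
have gp : 0 < gamma eps := lt_le_trans (expR_gt0 _) ge.
pose lg := ln (gamma eps); pose L := C1 * lg.
have lg2 : 2 / C1 <= lg by rewrite -[leLHS]expRK ler_ln ?posrE ?expR_gt0.
have L_ge2 : 2 <= L by rewrite /L mulrC -ler_pdivrMr.
have lg0 : 0 <= lg by apply: le_trans lg2; rewrite divr_ge0// ltW.
have [linP bP] := HP2 eps e1; have [linQ bQ] := HQ2 eps e1.
have [f0eH f1eL] := feH eps e1.
have PL a f f' psi : L2 Om f -> L2 Om f' -> L2 Om psi ->
    dot Om (P eps (a *: f + f')) psi = a * dot Om (P eps f) psi + dot Om (P eps f') psi.
  move=> fL fL' pL; rewrite (dot_ae _ (linear_L2_linear linP a fL fL')).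
  by rewrite (sdL Xb)//; exact: (linear_L2_stable linP).
pose c := C0 / gamma eps; pose k2 t := 2 * c ^+ 2 * h t.
have k2i : (@lebesgue_measure R).-integrable `[0, T] (EFin \o k2).
  by rewrite (_ : _ \o _ = fun t => ((2 * c ^+ 2)%:E * (h t)%:E)%E)//; apply: integrableZl.
have k20 s : 0 <= k2 s by apply: mulr_ge0 => //; rewrite mulr_ge0// sqr_ge0.
have [utt [ev _ _ _]] := Hu.
have uH s := evolution_H10 oOm T0 ev (t := s).
have utH := evolution_dt_H10 oOm T0 ev.
have PXs f : L2 Om f -> L2 Om (P eps f) by exact: (linear_L2_stable linP).
have defect psi : test_fun Om psi -> {ae @lebesgue_measure R, forall t, t \in `]0, T[ ->
    ((dot Om (P eps (u t)) psi - 2 * dot Om (u t) (lap psi)) +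
     (dot Om (P eps (ut t)) psi - 2 * dot Om (ut t) (lap psi))) ^+ 2 <= k2 t * dot Om psi psi}.
  move=> tpsi; have pL := test_fun_L2 oOm tpsi; rewrite -H10E in uH utH.
  (* Almost every time puts [ut s] both in [W] and in [H10], which is where [twice_laplacian_plus]
     identifies [P - 2 Lap] with [Q]. *)
  apply: ae_imp2 hae utH => s hs us sT; have [Wut hle] := hs sT.
  have sT' : s \in `[0, T] by exact: subset_itv_oo_cc sT.
  have Wu : W (u s) := (cu s sT').1.
  rewrite (laplacian_defect oOm HW (PQ eps e1) linQ (uH s sT') Wu tpsi).
  rewrite (laplacian_defect oOm HW (PQ eps e1) linQ (us sT) Wut tpsi).
  rewrite -(sdnorm_sqr Xb pL).
  have Qb f : W f -> `|dot Om (Q eps f) psi| <= c * nW f * sdnorm (dot Om) psi.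
    move=> Wf; have QL := linear_L2_stable linQ (fspace_L2 HW Wf).
    apply: le_trans (sd_CS Xb QL pL) _; rewrite ler_wpM2r ?sdnorm_ge0//.
    by rewrite /c mulrAC; exact: bQ.
  exact: (defect_algebra (sdnorm_ge0 _) (Qb _ Wu) (Qb _ Wut) hle).
have [b1 b2 b3] := comparison oOm T0 L_ge2 PXs PL (bP : forall f, L2 Om f -> norm2 Om (P eps f) <= L * norm2 Om f)
  f0H f1L f0eH f1eL (fe eps e1) Hu Hue k2i k20 defect tT.
set B := (X in _ <= 2 * X) in b1 b2; rewrite -/B in b3.
pose G := gamma eps `^ (3 * C1 * (T - t) - 2).
have GE : G = expR ((3 * C1 * (T - t) - 2) * lg) by rewrite /G /powR gt_eqF.
have gE : gamma eps ^+ 2 = expR (2 * lg) by rewrite expRM_natl lnK ?posrE.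
(* The exponent is nonpositive because [3 C1 (T - t) <= 3 C1 T < 2]. *)
have G01 : 0 <= G <= 1.
  rewrite GE expR_ge0/= -[leRHS]expR0 ler_expR mulr_le0_ge0//.
  move: tT; rewrite in_itv/= => /andP[t0 _]; rewrite subr_le0.
  by apply: (le_trans _ (ltW CT)); rewrite ler_wpM2l ?gerBl// mulr_ge0// ltW.
have BB : B <= 2 * L ^+ 2 * K' * eps + B0 * G / L.
  have -> : B = expR (3 * L * (T - t)) * (2 * L ^+ 2 * eps ^+ 2 + 4 / L *
      (2 * C0 ^+ 2 / gamma eps ^+ 2 * \int[lebesgue_measure]_(t in `[0, T]) h t)).
    rewrite /B /k2 RintegralZl//; congr (_ * (_ + _ * (_ * _))).
    by rewrite /c expr_div_n mulrA.
  apply: amplification_algebra => //; first by lra.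
  - by rewrite exprn_gt0.
  (* The amplification [e^(3 L (T - t))] is [gamma] to the power [3 C1 (T - t)], split as [G] times
     the square of [gamma]. *)
  - by rewrite GE gE -expRD /L; congr expR; ring.
  - by apply: rP; rewrite e0.
  have TC : T <= 2 / (3 * C1) by rewrite ler_pdivlMr ?mulr_gt0// mulrC ltW.
  rewrite (_ : B0 = 4 * (2 * C0 ^+ 2 * ((2 / (3 * C1) + 1) * M))); last by rewrite /B0; ring.
  apply: ler_wpM2l => //; apply: ler_wpM2l; first by rewrite mulr_ge0// sqr_ge0.
  by apply: le_trans hI _; rewrite ler_wpM2r ?(ltW M_gt0)// lerD2r.
have [q1 q2 q3] := rate_algebra C10 (erefl L) L_ge2 (ltW K'0) e0 (proj1 (andP G01)) B00 BB (erefl C).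
split; [exact: q1|exact: q2|].
by apply: le_trans b3 _; rewrite lee_fin.
Qed.
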